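(* Let $\pi:M(c)\to N$ be an anti-invariant submersion from a quaternionic space form $(M(c),g_M)$ onto a Riemannian manifold $(N,g_N)$, and let $\{U_1,\dots,U_r\}$, $\{X_1,\dots,X_\ell\}$ be local orthonormal frames of $\mathcal V$ and $\mathcal H$. Then $$\hat\tau+\tau^*\le\frac c4\Big((\ell+r)(\ell+r-1)+\sum_{\alpha=1}^3\sum_{i=1}^\ell\big(6\|B_{J_\alpha}X_i\|^2+3\|C_{J_\alpha}X_i\|^2\big)\Big)-r^2\|H\|^2+\|\mathcal T^{\mathcal H}\|^2+2\delta(N)-2\|\mathcal T^{\mathcal V}\|^2+2\|\mathcal A^{\mathcal H}\|^2$$ and $$\hat\tau+\tau^*\ge\frac c4\Big((\ell+r)(\ell+r-1)+\sum_{\alpha=1}^3\sum_{i=1}^\ell\big(6\|B_{J_\alpha}X_i\|^2+3\|C_{J_\alpha}X_i\|^2\big)\Big)-r^2\|H\|^2+\|\mathcal T^{\mathcal H}\|^2-3\|\mathcal A^{\mathcal V}\|^2+2\delta(N)-2\|\mathcal T^{\mathcal V}\|^2 .$$ In each of the two inequalities, equality holds for all $p\in M$ if and only if the horizontal distribution $\mathcal H$ is integrable.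
   Context: An almost quaternionic Hermitian manifold $(M,E,g_M)$ is a $4m$-dimensional Riemannian manifold with a rank 3 subbundle $E\subset \mathrm{End}(TM)$ having, near each point, a local basis $\{J_1,J_2,J_3\}$ of sections with $J_\alpha^2=-\mathrm{id}$, $J_\alpha J_{\alpha+1}=-J_{\alpha+1}J_\alpha=J_{\alpha+2}$ (indices mod 3) and $g_M(J_\alpha X,J_\alpha Y)=g_M(X,Y)$. It is quaternionic Kähler if there are local 1-forms $\omega_1,\omega_2,\omega_3$ with $\nabla_XJ_\alpha=\omega_{\alpha+2}(X)J_{\alpha+1}-\omega_{\alpha+1}(X)J_{\alpha+2}$, $\nabla$ the Levi-Civita connection. A quaternionic space form $M(c)$ ($c\in\mathbb R$) is a quaternionic Kähler manifold whose curvature tensor is $$R(X,Y)Z=\tfrac c4\Big\{g_M(Y,Z)X-g_M(X,Z)Y+\sum_{\alpha=1}^3\big(g_M(J_\alpha Y,Z)J_\alpha X-g_M(J_\alpha X,Z)J_\alpha Y+2g_M(J_\alpha Y,X)J_\alpha Z\big)\Big\}.$$ A Riemannian submersion $\pi:(M,g_M)\to(N,g_N)$ ($\dim M>\dim N$) is a smooth surjective map of maximal rank whose differential restricted to $(\ker\pi_* )^\perp$ is a linear isometry. Write $\mathcal V=\ker\pi_*$ (vertical), $\mathcal H=(\ker\pi_* )^\perp$ (horizontal), $r=\dim\mathcal V$, $\ell=\dim\mathcal H$, and use the same letters for the orthogonal projections. The submersion $\pi$ is anti-invariant if $J_\alpha(\ker\pi_* )\subset(\ker\pi_* )^\perp$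 for $\alpha=1,2,3$. For horizontal $X$ write $J_\alpha X=B_{J_\alpha}X+C_{J_\alpha}X$ with $B_{J_\alpha}X$ vertical and $C_{J_\alpha}X$ horizontal; $\|B_{J_\alpha}X_i\|^2=\sum_{k=1}^r g_M(B_{J_\alpha}X_i,U_k)^2$, $\|C_{J_\alpha}X_i\|^2=\sum_{j=1}^\ell g_M(C_{J_\alpha}X_i,X_j)^2$. O'Neill tensors: $\mathcal A_EF=\mathcal H\nabla_{\mathcal HE}\mathcal VF+\mathcal V\nabla_{\mathcal HE}\mathcal HF$, $\mathcal T_EF=\mathcal H\nabla_{\mathcal VE}\mathcal VF+\mathcal V\nabla_{\mathcal VE}\mathcal HF$; $\mathcal H$ is integrable iff $\mathcal A$ vanishes identically. Notation: $\|\mathcal T^{\mathcal V}\|^2=\sum_{i=1}^\ell\sum_{k=1}^r\|\mathcal T_{U_k}X_i\|^2$, $\|\mathcal T^{\mathcal H}\|^2=\sum_{j,k=1}^r\|\mathcal T_{U_j}U_k\|^2$, $\|\mathcal A^{\mathcal V}\|^2=\sum_{i,j=1}^\ell\|\mathcal A_{X_i}X_j\|^2$, $\|\mathcal A^{\mathcal H}\|^2=\sum_{i=1}^\ell\sum_{k=1}^r\|\mathcal A_{X_i}U_k\|^2$. Put $N=\sum_{j=1}^r\mathcal T_{U_j}U_j$ (a horizontal vector field, not to be confused with the target manifold), $H=\frac1rN$ (mean curvature of the fibers), and $\delta(N)=\sum_{i=1}^\ell g_M(\nabla_{X_i}N,X_i)=\sum_{i=1}^\ell\sum_{k=1}^r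 g_M((\nabla_{X_i}\mathcal T)(U_k,U_k),X_i)$. Curvature convention: $R(X,Y,Z,W)=g_M(R(X,Y)Z,W)$; $\hat R$ is the curvature tensor of the vertical distribution (fibers) and $R^*$ that of the horizontal distribution (horizontal lift of the curvature tensor $R'$ of the target: $\pi_*(R^*(X,Y)Z)=R'(\pi_*X,\pi_*Y)\pi_*Z$). They satisfy, for vertical $U,V,F,W$ and horizontal $X,Y,Z,Z'$, $$R(U,V,F,W)=\hat R(U,V,F,W)+g_M(\mathcal T_UW,\mathcal T_VF)-g_M(\mathcal T_VW,\mathcal T_UF),$$ $$R(X,Y,Z,Z')=R^*(X,Y,Z,Z')-2g_M(\mathcal A_XY,\mathcal A_ZZ')+g_M(\mathcal A_YZ,\mathcal A_XZ')-g_M(\mathcal A_XZ,\mathcal A_YZ'),$$ $$R(X,V,Y,W)=g_M((\nabla_X\mathcal T)(V,W),Y)+g_M((\nabla_V\mathcal A)(X,Y),W)-g_M(\mathcal T_VX,\mathcal T_WY)+g_M(\mathcal A_YW,\mathcal A_XV);$$ the sign of the curvature tensors is the one for which these hold, i.e. $R(X,Y)Z=\nabla_{[X,Y]}Z-\nabla_X\nabla_YZ+\nabla_Y\nabla_XZ$. Finally $\hat\tau=\sum_{i,j=1}^r\hat R(U_j,U_i,U_i,U_j)$ and $\tau^*=\sum_{i,j=1}^\ell R^*(X_i,X_j,X_j,X_i)$. *)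

(* Defs.v *)
From mathcomp Require Import all_boot all_order all_algebra.
From mathcomp Require Import all_classical all_reals.
From mathcomp Require Import topology normedtype derive.

Set Implicit Arguments.
Unset Strict Implicit.
Unset Printing Implicit Defensive.

Import Order.TTheory GRing.Theory Num.Theory numFieldNormedType.Exports.
Local Open Scope classical_set_scope.
Local Open Scope ring_scope.

(* Meaningful for U open: 'D_v f x only depends on f near x.                  *)
Fixpoint C_on (R : realType) (E F : normedModType R) (k : nat) (U : set E)
    (f : E -> F) : Prop :=
  (forall x, U x -> {for x, continuous f}) /\
  match k with
  | 0 => True
  | k'.+1 => forall v : E, (forall x, U x -> derivable f x v) /\
                           C_on k' U (fun x => 'D_v f x)
  end.

Definition Cinfty_on (R : realType) (E F : normedModType R) (U : set E)
    (f : E -> F) : Prop := forall k, C_on k U f.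

(* The atlas is indexed by the points: chart p is a chart around p, defined on
   chart_dom p (the functions chart p and chart_inv p are total, their values
   outside chart_dom p and its image are irrelevant).                         *)
Record manifold (R : realType) (n : nat) := Manifold {
  carrier :> topologicalType;
  chart_dom : carrier -> set carrier;
  chart : carrier -> carrier -> 'rV[R]_n;
  chart_inv : carrier -> 'rV[R]_n -> carrier;
  manifold_hausdorff : hausdorff_space carrier;
  manifold_second_countable : @second_countable carrier;
  chart_dom_open : forall p, open (chart_dom p);
  chart_dom_self : forall p, chart_dom p p;
  chart_img_open : forall p, open (chart p @` chart_dom p);
  chartK : forall p q, chart_dom p q -> chart_inv p (chart p q) = q;
  chart_continuous :
    forall p q, chart_dom p q -> {for q, continuous (chart p)};
  chart_inv_continuous : forall p y, (chart p @` chart_dom p) y ->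
    {for y, continuous (chart_inv p)};
  chart_transition : forall p q,
    Cinfty_on (chart p @` (chart_dom p `&` chart_dom q))
              (chart q \o chart_inv p) }.

(* A tangent vector at p is given by its components in the chart around p, so
   that T_pM is 'rV[R]_n; a vector field is a function M -> 'rV[R]_n, only used
   on open sets where it is smooth.                                           *)
Definition vfield (R : realType) (n : nat) (M : manifold R n) : Type :=
  M -> 'rV[R]_n.

Definition dfun (R : realType) (n : nat) (M : manifold R n)
    (F : normedModType R) (p : M) (v : 'rV[R]_n) (f : M -> F) : F :=
  'D_v (f \o chart_inv p) (chart p p).

Definition smooth_fun (R : realType) (n : nat) (M : manifold R n)
    (W : set M) (f : M -> R) : Prop :=
  forall p, Cinfty_on (chart p @` (chart_dom p `&` W))
                      ((f \o chart_inv p) : 'rV[R]_n -> R^o).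

Definition smooth_vfield (R : realType) (n : nat) (M : manifold R n)
    (W : set M) (X : vfield M) : Prop :=
  forall (W' : set M) (f : M -> R), open W' -> W' `<=` W -> smooth_fun W' f ->
  smooth_fun W' (fun q => dfun q (X q) (f : M -> R^o)).

Definition smooth_map (R : realType) (n k : nat) (M : manifold R n)
    (N : manifold R k) (pi : M -> N) : Prop :=
  continuous pi /\
  forall p q, Cinfty_on (chart p @` (chart_dom p `&` (pi @^-1` chart_dom q)))
                        (chart q \o pi \o chart_inv p).

(* Matrix of the differential of pi at p; since tangent vectors are rows, the
   pushforward of v is v *m dmap pi p.                                        *)
Definition dmap (R : realType) (n k : nat) (M : manifold R n)
    (N : manifold R k) (pi : M -> N) (p : M) : 'M[R]_(n, k) :=
  'J (chart (pi p) \o pi \o chart_inv p) (chart p p).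

(* XY - YX applied to the coordinate functions of the chart around p.         *)
Definition lie_bracket (R : realType) (n : nat) (M : manifold R n)
    (X Y : vfield M) : vfield M := fun p =>
  dfun p (X p) (fun q => dfun q (Y q) (chart p)) -
  dfun p (Y p) (fun q => dfun q (X q) (chart p)).

Definition gdot (R : realType) (n : nat) (M : manifold R n)
    (g : M -> 'M[R]_n) (p : M) (u v : 'rV[R]_n) : R :=
  (u *m g p *m v^T) 0 0.

Definition riemannian_metric (R : realType) (n : nat) (M : manifold R n)
    (g : M -> 'M[R]_n) : Prop :=
  [/\ forall p, (g p)^T = g p,
      forall p v, v != 0 -> 0 < gdot g p v v &
      forall (W : set M) (X Y : vfield M), open W ->
        smooth_vfield W X -> smooth_vfield W Y ->
        smooth_fun W (fun q => gdot g q (X q) (Y q))].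

(* nabla p v Y is the covariant derivative at p, in the direction v, of the
   (local) vector field Y; a connection in this form is C^infty-linear in the
   direction and local by design.                                             *)
Definition connection (R : realType) (n : nat) (M : manifold R n) : Type :=
  M -> 'rV[R]_n -> vfield M -> 'rV[R]_n.

Record levi_civita (R : realType) (n : nat) (M : manifold R n)
    (g : M -> 'M[R]_n) (nabla : connection M) : Prop := LeviCivita {
  nabla_smooth : forall (W : set M) (X Y : vfield M), open W ->
    smooth_vfield W X -> smooth_vfield W Y ->
    smooth_vfield W (fun q => nabla q (X q) Y);
  nabla_local : forall (W : set M) (Y Y' : vfield M), open W ->
    smooth_vfield W Y -> (forall q, W q -> Y q = Y' q) ->
    forall q v, W q -> nabla q v Y = nabla q v Y';
  nabla_linear : forall (W : set M) (Y : vfield M), open W ->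
    smooth_vfield W Y ->
    forall q a u v, W q ->
    nabla q (a *: u + v) Y = a *: nabla q u Y + nabla q v Y;
  nabla_additive : forall (W : set M) (Y Z : vfield M), open W ->
    smooth_vfield W Y -> smooth_vfield W Z ->
    forall q v, W q ->
    nabla q v (fun x => Y x + Z x) = nabla q v Y + nabla q v Z;
  nabla_leibniz : forall (W : set M) (f : M -> R) (Y : vfield M), open W ->
    smooth_fun W f -> smooth_vfield W Y ->
    forall q v, W q ->
    nabla q v (fun x => f x *: Y x) =
      dfun q v (f : M -> R^o) *: Y q + f q *: nabla q v Y;
  nabla_torsion_free : forall (W : set M) (X Y : vfield M), open W ->
    smooth_vfield W X -> smooth_vfield W Y ->
    forall q, W q ->
    nabla q (X q) Y - nabla q (Y q) X = lie_bracket X Y q;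
  nabla_metric : forall (W : set M) (Y Z : vfield M), open W ->
    smooth_vfield W Y -> smooth_vfield W Z ->
    forall q v, W q ->
    dfun q v ((fun x => gdot g x (Y x) (Z x)) : M -> R^o) =
      gdot g q (nabla q v Y) (Z q) + gdot g q (Y q) (nabla q v Z) }.

(* The Levi-Civita connection exists and is unique on smooth fields; carrying
   it in the record is a convenience and not additional structure.            *)
Record riemannian (R : realType) (n : nat) := Riemannian {
  rmanifold :> manifold R n;
  metric : rmanifold -> 'M[R]_n;
  conn : connection rmanifold;
  metricP : riemannian_metric metric;
  connP : levi_civita metric conn }.

Definition ip (R : realType) (n : nat) (M : riemannian R n) (p : M)
    (u v : 'rV[R]_n) : R := gdot (@metric R n M) p u v.

Definition nsq (R : realType) (n : nat) (M : riemannian R n) (p : M)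
    (v : 'rV[R]_n) : R := ip p v v.

(* O'Neill's sign: R(X,Y)Z = nabla_[X,Y] Z - nabla_X nabla_Y Z
                             + nabla_Y nabla_X Z.                             *)
Definition curv (R : realType) (n : nat) (M : manifold R n)
    (nabla : connection M) (X Y Z : vfield M) : vfield M := fun p =>
  nabla p (lie_bracket X Y p) Z
  - nabla p (X p) (fun q => nabla q (Y q) Z)
  + nabla p (Y p) (fun q => nabla q (X q) Z).

(* The field with the same components as v in the chart around p.             *)
Definition const_ext (R : realType) (n : nat) (M : manifold R n) (p : M)
    (v : 'rV[R]_n) : vfield M := fun q =>
  'D_v (chart q \o chart_inv p) (chart p q).

(* The curvature tensor on tangent vectors; being a tensor, it does not depend
   on the chosen local extensions.                                            *)
Definition curv_at (R : realType) (n : nat) (M : manifold R n)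
    (nabla : connection M) (p : M) (x y z : 'rV[R]_n) : 'rV[R]_n :=
  curv nabla (const_ext p x) (const_ext p y) (const_ext p z) p.

(* The indices a + 1 and a + 2 are computed in the ring 'I_3, i.e. mod 3.      *)
Record canonical_basis (R : realType) (n : nat) (M : riemannian R n)
    (E : M -> {vspace 'End('rV[R]_n)}) (W : set M)
    (J : 'I_3 -> M -> 'End('rV[R]_n)) : Prop := CanonicalBasis {
  cb_open : open W;
  cb_smooth : forall (a : 'I_3) (W' : set M) (X : vfield M),
    open W' -> W' `<=` W -> smooth_vfield W' X ->
    smooth_vfield W' (fun q => J a q (X q));
  cb_basis : forall q, W q -> basis_of (E q) [seq J a q | a <- enum 'I_3];
  cb_sqr : forall q, W q -> forall (a : 'I_3) v, J a q (J a q v) = - v;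
  cb_mul : forall q, W q -> forall (a : 'I_3) v,
    J a q (J (a + 1) q v) = J (a + 2) q v;
  cb_anti : forall q, W q -> forall (a : 'I_3) v,
    - J (a + 1) q (J a q v) = J (a + 2) q v;
  cb_hermitian : forall q, W q -> forall (a : 'I_3) u v,
    ip q (J a q u) (J a q v) = ip q u v }.

Definition almost_quaternionic_hermitian (R : realType) (n : nat)
    (M : riemannian R n) (E : M -> {vspace 'End('rV[R]_n)}) : Prop :=
  forall p : M, exists (W : set M) (J : 'I_3 -> M -> 'End('rV[R]_n)),
    W p /\ canonical_basis E W J.

(* The 1-form w a is given by its columns of components:
   w_a(v) = (v *m w a q) 0 0 for v tangent at q.                              *)
Definition quaternionic_kahler (R : realType) (n : nat)
    (M : riemannian R n) (E : M -> {vspace 'End('rV[R]_n)}) : Prop :=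
  almost_quaternionic_hermitian E /\
  forall p : M, exists (W : set M) (J : 'I_3 -> M -> 'End('rV[R]_n))
      (w : 'I_3 -> M -> 'cV[R]_n),
    [/\ W p, canonical_basis E W J,
        forall (a : 'I_3) (W' : set M) (X : vfield M),
          open W' -> W' `<=` W -> smooth_vfield W' X ->
          smooth_fun W' (fun q => (X q *m w a q) 0 0) &
        forall (a : 'I_3) (W' : set M) (Y : vfield M),
          open W' -> W' `<=` W -> smooth_vfield W' Y ->
          forall q v, W' q ->
          conn q v (fun x => J a x (Y x)) - J a q (conn q v Y) =
            (v *m w (a + 2) q) 0 0 *: J (a + 1) q (Y q)
            - (v *m w (a + 1) q) 0 0 *: J (a + 2) q (Y q)].

Definition quaternionic_space_form (R : realType) (n : nat)
    (M : riemannian R n) (E : M -> {vspace 'End('rV[R]_n)}) (c : R) : Prop :=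
  quaternionic_kahler E /\
  forall (W : set M) (J : 'I_3 -> M -> 'End('rV[R]_n)),
    canonical_basis E W J ->
  forall X Y Z : vfield M,
    smooth_vfield W X -> smooth_vfield W Y -> smooth_vfield W Z ->
  forall q, W q ->
    curv (@conn R n M) X Y Z q =
    (c / 4) *: (ip q (Y q) (Z q) *: X q - ip q (X q) (Z q) *: Y q
      + \sum_(a < 3) (ip q (J a q (Y q)) (Z q) *: J a q (X q)
                      - ip q (J a q (X q)) (Z q) *: J a q (Y q)
                      + (2 * ip q (J a q (Y q)) (X q)) *: J a q (Z q))).

(* The vertical and horizontal spaces at p are the row spaces of these.       *)
Definition vertical (R : realType) (n k : nat) (M : riemannian R n)
    (N : riemannian R k) (pi : M -> N) (p : M) : 'M[R]_n :=
  kermx (dmap pi p).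

Definition horizontal (R : realType) (n k : nat) (M : riemannian R n)
    (N : riemannian R k) (pi : M -> N) (p : M) : 'M[R]_n :=
  kermx (metric p *m (vertical pi p)^T).

Record riemannian_submersion (R : realType) (n k : nat)
    (M : riemannian R n) (N : riemannian R k) (pi : M -> N) : Prop :=
  RiemannianSubmersion {
  rs_dim : (k < n)%N;
  rs_smooth : smooth_map pi;
  rs_surj : forall y : N, exists p, pi p = y;
  rs_rank : forall p, \rank (dmap pi p) = k;
  rs_isometry : forall p u v,
    (u <= horizontal pi p)%MS -> (v <= horizontal pi p)%MS ->
    ip (pi p) (u *m dmap pi p) (v *m dmap pi p) = ip p u v }.

Definition anti_invariant (R : realType) (n k : nat)
    (M : riemannian R n) (N : riemannian R k)
    (E : M -> {vspace 'End('rV[R]_n)}) (pi : M -> N) : Prop :=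
  forall (W : set M) (J : 'I_3 -> M -> 'End('rV[R]_n)),
    canonical_basis E W J ->
  forall q (a : 'I_3) v, W q ->
    (v <= vertical pi q)%MS -> (J a q v <= horizontal pi q)%MS.

Definition ver (R : realType) (n k : nat) (M : riemannian R n)
    (N : riemannian R k) (pi : M -> N) (p : M) (v : 'rV[R]_n) : 'rV[R]_n :=
  v *m proj_mx (vertical pi p) (horizontal pi p).

Definition hor (R : realType) (n k : nat) (M : riemannian R n)
    (N : riemannian R k) (pi : M -> N) (p : M) (v : 'rV[R]_n) : 'rV[R]_n :=
  v *m proj_mx (horizontal pi p) (vertical pi p).

Definition horizontal_integrable (R : realType) (n k : nat)
    (M : riemannian R n) (N : riemannian R k) (pi : M -> N) : Prop :=
  forall (W : set M) (X Y : vfield M), open W ->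
    smooth_vfield W X -> smooth_vfield W Y ->
    (forall q, W q -> (X q <= horizontal pi q)%MS) ->
    (forall q, W q -> (Y q <= horizontal pi q)%MS) ->
    forall q, W q -> (lie_bracket X Y q <= horizontal pi q)%MS.

Definition oneill_A (R : realType) (n k : nat)
    (M : riemannian R n) (N : riemannian R k) (pi : M -> N)
    (E F : vfield M) : vfield M := fun p =>
  hor pi p (conn p (hor pi p (E p)) (fun q => ver pi q (F q)))
  + ver pi p (conn p (hor pi p (E p)) (fun q => hor pi q (F q))).

Definition oneill_T (R : realType) (n k : nat)
    (M : riemannian R n) (N : riemannian R k) (pi : M -> N)
    (E F : vfield M) : vfield M := fun p =>
  hor pi p (conn p (ver pi p (E p)) (fun q => ver pi q (F q)))
  + ver pi p (conn p (ver pi p (E p)) (fun q => hor pi q (F q))).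

(* On vertical fields this restricts to the Levi-Civita connections of the
   fibers.                                                                    *)
Definition vconn (R : realType) (n k : nat)
    (M : riemannian R n) (N : riemannian R k) (pi : M -> N) : connection M :=
  fun p v Y => ver pi p (conn p v Y).

(* The horizontal vector at p that dmap pi p sends to w.                      *)
Definition hlift (R : realType) (n k : nat)
    (M : riemannian R n) (N : riemannian R k) (pi : M -> N) (p : M)
    (w : 'rV[R]_k) : 'rV[R]_n := hor pi p (w *m pinvmx (dmap pi p)).

Definition curv_vert (R : realType) (n k : nat)
    (M : riemannian R n) (N : riemannian R k) (pi : M -> N)
    (U V W : vfield M) : vfield M := curv (vconn pi) U V W.

Definition curv_hor (R : realType) (n k : nat)
    (M : riemannian R n) (N : riemannian R k) (pi : M -> N)
    (p : M) (x y z : 'rV[R]_n) : 'rV[R]_n :=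
  hlift pi p (curv_at (@conn R k N) (pi p)
    (x *m dmap pi p) (y *m dmap pi p) (z *m dmap pi p)).

(* D q is a subspace of T_qM, given as a row space.                           *)
Definition orthonormal_frame (R : realType) (n s : nat) (M : riemannian R n)
    (D : M -> 'M[R]_n) (W : set M) (U : 'I_s -> vfield M) : Prop :=
  [/\ forall i, smooth_vfield W (U i),
      forall q, W q -> forall i j, ip q (U i q) (U j q) = (i == j)%:R &
      forall q, W q -> (\matrix_(i < s) U i q == D q)%MS].

Definition scal_vert (R : realType) (n k r : nat)
    (M : riemannian R n) (N : riemannian R k) (pi : M -> N)
    (U : 'I_r -> vfield M) (p : M) : R :=
  \sum_(i < r) \sum_(j < r)
    ip p (curv_vert pi (U j) (U i) (U i) p) (U j p).

Definition scal_hor (R : realType) (n k l : nat)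
    (M : riemannian R n) (N : riemannian R k) (pi : M -> N)
    (X : 'I_l -> vfield M) (p : M) : R :=
  \sum_(i < l) \sum_(j < l)
    ip p (curv_hor pi p (X i p) (X j p) (X j p)) (X i p).

Definition normB2 (R : realType) (n k r : nat)
    (M : riemannian R n) (N : riemannian R k) (pi : M -> N)
    (U : 'I_r -> vfield M) (J : M -> 'End('rV[R]_n)) (x : 'rV[R]_n)
    (p : M) : R :=
  \sum_(j < r) ip p (ver pi p (J p x)) (U j p) ^+ 2.

Definition normC2 (R : realType) (n k l : nat)
    (M : riemannian R n) (N : riemannian R k) (pi : M -> N)
    (X : 'I_l -> vfield M) (J : M -> 'End('rV[R]_n)) (x : 'rV[R]_n)
    (p : M) : R :=
  \sum_(j < l) ip p (hor pi p (J p x)) (X j p) ^+ 2.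

Definition normTV2 (R : realType) (n k r l : nat)
    (M : riemannian R n) (N : riemannian R k) (pi : M -> N)
    (U : 'I_r -> vfield M) (X : 'I_l -> vfield M) (p : M) : R :=
  \sum_(i < l) \sum_(j < r) nsq p (oneill_T pi (U j) (X i) p).

Definition normTH2 (R : realType) (n k r : nat)
    (M : riemannian R n) (N : riemannian R k) (pi : M -> N)
    (U : 'I_r -> vfield M) (p : M) : R :=
  \sum_(i < r) \sum_(j < r) nsq p (oneill_T pi (U i) (U j) p).

Definition normAV2 (R : realType) (n k l : nat)
    (M : riemannian R n) (N : riemannian R k) (pi : M -> N)
    (X : 'I_l -> vfield M) (p : M) : R :=
  \sum_(i < l) \sum_(j < l) nsq p (oneill_A pi (X i) (X j) p).

Definition normAH2 (R : realType) (n k r l : nat)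
    (M : riemannian R n) (N : riemannian R k) (pi : M -> N)
    (U : 'I_r -> vfield M) (X : 'I_l -> vfield M) (p : M) : R :=
  \sum_(i < l) \sum_(j < r) nsq p (oneill_A pi (X i) (U j) p).

Definition trT (R : realType) (n k r : nat)
    (M : riemannian R n) (N : riemannian R k) (pi : M -> N)
    (U : 'I_r -> vfield M) : vfield M := fun p =>
  \sum_(j < r) oneill_T pi (U j) (U j) p.

Definition mean_curvature (R : realType) (n k r : nat)
    (M : riemannian R n) (N : riemannian R k) (pi : M -> N)
    (U : 'I_r -> vfield M) : vfield M := fun p =>
  r%:R^-1 *: trT pi U p.

Definition delta_trT (R : realType) (n k r l : nat)
    (M : riemannian R n) (N : riemannian R k) (pi : M -> N)
    (U : 'I_r -> vfield M) (X : 'I_l -> vfield M) (p : M) : R :=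
  \sum_(i < l) ip p (conn p (X i p) (trT pi U)) (X i p).

Definition common_rhs (R : realType) (n k r l : nat)
    (M : riemannian R n) (N : riemannian R k) (pi : M -> N) (c : R)
    (J : 'I_3 -> M -> 'End('rV[R]_n))
    (U : 'I_r -> vfield M) (X : 'I_l -> vfield M) (p : M) : R :=
  c / 4 * ((l%:R + r%:R) * (l%:R + r%:R - 1)
    + \sum_(a < 3) \sum_(i < l)
        (6 * normB2 pi U (J a) (X i p) p + 3 * normC2 pi X (J a) (X i p) p))
  - r%:R ^+ 2 * nsq p (mean_curvature pi U p)
  + normTH2 pi U p + 2 * delta_trT pi U X p - 2 * normTV2 pi U X p.

Definition upper_rhs (R : realType) (n k r l : nat)
    (M : riemannian R n) (N : riemannian R k) (pi : M -> N) (c : R)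
    (J : 'I_3 -> M -> 'End('rV[R]_n))
    (U : 'I_r -> vfield M) (X : 'I_l -> vfield M) (p : M) : R :=
  common_rhs pi c J U X p + 2 * normAH2 pi U X p.

Definition lower_rhs (R : realType) (n k r l : nat)
    (M : riemannian R n) (N : riemannian R k) (pi : M -> N) (c : R)
    (J : 'I_3 -> M -> 'End('rV[R]_n))
    (U : 'I_r -> vfield M) (X : 'I_l -> vfield M) (p : M) : R :=
  common_rhs pi c J U X p - 3 * normAV2 pi X p.

Definition adapted_frames (R : realType) (n k r l : nat)
    (M : riemannian R n) (N : riemannian R k)
    (E : M -> {vspace 'End('rV[R]_n)}) (pi : M -> N) (W : set M)
    (U : 'I_r -> vfield M) (X : 'I_l -> vfield M)
    (J : 'I_3 -> M -> 'End('rV[R]_n)) : Prop :=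
  [/\ open W, orthonormal_frame (vertical pi) W U,
      orthonormal_frame (horizontal pi) W X & canonical_basis E W J].

(* Main.v *)
Require Import Defs.
From mathcomp Require Import all_boot all_order all_algebra.
From mathcomp Require Import all_classical all_reals.
From mathcomp Require Import topology normedtype derive.
From HB Require Import structures.
From mathcomp Require Import landau realfun ring.

Import Order.TTheory GRing.Theory Num.Theory numFieldNormedType.Exports.
Local Open Scope classical_set_scope.
Local Open Scope ring_scope.

Set Implicit Arguments.
Unset Strict Implicit.
Unset Printing Implicit Defensive.

(* Fix local orthonormal frames U of the vertical and X of the horizontal
   distribution and trace the curvature R(E_a, E_b, E_b, E_a) over their union.
   For a space form the trace is an algebraic expression in the J_a. O'Neill's
   equations for two vertical, two horizontal and one vertical and one
   horizontal vector express it through the scalar curvatures of the fibres and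
   of the base, |N|^2, |T|^2, |A|^2 and delta(N). As A_X is skew,
   |A^V| = |A^H| =: |A|, whence
     scal_vert + scal_hor = common_rhs - |A|^2,
   while upper_rhs = common_rhs + 2|A|^2 and lower_rhs = common_rhs - 3|A|^2.
   So both inequalities hold, with equality iff A = 0, i.e. iff the horizontal
   distribution is integrable.

   The curvature equation for two horizontal vectors is first obtained for basic
   lifts of fields on the base, for which pi maps brackets to brackets, so that
   the two Levi-Civita connections are compared by Koszul's formula. It carries
   over to the given frames because the curvature of a space form depends on
   the values of the fields only. *)

(** * Functions of class C^k *)

(** The mixed curvature equation is where the choice of frame matters. Written with the field T_U U
    in place of the tensor derivative of T, it carries an extra term -2 <V nabla_X U, V nabla_U X>.
    This vanishes only after summation over the frame U: one factor is skew in the frame indices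
    since the frame is orthonormal, the other symmetric since T is. The net coefficient -1 of |A|^2
    is -3 from the pairs of horizontal vectors plus +2 from the mixed pairs, each of which is
    counted twice in the trace. Equality is asserted for all adapted frames and says nothing near a
    point that has none; the converse therefore needs such frames around every point, and these are
    built by Gram-Schmidt. The analysis is there because C^k means iterated directional derivatives:
    differentiability, the chain rule and the symmetry of second derivatives are derived from it.
    The symmetry makes the bracket, defined through coordinate functions, act as a commutator on
    every smooth function, and the behaviour of brackets under [pi] rests on that. *)

Section Cdiff.
Variable (R : realType).

Section General.
Variables (E F : normedModType R).
Implicit Types (f g : E -> F) (U V : set E) (k : nat).

Lemma C_on_cont k U f : C_on k U f -> forall x, U x -> {for x, continuous f}.
Proof. by case: k => [|k] []. Qed.

Lemma C_onW k U f : C_on k.+1 U f -> C_on k U f.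
Proof.
elim: k f => [|k IH] f [cf df]; split=> // v.
by have [d1 d2] := df v; split=> //; exact: IH.
Qed.

Lemma C_on_sub k U V f : V `<=` U -> C_on k U f -> C_on k V f.
Proof.
move=> VU; elim: k f => [|k IH] f [cf df]; split; try by move=> x /VU; exact: cf.
  by [].
move=> v; have [d1 d2] := df v; split; first by move=> x /VU; exact: d1.
exact: IH.
Qed.

(** Every clause of [C_on] speaks about one point at a time, so the property can be checked at each
    point on a neighbourhood of its own. Smoothness on a manifold is local for this reason. *)
Lemma C_on_pt k U f : (forall x, U x -> C_on k [set x] f) -> C_on k U f.
Proof.
elim: k f => [|k IH] f H; split; try by move=> x /H /C_on_cont; exact.
  by [].
move=> v; split; first by move=> x /H [_ /(_ v) [+ _]]; exact.
by apply: IH => x /H [_ /(_ v) []].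
Qed.

Lemma C_on_ext k U f g : open U -> (forall x, U x -> f x = g x) ->
  C_on k U f -> C_on k U g.
Proof.
move=> oU; elim: k f g => [|k IH] f g fg Cf.
  split=> // x Ux; have [cf _] := Cf.
  have fgx : \forall y \near x, f y = g y.
    by apply: filterS (open_nbhs_nbhs (conj oU Ux)) => y; exact: fg.
  rewrite /prop_for /continuous_at -(fg _ Ux).
  by apply: cvg_trans (cf x Ux); exact: near_eq_cvg.
have fgx x : U x -> \forall y \near x, f y = g y.
  by move=> Ux; apply: filterS (open_nbhs_nbhs (conj oU Ux)) => y; exact: fg.
split.
  exact: C_on_cont (IH _ _ fg (C_onW Cf)).
move=> v; have [_ /(_ v) [d1 d2]] := Cf; split=> [x Ux|].
  exact: near_eq_derivable (fgx x Ux) (d1 x Ux).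
apply: IH d2 => x Ux; exact: near_eq_derive (fgx x Ux).
Qed.

Lemma C_on_cst k U (a : F) : C_on k U (fun=> a).
Proof.
elim: k a => [|k IH] a; split=> //; try by move=> x _; exact: cst_continuous.
move=> v; split=> [x _|]; first exact: derivable_cst.
have -> : 'D_v (fun=> a) = (fun=> 0) :> (E -> F).
  by apply/funext => x; exact: derive_cst.
exact: IH.
Qed.

Lemma C_onD k U f g : open U -> C_on k U f -> C_on k U g ->
  C_on k U (fun x => f x + g x).
Proof.
move=> oU; elim: k f g => [|k IH] f g [cf df] [cg dg].
  by split=> // x Ux; apply: continuousD; [exact: cf|exact: cg].
split=> [x Ux|v]; first by apply: continuousD; [exact: cf|exact: cg].
have [d1 d2] := df v; have [e1 e2] := dg v.
split=> [x Ux|]; first by apply: derivableD; [exact: d1|exact: e1].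
apply: C_on_ext (IH _ _ d2 e2) => // x Ux.
by rewrite (deriveD (d1 x Ux) (e1 x Ux)).
Qed.

End General.

Section Scalar.
Variables (E : normedModType R).
Implicit Types (f g : E -> R^o) (U V : set E) (k : nat).

(** Leibniz' rule leaves one factor undifferentiated, so the induction also uses both factors at the
    lower order, through [C_onW]. *)
Lemma C_onM k U f g : open U -> C_on k U f -> C_on k U g ->
  C_on k U (fun x => f x * g x : R^o).
Proof.
move=> oU; elim: k f g => [|k IH] f g Cf Cg.
  have [cf _] := Cf; have [cg _] := Cg.
  by split=> // x Ux; apply: continuousM; [exact: cf|exact: cg].
split=> [x Ux|v].
  by apply: continuousM; [exact: (C_on_cont Cf)|exact: (C_on_cont Cg)].
have [cf /(_ v) [d1 d2]] := Cf; have [cg /(_ v) [e1 e2]] := Cg.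
split=> [x Ux|]; first by apply: derivableM; [exact: d1|exact: e1].
have H : C_on k U (fun x => f x * 'D_v g x + g x * 'D_v f x : R^o).
  by apply: C_onD => //; apply: IH => //; exact: C_onW.
apply: C_on_ext H => // x Ux.
by rewrite (deriveM (d1 x Ux) (e1 x Ux)).
Qed.

Lemma C_on_sum k U (I : Type) (s : seq I) (h : I -> E -> R^o) : open U ->
  (forall i, C_on k U (h i)) -> C_on k U (fun x => \sum_(i <- s) h i x : R^o).
Proof.
move=> oU Ch; elim: s => [|i s IH].
  apply: (C_on_ext oU _ (@C_on_cst E R^o k U 0)) => x _; by rewrite big_nil.
apply: (C_on_ext oU _ (C_onD oU (Ch i) IH)) => x _; by rewrite big_cons.
Qed.

End Scalar.

Lemma continuous_entry (E : normedModType R) n (f : E -> 'rV[R]_n) x j :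
  {for x, continuous f} -> {for x, continuous (fun x => f x 0 j : R^o)}.
Proof.
move=> cf; apply: (@continuous_comp _ _ _ f (fun v : 'rV[R]_n => v 0 j : R^o)) => //.
exact: coord_continuous.
Qed.

Lemma C_on_row (E : normedModType R) n k (U : set E) (f : E -> 'rV[R]_n) :
  open U -> C_on k U f <-> forall j, C_on k U (fun x => f x 0 j : R^o).
Proof.
move=> oU; elim: k f => [|k IH] f; split=> [Cf j|Cf].
- have [cf _] := Cf; split=> // x Ux.
  exact/continuous_entry/cf.
- split=> // x Ux; apply/cvgrPdist_le => /= e e0.
  near=> y.
  rewrite /Num.Def.normr/= mx_normrE (bigmax_le _ (ltW e0))//= => -[i j] _.
  rewrite !mxE/= (ord1 i).
  move: j {i}; near: y; apply: filter_forall => /= i.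
  have [/(_ x Ux) ci _] := Cf i.
  by move/cvgrPdist_le : ci => /(_ _ e0).
- have [cf df] := Cf; split=> [x Ux|v].
    exact/continuous_entry/cf.
  have [d1 d2] := df v; split=> [x Ux|].
    by have /derivable_mxP := d1 x Ux; exact.
  have /IH/(_ j) := d2; apply: C_on_ext => // x Ux.
  by rewrite (derive_mx (d1 x Ux)) mxE.
- split.
    suff : C_on k U f by exact: C_on_cont.
    by apply/IH => j; exact: C_onW.
  move=> v.
  have d1 x : U x -> derivable f x v.
    move=> Ux; apply/derivable_mxP => i j; rewrite (ord1 i).
    by have [_ /(_ v) [+ _]] := Cf j; exact.
  split=> //; apply/IH => j.
  have [_ /(_ v) [_]] := Cf j; apply: C_on_ext => // x Ux.
  by rewrite (derive_mx (d1 x Ux)) mxE.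
Unshelve. all: by end_near. Qed.

(** * Mean values along a line *)

Section MeanValue.
Variable (E : normedModType R).
Implicit Types (f : E -> R^o).

Lemma is_derive_line f x v t : derivable f (t *: v + x) v ->
  is_derive t 1 (fun s : R => f (s *: v + x)) ('D_v f (t *: v + x)).
Proof.
have E0 : (fun h : R => h^-1 *: (((fun s : R => f (s *: v + x)) \o shift t) h%:A - f (t *: v + x)))
  = (fun h : R => h^-1 *: ((f \o shift (t *: v + x)) (h *: v) - f (t *: v + x))).
  by apply/funext => h /=; rewrite [h%:A]mulr1 scalerDl addrA.
by move=> df; split; rewrite /derivable /derive E0.
Qed.

Lemma mean_value_line f x v :
  (forall t, 0 <= t <= 1 -> derivable f (t *: v + x) v) ->
  exists2 t, 0 < t < 1 & f (v + x) - f x = 'D_v f (t *: v + x).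
Proof.
move=> df.
have := @MVT R (fun s : R => f (s *: v + x)) (fun t => 'D_v f (t *: v + x)) 0 1 ltr01.
case.
- move=> t /[!in_itv]/= /andP[t0 t1]; apply: is_derive_line.
  by apply: df; rewrite !ltW.
- apply: derivable_within_continuous => t /[!in_itv]/= t01.
  by have [] := is_derive_line (df t t01).
- move=> t /[!in_itv]/= t01; rewrite scale1r scale0r add0r subr0 mulr1 => H.
  by exists t.
Qed.

(** Derivability in the single direction [v] suffices: for [a != 0] the difference quotient along
    [a *: v] is [a] times the quotient along [v] with [a * h] in place of [h]. *)
Lemma derive_scale f x v (a : R) : derivable f x v ->
  derivable f x (a *: v) /\ 'D_(a *: v) f x = a * 'D_v f x.
Proof.
move=> df; have [->|a0] := eqVneq a 0.
  by rewrite scale0r mul0r; split; [exact: derivable0|exact: derive0].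
have := df; move=> /derivableP [_]; rewrite /derive.
have cv : (h^-1 *: ((f \o shift x) (h *: (a *: v)) - f x)) @[h --> 0^'] --> (a * 'D_v f x : R^o).
  have -> : (fun h : R => h^-1 *: ((f \o shift x) (h *: (a *: v)) - f x)) =
            (fun h : R => a *: ((a * h)^-1 *: ((f \o shift x) ((a * h) *: v) - f x))).
    by apply/funext => h; rewrite invfM !scalerA mulrA mulfV // mul1r [h * a]mulrC.
  apply: cvgZl_tmp.
  apply: (@cvg_comp _ _ _ (fun h => a * h) (fun h => h^-1 *: ((f \o shift x) (h *: v) - f x)) _ 0^').
    move=> A [e /= e0 eA].
    exists (e / `|a|); first by rewrite /= divr_gt0 // normr_gt0.
    move=> h; rewrite /ball_ /= !sub0r !normrN ltr_pdivlMr ?normr_gt0 // => he h0.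
    apply: eA; last by rewrite mulf_neq0.
    by rewrite /ball_ /= sub0r normrN normrM mulrC.
  exact: df.
move=> _; split; first by apply/cvg_ex; eexists; exact: cv.
exact: cvg_lim cv.
Qed.

End MeanValue.
End Cdiff.

Section LinearForm.
Variables (R : realType) (n : nat).

(** With the partial derivatives at a point as coefficients, this is the candidate for the
    differential there. *)
Definition linear_form (a : 'I_n -> R) (h : 'rV[R]_n) : R^o :=
  \sum_(j < n) h 0 j * a j.

Lemma linear_form_linear a : linear (linear_form a).
Proof.
move=> k u v; rewrite /linear_form scaler_sumr -big_split /=.
by apply: eq_bigr => j _; rewrite !mxE mulrDl scalerAl.
Qed.

HB.instance Definition _ a :=
  GRing.isLinear.Build R 'rV[R]_n R^o _ (linear_form a) (linear_form_linear a).

Lemma linear_form_continuous a : continuous (linear_form a).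
Proof.
rewrite (_ : linear_form a = \sum_(j < n) (fun h : 'rV[R]_n => h 0 j * a j : R^o)).
  elim/big_ind : _ => [|f g cf cg|j _] x; first exact: cst_continuous.
    by apply: continuousD; [exact: cf|exact: cg].
  apply: continuousM; last exact: cst_continuous.
  exact: coord_continuous.
by apply/funext => h; rewrite fct_sumE.
Qed.

End LinearForm.

(** * From continuous partial derivatives to differentiability *)

Section C1.
Variables (R : realType) (n : nat).
Local Notation E := 'rV[R]_n.
Implicit Types (U V : set E) (k : nat).

Let e (j : 'I_n) : E := delta_mx 0 j.

(* Telescoping along the coordinates, one mean value per coordinate. *)
Lemma C1_differentiable U (f : E -> R^o) x : open U -> C_on 1 U f -> U x ->
  differentiable f x.
Proof.
move=> oU [_ Cf] Ux.
pose a j : R := 'D_(e j) f x.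
have H (eps : R) : 0 < eps -> \forall h \near (0 : E),
    `|f (h + x) - (f x + linear_form a h)| <= eps * `|h|.
  move=> eps0.
  (* Dividing by [n.+1] keeps the sum of the [n] coordinate errors below [eps] and covers [n = 0] as
     well. *)
  have [d d0 dU] : exists2 d : R, 0 < d & forall y, `|x - y| < d ->
      U y /\ forall j, `|'D_(e j) f x - 'D_(e j) f y| <= eps / n.+1%:R.
    have : \forall y \near x, U y /\ forall j, `|'D_(e j) f x - 'D_(e j) f y| <= eps / n.+1%:R.
      near=> y; split; first by near: y; exact: open_nbhs_nbhs.
      move=> j; move: j; near: y; apply: filter_forall => j.
      have [_ Cj] := Cf (e j); have := Cj.1 x Ux.
      by move/cvgrPdist_le; apply; rewrite divr_gt0.
    move=> /nbhs_ballP [d /= d0 dU]; exists d => // y xy; apply: dU.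
    by rewrite -ball_normE.
  near=> h.
  have hd : `|h| < d.
    by near: h; apply/nbhs_ballP; exists d => //= y; rewrite -ball_normE /= sub0r normrN.
  pose s (i : nat) : E := \row_j (if (j < i)%N then h 0 j else 0).
  have hE j : `|h 0 j| <= `|h|.
    rewrite [leRHS]/Num.Def.normr/= mx_normrE.
    exact: (le_bigmax _ (fun i : 'I_1 * 'I_n => `|h i.1 i.2|) (0, j)).
  have s0 : s 0 = 0 by apply/rowP => j; rewrite !mxE.
  have sn : s n = h by apply/rowP => j; rewrite !mxE ltn_ord.
  have sS (i : 'I_n) : s i.+1 = h 0 i *: e i + s i.
    apply/rowP => j; rewrite !mxE ltnS leq_eqVlt /=.
    have [->|ji] := eqVneq j i; first by rewrite eqxx /= ltnn mulr1 addr0.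
    by rewrite mulr0 add0r; case: eqP => [/val_inj /eqP|]; [rewrite (negPf ji)|].
  have sd (i : 'I_n) t : 0 <= t <= 1 -> `|x - (t *: (h 0 i *: e i) + (s i + x))| < d.
    move=> /andP[t0 t1]; apply: le_lt_trans hd.
    rewrite addrA opprD addrCA subrr addr0 normrN.
    rewrite [leLHS]/Num.Def.normr/= mx_normrE bigmax_le //= => -[i0 j] _ /=.
    rewrite !mxE (ord1 i0) /= ?eqxx /=.
    have [->|ji] := eqVneq j i.
      rewrite ltnn mulr1 addr0 normrM (ger0_norm t0); apply: le_trans (hE i).
      by rewrite ler_piMl.
    rewrite !mulr0 add0r; case: ifP => _; [exact: hE|by rewrite normr0].
  have step (i : 'I_n) : `|f (s i.+1 + x) - f (s i + x) - h 0 i * a i| <= eps / n.+1%:R * `|h|.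
    have dd y : U y -> derivable f y (h 0 i *: e i) /\ 'D_(h 0 i *: e i) f y = h 0 i * 'D_(e i) f y.
      by move=> Uy; apply: derive_scale; have [+ _] := Cf (e i); exact.
    have := @mean_value_line R _ f (s i + x) (h 0 i *: e i).
    case=> [t t01|t /andP[t0 t1] Ht]; first by have [] := dd _ (dU _ (sd i t t01)).1.
    have yd := sd i t _; rewrite !ltW // in yd.
    have [Uy Dy] := dU _ (yd isT).
    rewrite sS -(addrA (h 0 i *: e i)) Ht (dd _ Uy).2 -mulrBr normrM mulrC.
    by apply: ler_pM => //; rewrite distrC; exact: Dy.
  have -> : f (h + x) - (f x + linear_form a h) =
      \sum_(i < n) (f (s i.+1 + x) - f (s i + x) - h 0 i * a i).
    rewrite sumrB.
    rewrite -(big_mkord xpredT (fun i => f (s i.+1 + x) - f (s i + x))).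
    by rewrite telescope_sumr // s0 sn add0r /= opprD addrA.
  apply: le_trans (ler_norm_sum _ _ _) _.
  apply: le_trans (ler_sum _ (fun i _ => step i)) _.
  rewrite sumr_const card_ord -[_ *+ n]mulr_natl mulrA ler_wpM2r //.
  rewrite mulrCA ger_pMr // ler_pdivrMr // mul1r ler_nat //.
have cL : continuous (linear_form a) by exact: linear_form_continuous.
have dE : 'd f x = linear_form a :> (E -> R^o).
  by apply: diff_unique cL _; apply/eqaddoP => eps /H.
by apply/diff_locallyP; rewrite dE; split => //; apply/eqaddoP => eps /H.
Unshelve. all: by end_near. Qed.

Lemma C1_row_differentiable m U (f : E -> 'rV[R]_m) x :
  open U -> C_on 1 U f -> U x -> differentiable f x.
Proof.
move=> oU Cf Ux.
have -> : f = \sum_(j < m) (fun x => (f x 0 j : R) *: (delta_mx 0 j : 'rV[R]_m)).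
  apply/funext => y; rewrite fct_sumE [LHS]row_sum_delta //.
apply: differentiable_sum => j; apply: differentiableZl.
by apply: (C1_differentiable oU) => //; have /C_on_row := Cf; exact.
Qed.

Lemma derive_comp m (f : E -> 'rV[R]_m) (W : normedModType R) (g : 'rV[R]_m -> W) x v :
  differentiable f x -> differentiable g (f x) ->
  'D_v (g \o f) x = 'D_('D_v f x) g (f x).
Proof.
move=> df dg.
have dgf := differentiable_comp df dg.
by rewrite (deriveE v dgf) (diff_comp df dg) (deriveE v df) (deriveE _ dg).
Qed.

Lemma derive_sum_delta (W : normedModType R) (g : E -> W) x v : differentiable g x ->
  'D_v g x = \sum_(j < n) v 0 j *: 'D_(e j) g x.
Proof.
move=> dg; rewrite (deriveE v dg) {1}(row_sum_delta v) linear_sum.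
by apply: eq_bigr => j _; rewrite linearZ (deriveE (e j) dg).
Qed.

End C1.

(** * Chain rule and symmetry of second derivatives *)

Section Smooth.
Variables (R : realType).

Lemma C_on_ge k k' (E F : normedModType R) (U : set E) (f : E -> F) :
  (k' <= k)%N -> C_on k U f -> C_on k' U f.
Proof.
elim: k => [|k IH]; first by rewrite leqn0 => /eqP ->.
by rewrite leq_eqVlt => /predU1P [-> //|]; rewrite ltnS => /IH H /C_onW.
Qed.

Lemma derive_add n (W : normedModType R) (g : 'rV[R]_n -> W) x (a : R) u v :
  differentiable g x -> 'D_(a *: u + v) g x = a *: 'D_u g x + 'D_v g x.
Proof. by move=> dg; rewrite !(deriveE _ dg) linearP. Qed.

(** The derivative of the composite is a sum of products of components of the derivative of [f] with
    partial derivatives of [g] composed with [f]. The induction hypothesis applies to these partial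
    derivatives, hence the generalisation over [g]. *)
Lemma C_on_comp n m k (U : set 'rV[R]_n) (V : set 'rV[R]_m) (f : 'rV[R]_n -> 'rV[R]_m) (g : 'rV[R]_m -> R^o) :
  open U -> open V -> (forall x, U x -> V (f x)) ->
  C_on k U f -> C_on k V g -> C_on k U (g \o f).
Proof.
move=> oU oV fUV; elim: k g => [|k IH] g Cf Cg.
  split=> // x Ux; apply: continuous_comp; first exact: (C_on_cont Cf).
  exact/(C_on_cont Cg)/fUV.
have C1f : C_on 1 U f by exact: C_on_ge Cf.
have C1g : C_on 1 V g by exact: C_on_ge Cg.
split=> [x Ux|v].
  apply: continuous_comp; first exact: (C_on_cont Cf).
  exact/(C_on_cont Cg)/fUV.
have df x : U x -> differentiable f x by move=> Ux; exact: C1_row_differentiable C1f Ux.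
have dg x : U x -> differentiable g (f x).
  by move=> /fUV Vx; exact: C1_differentiable C1g Vx.
split=> [x Ux|].
  by apply/diff_derivable/differentiable_comp; [exact: df|exact: dg].
have H : C_on k U (fun x => \sum_(j < m) ('D_v f x) 0 j * ('D_(delta_mx 0 j) g \o f) x : R^o).
  apply: C_on_sum => // j; apply: C_onM => //.
    by have [_ /(_ v) [_ /C_on_row]] := Cf; exact.
  apply: IH; first exact: C_onW.
  by have [_ /(_ (delta_mx 0 j)) []] := Cg.
apply: C_on_ext H => // x Ux.
by rewrite (derive_comp v (df x Ux) (dg x Ux)) (derive_sum_delta _ (dg x Ux)).
Qed.

Lemma derive_rsqrt (y : R) : 0 < y ->
  is_derive y 1 (fun z : R => (Num.sqrt z)^-1 : R^o) (- 2^-1 * (Num.sqrt y)^-1 ^+ 3).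
Proof.
move=> y0; have s0 : Num.sqrt y != 0 by rewrite gt_eqF // sqrtr_gt0.
have [d1 d2] := is_derive1_sqrt y0.
split; first exact: derivableV.
rewrite deriveV // d2 /=.
rewrite /GRing.scale /=.
field; exact: s0.
Qed.

(** The derivative of f^(-1/2) is -1/2 times its own cube times the derivative of f, so the
    induction closes under products. This is the normalising factor in the Gram-Schmidt process. *)
Lemma C_on_rsqrt n k (U : set 'rV[R]_n) (f : 'rV[R]_n -> R^o) : open U ->
  (forall x, U x -> 0 < f x) -> C_on k U f ->
  C_on k U (fun x => (Num.sqrt (f x))^-1 : R^o).
Proof.
move=> oU f0; elim: k => [|k IH] Cf.
  split=> // x Ux.
  apply: (@continuous_comp _ _ _ f (fun z : R => (Num.sqrt z)^-1 : R^o)).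
    exact: (C_on_cont Cf).
  have [/derivable1_diffP d _] := derive_rsqrt (f0 x Ux).
  exact: differentiable_continuous.
have C1f : C_on 1 U f by exact: C_on_ge Cf.
have Cg := IH (C_onW Cf).
have df x : U x -> differentiable f x by move=> Ux; exact: C1_differentiable C1f Ux.
have dg x : U x -> differentiable (fun z : R => (Num.sqrt z)^-1 : R^o) (f x).
  by move=> Ux; have [/derivable1_diffP d _] := derive_rsqrt (f0 x Ux).
have dgf x : U x -> differentiable (fun x => (Num.sqrt (f x))^-1 : R^o) x.
  move=> Ux; exact: differentiable_comp (df x Ux) (dg x Ux).
split=> [x Ux|v]; first exact: (C_on_cont Cg).
split=> [x Ux|]; first exact/diff_derivable/dgf.
have H : C_on k U (fun x => (- 2^-1 * ((Num.sqrt (f x))^-1 * ((Num.sqrt (f x))^-1 * (Num.sqrt (f x))^-1))) * 'D_v f x : R^o).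
  apply: C_onM => //; last by have [_ /(_ v) []] := Cf.
  by apply: C_onM => //; [exact: C_on_cst|apply: C_onM => //; exact: C_onM].
apply: C_on_ext H => // x Ux.
rewrite (deriveE v (dgf x Ux)) (diff_comp (df x Ux) (dg x Ux)) /=.
rewrite -(deriveE v (df x Ux)).
set phi := fun z : R => _.
have L (a : R) : 'd phi (f x) a = a * 'd phi (f x) (1 : R).
  by rewrite -{1}[a]mulr1; exact: linearZ.
rewrite L -(deriveE (1 : R) (dg x Ux)) (@derive_val _ _ _ _ _ _ _ (derive_rsqrt (f0 x Ux))).
by rewrite mulrC !exprS expr0 mulr1.
Qed.

Section Schwarz.
Variable E : normedModType R.
Implicit Types f : E -> R^o.

(** Two mean values: one along [t *: u] for the increment [g] of [f] in direction [v], then one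
    along [t *: v] for the derivative of [f] along [u]. The left-hand side is symmetric in [u] and
    [v], which is what [schwarz] exploits. *)
Lemma second_difference f x u v (d t : R) : 0 < t ->
  t * (`|u| + `|v|) < d ->
  (forall y, `|x - y| < d -> derivable f y u /\ derivable ('D_u f) y v) ->
  exists2 y, `|x - y| < d &
    (f (x + t *: u + t *: v) - f (x + t *: u) - f (x + t *: v) + f x) / t ^+ 2 =
    'D_v ('D_u f) y.
Proof.
move=> t0 td dd.
have near_x (a b : R) : 0 <= a <= 1 -> 0 <= b <= 1 -> `|x - (x + a *: (t *: u) + b *: (t *: v))| < d.
  move=> /andP[a0 a1] /andP[b0 b1]; apply: le_lt_trans td.
  rewrite -addrA opprD addrA subrr add0r normrN mulrDr.
  apply: le_trans (ler_normD _ _) _; rewrite !normrZ !ger0_norm ?(ltW t0) //.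
  by apply: lerD; apply: ler_piMl => //; rewrite mulr_ge0 // ltW.
pose g y : R^o := f (y + t *: v) - f y.
have dg (a : R) : 0 <= a <= 1 -> derivable g (a *: (t *: u) + x) u /\
   'D_u g (a *: (t *: u) + x) = 'D_u f (x + a *: (t *: u) + t *: v) - 'D_u f (x + a *: (t *: u)).
  move=> a01; set z := _ + x.
  have z1 : z + t *: v = x + a *: (t *: u) + 1 *: (t *: v).
    by rewrite /z scale1r [_ + x]addrC.
  have z2 : z = x + a *: (t *: u) + 0 *: (t *: v).
    by rewrite /z scale0r addr0 [_ + x]addrC.
  have zd1 : `|x - (z + t *: v)| < d by rewrite z1; apply: near_x; rewrite ?lexx ?ler01.
  have zd2 : `|x - z| < d by rewrite z2; apply: near_x; rewrite ?lexx ?ler01.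
  have [d1 _] := dd _ zd1; have [d2 _] := dd _ zd2.
  have E0 : (fun h : R => h^-1 *: (((fun y => f (y + t *: v)) \o shift z) (h *: u) - f (z + t *: v)))
    = (fun h : R => h^-1 *: ((f \o shift (z + t *: v)) (h *: u) - f (z + t *: v))).
    by apply/funext => h /=; rewrite (addrA _ z).
  have d3 : derivable (fun y => f (y + t *: v)) z u by rewrite /derivable E0.
  have D3 : 'D_u (fun y => f (y + t *: v)) z = 'D_u f (z + t *: v) by rewrite /derive E0.
  split; first exact: (derivableB d3 d2).
  rewrite (deriveB d3 d2) D3 z1 scale1r; congr (_ - 'D_u f _).
  by rewrite /z addrC.
have [a a01|a /andP[a0 a1]] := @mean_value_line R _ g x (t *: u).
  by have [+ _] := dg a a01 => /(derive_scale t) [].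
have a01 : 0 <= a <= 1 by rewrite !ltW.
have [D1 D2] := dg a a01.
rewrite (derive_scale t D1).2 D2 => gE.
set z := x + a *: (t *: u) in gE D2.
have dz (b : R) : 0 <= b <= 1 -> derivable ('D_u f) (b *: (t *: v) + z) v.
  move=> b01; have zd : `|x - (b *: (t *: v) + z)| < d by rewrite [_ + z]addrC; exact: near_x.
  by have [] := dd _ zd.
have [b b01|b /andP[b0 b1]] := @mean_value_line R _ ('D_u f) z (t *: v).
  by have /(derive_scale t) [] := dz b b01.
have b01 : 0 <= b <= 1 by rewrite !ltW.
rewrite (derive_scale t (dz b b01)).2 => hE.
exists (b *: (t *: v) + z); first by rewrite [_ + z]addrC; exact: near_x.
apply: (canLR (mulfK _)); first by rewrite expf_neq0 // gt_eqF.
rewrite [RHS]mulrC expr2 -mulrA -hE [t *: v + z]addrC -gE /g /=.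
rewrite [t *: u + x]addrC; ring.
Qed.

Lemma eq_common_values (A B : E -> R^o) x :
  {for x, continuous A} -> {for x, continuous B} ->
  (forall d : R, 0 < d -> exists y z, [/\ `|x - y| < d, `|x - z| < d & A y = B z]) ->
  A x = B x.
Proof.
move=> cA cB H.
apply/eqP; rewrite -subr_eq0 -normr_le0; apply/ler_addgt0Pr => eps eps0; rewrite add0r.
have eps2 : 0 < eps / 2 by rewrite divr_gt0.
have near_A : \forall y \near x, `|A x - A y| <= eps / 2.
  by have /cvgrPdist_le := cA; apply.
have near_B : \forall y \near x, `|B x - B y| <= eps / 2.
  by have /cvgrPdist_le := cB; apply.
have /nbhs_ballP [d /= d0 dP] : \forall y \near x, `|A x - A y| <= eps / 2 /\ `|B x - B y| <= eps / 2.
  by move: near_A near_B; apply: filterS2 => y; split.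
have [y [z [xy xz yz]]] := H d d0.
have [A1 _] : `|A x - A y| <= eps / 2 /\ `|B x - B y| <= eps / 2.
  by apply: dP; rewrite -ball_normE.
have [_ B1] : `|A x - A z| <= eps / 2 /\ `|B x - B z| <= eps / 2.
  by apply: dP; rewrite -ball_normE.
rewrite -(subrKA (A y)) [X in _ + (X - _)]yz.
apply: le_trans (ler_normD _ _) _.
by rewrite [leRHS]splitr; apply: lerD => //; rewrite distrC.
Qed.

(** Both mixed derivatives take the value of the same second difference quotient at points
    arbitrarily close to [x]; by continuity they agree at [x]. *)
Lemma schwarz (U : set E) f x u v : open U -> U x -> C_on 2 U f ->
  'D_v ('D_u f) x = 'D_u ('D_v f) x.
Proof.
move=> oU Ux [_ Cf].
have [Cu1 [_ Cu]] := Cf u; have [Cv1 [_ Cv]] := Cf v.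
have [cuv1 [cuv _]] := Cu v; have [cvu1 [cvu _]] := Cv u.
apply: eq_common_values (cuv x Ux) (cvu x Ux) _ => d d0.
have /nbhs_ballP [r /= r0 rU] := open_nbhs_nbhs (conj oU Ux).
have {}rU y : `|x - y| < Num.min d r -> U y.
  by rewrite lt_min => /andP[_ xy]; apply: rU; rewrite -ball_normE.
have m0 : 0 < Num.min d r by rewrite lt_min d0.
(* The summand 1 makes the denominator positive even for [u = v = 0] and the resulting bound
   strict. *)
pose t := Num.min d r / (`|u| + `|v| + 1).
have s0 : 0 < `|u| + `|v| + 1 by rewrite ltr_wpDl // addr_ge0.
have t0 : 0 < t by rewrite divr_gt0.
have td : t * (`|u| + `|v|) < Num.min d r.
  by rewrite /t mulrAC -mulrA gtr_pMr // ltr_pdivrMr // mul1r ltrDl.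
have [y1 y1d E1] := second_difference t0 td (fun y yd =>
  conj (Cu1 y (rU y yd)) (cuv1 y (rU y yd))).
have td' : t * (`|v| + `|u|) < Num.min d r by rewrite [`|v| + _]addrC.
have [y2 y2d E2] := second_difference t0 td' (fun y yd =>
  conj (Cv1 y (rU y yd)) (cvu1 y (rU y yd))).
have E12 : f (x + t *: u + t *: v) - f (x + t *: u) - f (x + t *: v) + f x =
    f (x + t *: v + t *: u) - f (x + t *: v) - f (x + t *: u) + f x.
  by rewrite (addrAC x (t *: u)); ring.
move: y1d y2d; rewrite !lt_min => /andP[y1d _] /andP[y2d _].
exists y1, y2; split; [exact: y1d|exact: y2d|].
exact: (etrans (esym E1) (etrans (congr1 (fun z => z / t ^+ 2) E12) E2)).
Qed.

End Schwarz.
End Smooth.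

(** * Functions and vector fields on a manifold *)

Section Manifold.
Variables (R : realType) (n : nat) (M : manifold R n).
Implicit Types (p q : M) (W : set M) (f g : M -> R) (X Y Z : vfield M).

Definition chart_image p W : set 'rV[R]_n := chart p @` (chart_dom p `&` W).

Lemma chart_imageP p W y :
  chart_image p W y <-> (chart p @` chart_dom p) y /\ W (chart_inv p y).
Proof.
split=> [[q [dq Wq] <-]|[[q dq <-]]]; first by rewrite chartK //; split=> //; exists q.
by rewrite chartK // => Wq; exists q.
Qed.

Lemma chart_image_self p q W : chart_dom p q -> W q -> chart_image p W (chart p q).
Proof. by move=> dq Wq; exists q. Qed.

Lemma nbhs_chart_inv p q (A : set M) : chart_dom p q -> nbhs q A ->
  \forall y \near chart p q, A (chart_inv p y).
Proof.
move=> dq Aq; have : {for chart p q, continuous (chart_inv p)}.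
  by apply: chart_inv_continuous; exists q.
by apply; rewrite chartK.
Qed.

Lemma nbhs_chart_inv_open p q W : open W -> W q -> chart_dom p q ->
  \forall y \near chart p q, W (chart_inv p y).
Proof. by move=> oW Wq dq; apply: nbhs_chart_inv dq _; exact: open_nbhs_nbhs. Qed.

Lemma nbhs_chart_dom p q : chart_dom p q ->
  \forall y \near chart p q, (chart p @` chart_dom p) y.
Proof.
move=> dq; apply: open_nbhs_nbhs; split; first exact: chart_img_open.
by exists q.
Qed.

Lemma open_chart_image p W : open W -> open (chart_image p W).
Proof.
move=> oW; rewrite openE => y [q [dq Wq] <-].
have := nbhs_chart_inv_open oW Wq dq; have := nbhs_chart_dom dq.
by apply: filterS2 => z z1 z2; apply/chart_imageP.
Qed.

Lemma dfun_local (F : normedModType R) W (f g : M -> F) q v :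
  open W -> W q -> (forall x, W x -> f x = g x) -> dfun q v f = dfun q v g.
Proof.
move=> oW Wq fg; apply: near_eq_derive.
have := nbhs_chart_inv_open oW Wq (chart_dom_self q).
by apply: filterS => y Wy /=; exact: fg.
Qed.

Definition mdifferentiable (F : normedModType R) (f : M -> F) q : Prop :=
  differentiable (f \o chart_inv q) (chart q q).

Lemma differentiable_near (V F : normedModType R) (f g : V -> F) x :
  (\forall y \near x, f y = g y) -> differentiable f x -> differentiable g x.
Proof.
move=> fg df.
have fgx := nbhs_singleton fg.
have fg0 : \forall h \near 0, (f \o shift x) h = (g \o shift x) h.
  by move: fg; rewrite (near_shift 0 x) subr0.
have H (eps : R) : 0 < eps -> \forall h \near (0 : V),
    `|(g \o shift x - (cst (g x) + 'd f x)) h| <= eps * `|h|.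
  move=> eps0.
  have /eqaddoP := diff_locally df => /(_ eps eps0).
  move: fg0; apply: filterS2 => h h1; apply: le_trans.
  suff -> : (g \o shift x - (cst (g x) + 'd f x)) h = (f \o shift x - (cst (f x) + 'd f x)) h by [].
  by rewrite -fgx; congr (_ - _); exact: esym h1.
have dE : 'd g x = 'd f x :> (V -> F).
  by apply: diff_unique (diff_continuous df) _; apply/eqaddoP.
by apply/diff_locallyP; rewrite dE; split; [exact: diff_continuous|apply/eqaddoP].
Qed.

Lemma transition_C1 p q : C_on 1 (chart_image p (chart_dom q)) (chart q \o chart_inv p).
Proof. exact: chart_transition. Qed.

Lemma transition_differentiable p q x : chart_dom p x -> chart_dom q x ->
  differentiable (chart q \o chart_inv p) (chart p x).
Proof.
move=> px qx; apply: (@C1_row_differentiable _ _ _ (chart_image p (chart_dom q))).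
- exact/open_chart_image/chart_dom_open.
- exact: transition_C1.
- exact: chart_image_self.
Qed.

Lemma near_transition (F : Type) p q x (f : M -> F) : chart_dom p x -> chart_dom q x ->
  \forall y \near chart p x, ((f \o chart_inv q) \o (chart q \o chart_inv p)) y = (f \o chart_inv p) y.
Proof.
move=> px qx; have := nbhs_chart_inv_open (@chart_dom_open _ _ M q) qx px.
by apply: filterS => y /= qy; rewrite chartK.
Qed.

Lemma mdifferentiable_chart (F : normedModType R) (f : M -> F) p q x :
  chart_dom p x -> chart_dom q x ->
  differentiable (f \o chart_inv q) (chart q x) -> differentiable (f \o chart_inv p) (chart p x).
Proof.
move=> px qx df; apply: differentiable_near (near_transition f px qx) _.
apply: differentiable_comp; first exact: transition_differentiable.
by rewrite /= chartK.
Qed.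

Lemma derive_chart (F : normedModType R) (f : M -> F) p q x v :
  chart_dom p x -> chart_dom q x ->
  differentiable (f \o chart_inv q) (chart q x) ->
  'D_v (f \o chart_inv p) (chart p x) =
  'D_('D_v (chart q \o chart_inv p) (chart p x)) (f \o chart_inv q) (chart q x).
Proof.
move=> px qx df; rewrite -(near_eq_derive v (near_transition f px qx)).
have dt := transition_differentiable px qx.
by rewrite (derive_comp v dt) /= chartK.
Qed.

(** Tangent vectors at [q] are stored in the chart around [q], so [dfun q v (chart p)] is [v]
    re-expressed in the chart around [p]. With this the derivative can be computed in one fixed
    chart while [q] moves. *)
Lemma dfun_chart (F : normedModType R) (f : M -> F) p q v : chart_dom p q ->
  mdifferentiable f q ->
  dfun q v f = 'D_(dfun q v (chart p)) (f \o chart_inv p) (chart p q).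
Proof.
move=> pq df; apply: (derive_chart v (chart_dom_self q) pq).
exact: mdifferentiable_chart (chart_dom_self q) df.
Qed.

Lemma dfun_self p v : dfun p v (chart p) = v.
Proof.
rewrite /dfun (near_eq_derive (g := id)) ?derive_id //.
by apply: filterS (nbhs_chart_dom (chart_dom_self p)) => _ [q dq <-] /=; rewrite chartK.
Qed.

Lemma mdifferentiable_chart_fun p q : chart_dom p q -> mdifferentiable (chart p) q.
Proof. exact: (transition_differentiable (chart_dom_self q)). Qed.

Section Smooth_fun.

Lemma smooth_fun_C W f p k : smooth_fun W f ->
  C_on k (chart_image p W) (f \o chart_inv p : _ -> R^o).
Proof. by move=> sf; exact: (sf p k). Qed.

Lemma smooth_differentiable W f p q : open W -> W q -> smooth_fun W f -> chart_dom p q ->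
  differentiable (f \o chart_inv p : _ -> R^o) (chart p q).
Proof.
move=> oW Wq sf pq; apply: (@C1_differentiable _ _ (chart_image p W)).
- exact: open_chart_image.
- exact: smooth_fun_C.
- exact: chart_image_self.
Qed.

Lemma smooth_mdifferentiable W f q : open W -> W q -> smooth_fun W f ->
  mdifferentiable (f : M -> R^o) q.
Proof. by move=> oW Wq sf; apply: smooth_differentiable sf _ => //; exact: chart_dom_self. Qed.

Lemma smooth_fun_sub W W' f : W' `<=` W -> smooth_fun W f -> smooth_fun W' f.
Proof.
move=> W'W sf p k; apply: C_on_sub (sf p k) => y [q [pq W'q] <-].
by exists q => //; split => //; exact: W'W.
Qed.

Lemma smooth_fun_ext W f g : open W -> (forall q, W q -> f q = g q) ->
  smooth_fun W f -> smooth_fun W g.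
Proof.
move=> oW fg sf p k; apply: C_on_ext (sf p k); first exact: open_chart_image.
by move=> y /chart_imageP [_ Wy] /=; exact: fg.
Qed.

Lemma smooth_fun_cover W f :
  (forall q, W q -> exists W', W' q /\ smooth_fun W' f) -> smooth_fun W f.
Proof.
move=> H p k; apply: C_on_pt => _ [q [pq Wq] <-].
have [W' [W'q sf]] := H q Wq.
by apply: C_on_sub (sf p k) => _ ->; exists q.
Qed.

Lemma smooth_fun_cst W (a : R) : smooth_fun W (fun=> a).
Proof. by move=> p k; exact: C_on_cst. Qed.

Lemma smooth_funD W f g : open W -> smooth_fun W f -> smooth_fun W g ->
  smooth_fun W (fun x => f x + g x).
Proof. by move=> oW sf sg p k; apply: C_onD; [exact: open_chart_image|exact: sf|exact: sg]. Qed.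

Lemma smooth_funM W f g : open W -> smooth_fun W f -> smooth_fun W g ->
  smooth_fun W (fun x => f x * g x).
Proof. by move=> oW sf sg p k; apply: C_onM; [exact: open_chart_image|exact: sf|exact: sg]. Qed.

Lemma smooth_fun_sum W (I : Type) (s : seq I) (h : I -> M -> R) : open W ->
  (forall i, smooth_fun W (h i)) -> smooth_fun W (fun x => \sum_(i <- s) h i x).
Proof.
move=> oW sh p k.
exact: (C_on_sum s (open_chart_image (p := p) oW) (fun i => sh i p k)).
Qed.

Lemma smooth_fun_rsqrt W f : open W -> (forall q, W q -> 0 < f q) -> smooth_fun W f ->
  smooth_fun W (fun x => (Num.sqrt (f x))^-1).
Proof.
move=> oW f0 sf p k; apply: (C_on_rsqrt (f := f \o chart_inv p)).
- exact: open_chart_image.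
- by move=> y /chart_imageP [_ Wy]; exact: f0.
- exact: sf.
Qed.

(** Any other chart expression is the given one composed with a smooth transition map. *)
Lemma smooth_fun_chart1 W f p : open W -> W `<=` chart_dom p ->
  Cinfty_on (chart_image p W) (f \o chart_inv p : _ -> R^o) -> smooth_fun W f.
Proof.
move=> oW Wp Cf q k.
have oq : open (chart_image q W) by exact: open_chart_image.
have op : open (chart_image p W) by exact: open_chart_image.
have H : C_on k (chart_image q W) ((f \o chart_inv p) \o (chart p \o chart_inv q) : _ -> R^o).
  apply: C_on_comp oq op _ _ (Cf k).
    move=> y /chart_imageP [_ Wy] /=; apply: chart_image_self => //; exact: Wp.
  apply: C_on_sub (chart_transition q p k) => y [x [qx Wx] <-].
  by exists x => //; split => //; exact: Wp.
apply: C_on_ext H => // y /chart_imageP [_ Wy] /=; rewrite chartK //; exact: Wp.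
Qed.

Lemma smooth_fun_coord p j : smooth_fun (chart_dom p) (fun q => chart p q 0 j).
Proof.
move=> q k; have H := chart_transition q p k.
have oq : open (chart_image q (chart_dom p)).
  exact/open_chart_image/chart_dom_open.
by have := (proj1 (C_on_row _ _ oq) H) j.
Qed.

Lemma smooth_fun_continuous W f q : open W -> W q -> smooth_fun W f ->
  {for q, continuous f}.
Proof.
move=> oW Wq sf.
have c1 : {for q, continuous ((f \o chart_inv q) \o chart q)}.
  apply: continuous_comp; first by apply: chart_continuous; exact: chart_dom_self.
  have H := smooth_mdifferentiable oW Wq sf.
  exact: differentiable_continuous H.
have eqf : \forall x \near q, ((f \o chart_inv q) \o chart q) x = f x.
  apply: filterS (open_nbhs_nbhs (conj (chart_dom_open q) (chart_dom_self q))) => x /= dx.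
  by rewrite chartK.
have := c1; rewrite /prop_for /continuous_at (nbhs_singleton eqf) => c2.
by apply: cvg_trans c2; apply: near_eq_cvg.
Qed.

(** Provides the open domain on which a field that is nonzero at one point can be normalised. *)
Lemma open_pos W f : open W -> smooth_fun W f -> open [set q | W q /\ 0 < f q].
Proof.
move=> oW sf; rewrite openE => q [Wq fq].
have cf := smooth_fun_continuous oW Wq sf.
have H1 : \forall x \near q, 0 < f x.
  have := cf; rewrite /prop_for /continuous_at => /(_ [set y | 0 < y]); apply.
  exact: (@open_nbhs_nbhs R (f q) [set y | 0 < y] (conj (@open_gt R 0) fq)).
have H2 : \forall x \near q, W x by exact: open_nbhs_nbhs.
by move: H1 H2; apply: filterS2.
Qed.

End Smooth_fun.

Section Dfun.

Lemma dfunP (f : M -> R) q (a : R) u v : mdifferentiable (f : M -> R^o) q ->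
  dfun q (a *: u + v) (f : M -> R^o) = a * dfun q u (f : M -> R^o) + dfun q v (f : M -> R^o).
Proof. exact: derive_add. Qed.

Lemma dfun0v (F : normedModType R) (f : M -> F) q : dfun q 0 f = 0.
Proof. exact: derive0. Qed.

Lemma dfun_sumv (f : M -> R) q (I : Type) (s : seq I) (u : I -> 'rV[R]_n) :
  mdifferentiable (f : M -> R^o) q ->
  dfun q (\sum_(i <- s) u i) (f : M -> R^o) = \sum_(i <- s) dfun q (u i) (f : M -> R^o).
Proof.
move=> df; elim: s => [|i s IH]; first by rewrite !big_nil dfun0v.
by rewrite !big_cons -{1}(scale1r (u i)) dfunP // mul1r IH.
Qed.

Lemma dfunZv (f : M -> R) q (a : R) u : mdifferentiable (f : M -> R^o) q ->
  dfun q (a *: u) (f : M -> R^o) = a * dfun q u (f : M -> R^o).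
Proof. by move=> df; rewrite -[a *: u]addr0 (dfunP _ _ _ df) dfun0v addr0. Qed.

Lemma dfunD (f g : M -> R) q v : mdifferentiable (f : M -> R^o) q ->
  mdifferentiable (g : M -> R^o) q ->
  dfun q v ((fun x => f x + g x) : M -> R^o) = dfun q v (f : M -> R^o) + dfun q v (g : M -> R^o).
Proof.
move=> df dg.
exact: (deriveD (diff_derivable (v := v) df) (diff_derivable (v := v) dg)).
Qed.

Lemma dfunM (f g : M -> R) q v : mdifferentiable (f : M -> R^o) q ->
  mdifferentiable (g : M -> R^o) q ->
  dfun q v ((fun x => f x * g x) : M -> R^o) =
  f q * dfun q v (g : M -> R^o) + g q * dfun q v (f : M -> R^o).
Proof.
move=> df dg; rewrite /dfun.
have := deriveM (diff_derivable (v := v) df) (diff_derivable (v := v) dg).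
by rewrite /= chartK //; exact: chart_dom_self.
Qed.

Lemma dfun_cst (a : R) q v : dfun q v ((fun=> a) : M -> R^o) = 0.
Proof. exact: derive_cst. Qed.

Lemma mdifferentiable_sum (I : Type) (s : seq I) (h : I -> M -> R) q :
  (forall i, mdifferentiable (h i : M -> R^o) q) ->
  mdifferentiable ((fun x => \sum_(i <- s) h i x) : M -> R^o) q.
Proof.
move=> dh; rewrite /mdifferentiable; elim: s => [|i s IH].
  have -> : (fun x => \sum_(i <- [::]) h i x) = (fun=> 0) :> (M -> R^o).
    by apply/funext => y; rewrite big_nil.
  exact: (@differentiable_cst _ _ R^o 0).
have -> : (fun x => \sum_(j <- i :: s) h j x) = (fun x => h i x + \sum_(j <- s) h j x) :> (M -> R^o).
  by apply/funext => y; rewrite big_cons.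
exact: (differentiableD (dh i) IH).
Qed.

Lemma dfun_sum (I : Type) (s : seq I) (h : I -> M -> R) q v :
  (forall i, mdifferentiable (h i : M -> R^o) q) ->
  dfun q v ((fun x => \sum_(i <- s) h i x) : M -> R^o) = \sum_(i <- s) dfun q v (h i : M -> R^o).
Proof.
move=> dh; elim: s => [|i s IH].
  have -> : (fun x => \sum_(i <- [::]) h i x) = (fun=> 0) :> (M -> R^o).
    by apply/funext => y; rewrite big_nil.
  by rewrite dfun_cst big_nil.
have -> : (fun x => \sum_(j <- i :: s) h j x) = (fun x => h i x + \sum_(j <- s) h j x) :> (M -> R^o).
  by apply/funext => y; rewrite big_cons.
by rewrite dfunD ?IH ?big_cons //; exact: mdifferentiable_sum.
Qed.

Lemma dfun_row m (f : M -> 'rV[R]_m) q v j : mdifferentiable f q ->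
  (dfun q v f) 0 j = dfun q v ((fun x => f x 0 j) : M -> R^o).
Proof. by move=> df; rewrite /dfun derive_mx ?mxE //; exact: diff_derivable. Qed.

End Dfun.

End Manifold.

(* Unification would otherwise compare derivatives by unfolding limits. *)
Local Opaque derive.

(** * Vector fields and the Lie bracket *)

Section VectorFields.
Variables (R : realType) (n : nat) (M : manifold R n).
Implicit Types (p q : M) (W : set M) (f g : M -> R) (X Y Z : vfield M).

Lemma smooth_vfield_sub W W' X : W' `<=` W -> smooth_vfield W X -> smooth_vfield W' X.
Proof. by move=> W'W sX W2 f oW2 W2W'; apply: sX => // x /W2W' /W'W. Qed.

Lemma smooth_vfield_ext W X Y : (forall q, W q -> X q = Y q) ->
  smooth_vfield W X -> smooth_vfield W Y.
Proof.
move=> XY sX W' f oW' W'W sf; apply: (smooth_fun_ext oW' _ (sX W' f oW' W'W sf)) => q W'q.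
by rewrite (XY _ (W'W _ W'q)).
Qed.

Lemma smooth_vfieldD W X Y : smooth_vfield W X -> smooth_vfield W Y ->
  smooth_vfield W (fun q => X q + Y q).
Proof.
move=> sX sY W' f oW' W'W sf.
have := smooth_funD oW' (sX W' f oW' W'W sf) (sY W' f oW' W'W sf).
apply: smooth_fun_ext => // q W'q.
by rewrite -{2}(scale1r (X q)) dfunP ?mul1r //; exact: smooth_mdifferentiable sf.
Qed.

Lemma smooth_vfieldZ W (a : M -> R) X : smooth_fun W a -> smooth_vfield W X ->
  smooth_vfield W (fun q => a q *: X q).
Proof.
move=> sa sX W' f oW' W'W sf.
have := smooth_funM oW' (smooth_fun_sub W'W sa) (sX W' f oW' W'W sf).
apply: smooth_fun_ext => // q W'q.
by rewrite dfunZv //; exact: smooth_mdifferentiable sf.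
Qed.

Lemma smooth_vfield0 W : smooth_vfield W (fun=> 0 : 'rV[R]_n).
Proof.
move=> W' f oW' W'W sf; apply: smooth_fun_ext (smooth_fun_cst W' 0) => // q _.
by rewrite dfun0v.
Qed.

Lemma smooth_vfield_sum W (I : Type) (s : seq I) (X : I -> vfield M) :
  (forall i, smooth_vfield W (X i)) -> smooth_vfield W (fun q => \sum_(i <- s) X i q).
Proof.
move=> sX; elim: s => [|i s IH].
  by apply: (smooth_vfield_ext _ (@smooth_vfield0 W)) => q _; rewrite big_nil.
by apply: (smooth_vfield_ext _ (smooth_vfieldD (sX i) IH)) => q _; rewrite big_cons.
Qed.

Lemma smooth_vfieldB W X Y : smooth_vfield W X -> smooth_vfield W Y ->
  smooth_vfield W (fun q => X q - Y q).
Proof.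
move=> sX sY.
have := smooth_vfieldD sX (smooth_vfieldZ (smooth_fun_cst W (-1)) sY).
by apply: smooth_vfield_ext => q _; rewrite scaleN1r.
Qed.

Lemma dfun_const_ext p q v (F : normedModType R) (f : M -> F) : chart_dom p q ->
  mdifferentiable f q ->
  dfun q (const_ext p v q) f = 'D_v (f \o chart_inv p) (chart p q).
Proof.
by move=> pq df; rewrite (derive_chart v pq (chart_dom_self q) df).
Qed.

Lemma const_ext_self p v : const_ext p v p = v.
Proof. exact: dfun_self. Qed.

Lemma smooth_const_ext p v : smooth_vfield (chart_dom p) (const_ext p v).
Proof.
move=> W f oW Wp sf.
apply: (@smooth_fun_chart1 _ _ _ _ _ p) => // k.
have [_ /(_ v) [_]] := sf p k.+1.
have oI : open (chart_image p W) by exact: open_chart_image.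
apply: C_on_ext => // _ [q [pq Wq] <-].
have df := smooth_mdifferentiable oW Wq sf.
by rewrite -(dfun_const_ext v pq df) /= chartK.
Qed.

Lemma tangent_decomp p q v : chart_dom p q ->
  v = \sum_j (dfun q v (chart p)) 0 j *: const_ext p (delta_mx 0 j) q.
Proof.
move=> pq; rewrite -{1}(dfun_self (M := M) q v).
have dq := mdifferentiable_chart_fun (chart_dom_self q).
rewrite (dfun_chart v pq dq).
have dt := transition_differentiable pq (chart_dom_self q).
exact: (derive_sum_delta _ dt).
Qed.

Lemma lie_bracket0l X p : lie_bracket (fun=> 0 : 'rV[R]_n) X p = 0.
Proof.
rewrite /lie_bracket dfun0v.
have -> : (fun q => dfun q 0 (chart p)) = (fun=> 0) :> (M -> 'rV[R]_n).
  by apply/funext => q; rewrite dfun0v.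
by rewrite sub0r (_ : dfun _ _ _ = 0) ?oppr0 //; exact: derive_cst.
Qed.

Section Bracket.

(** The components of [X] in the fixed chart around [p] are [X] applied to coordinate functions, and
    smoothness of a field is defined by its action on functions. *)
Lemma mdifferentiable_dfun_chart W p X : open W -> W p -> smooth_vfield W X ->
  mdifferentiable (fun q => dfun q (X q) (chart p)) p.
Proof.
move=> oW Wp sX; have oD := @chart_dom_open _ _ M p.
have oW1 : open (W `&` chart_dom p) by exact: openI.
have oI : open (chart_image p (W `&` chart_dom p)) by exact: open_chart_image.
have xI : chart_image p (W `&` chart_dom p) (chart p p).
  by apply: chart_image_self; [|split => //]; exact: chart_dom_self.
apply: (C1_row_differentiable oI _ xI).
apply/(C_on_row _ _ oI) => j.
have sj : smooth_fun (W `&` chart_dom p) (fun x => chart p x 0 j).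
  by apply: smooth_fun_sub (smooth_fun_coord p j) => x [].
have := sX (W `&` chart_dom p) _ oW1 (@subIsetl _ _ _) sj p 1.
apply: C_on_ext => // _ [q [_ [Wq pq]] <-] /=.
by rewrite chartK // (dfun_row _ _ (mdifferentiable_chart_fun pq)).
Qed.

(** Both sides are the Hessian of [h] at [x] evaluated on [u] and [v], and the Hessian matrix is
    symmetric by [schwarz]. *)
Lemma derive_second_sym (U : set 'rV[R]_n) (h : 'rV[R]_n -> R^o) x (u v : 'rV[R]_n) :
  open U -> U x -> C_on 2 U h ->
  \sum_j v 0 j * 'D_u ('D_(delta_mx 0 j) h) x = \sum_j u 0 j * 'D_v ('D_(delta_mx 0 j) h) x.
Proof.
move=> oU Ux Ch.
have [H Hsym HE] : exists2 H : 'I_n -> 'I_n -> R, forall i j, H i j = H j i &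
    forall w j, 'D_w ('D_(delta_mx 0 j) h) x = \sum_i w 0 i * H i j.
  exists (fun i j => 'D_(delta_mx 0 i) ('D_(delta_mx 0 j) h) x) => [i j|w j].
    exact: schwarz oU Ux Ch.
  have dj : differentiable ('D_(delta_mx 0 j : 'rV[R]_n) h) x.
    by apply: (C1_differentiable oU _ Ux); have [_ /(_ (delta_mx 0 j)) []] := Ch.
  exact: (derive_sum_delta w dj).
have E (a b : 'rV[R]_n) : \sum_j b 0 j * 'D_a ('D_(delta_mx 0 j) h) x =
    \sum_j \sum_i b 0 j * (a 0 i * H i j).
  by apply: eq_bigr => j _; rewrite -mulr_sumr; congr (_ * _); exact: HE.
apply: etrans (E u v) (etrans _ (esym (E v u))).
rewrite exchange_big; apply: eq_bigr => i _; apply: eq_bigr => j _.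
by rewrite mulrCA Hsym.
Qed.

(** Product rule for X f = sum of components times partial derivatives, all in the one chart around
    [p]. The first summand differentiates the components of [X], the second is the coordinate
    Hessian of [f] on [X] and [v]. *)
Lemma dfun_dfun W p X f v : open W -> W p -> smooth_vfield W X -> smooth_fun W f ->
  dfun p v ((fun q => dfun q (X q) (f : M -> R^o)) : M -> R^o) =
  dfun p (dfun p v (fun q => dfun q (X q) (chart p))) (f : M -> R^o) +
  \sum_j X p 0 j * 'D_v ('D_(delta_mx 0 j) (f \o chart_inv p : _ -> R^o)) (chart p p).
Proof.
move=> oW Wp sX sf.
pose xc q := dfun q (X q) (chart p).
pose fh := f \o chart_inv p : 'rV[R]_n -> R^o.
pose G j q : R := 'D_(delta_mx 0 j : 'rV[R]_n) fh (chart p q).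
have oD := @chart_dom_open _ _ M p; have dp := chart_dom_self p.
have oW1 : open (W `&` chart_dom p) by exact: openI.
have W1p : (W `&` chart_dom p) p by split.
have dxc : mdifferentiable xc p by exact: mdifferentiable_dfun_chart sX.
have dfh : differentiable fh (chart p p) by exact: smooth_differentiable oW Wp sf dp.
have E q : (W `&` chart_dom p) q -> dfun q (X q) (f : M -> R^o) = \sum_j xc q 0 j * G j q.
  move=> [Wq pq]; have dfq := smooth_mdifferentiable oW Wq sf.
  rewrite (dfun_chart _ pq dfq).
  exact: (derive_sum_delta _ (smooth_differentiable oW Wq sf pq)).
rewrite (dfun_local v oW1 W1p E).
have oI : open (chart_image p W) by exact: open_chart_image.
have xI : chart_image p W (chart p p) by exact: chart_image_self.
have dD j : differentiable ('D_(delta_mx 0 j : 'rV[R]_n) fh) (chart p p).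
  apply: (C1_differentiable oI _ xI).
  by have [_ /(_ (delta_mx 0 j)) []] := sf p 2.
have GE j : \forall y \near chart p p, ('D_(delta_mx 0 j : 'rV[R]_n) fh) y = (G j \o chart_inv p) y.
  by apply: filterS (nbhs_chart_dom dp) => _ [q dq <-] /=; rewrite chartK.
have dG j : mdifferentiable (G j : M -> R^o) p.
  exact: differentiable_near (GE j) (dD j).
have dfG j : dfun p v (G j : M -> R^o) = 'D_v ('D_(delta_mx 0 j) fh) (chart p p).
  exact: esym (near_eq_derive v (GE j)).
have dxj j : mdifferentiable ((fun q => xc q 0 j) : M -> R^o) p.
  exact: (differentiable_comp dxc (differentiable_coord _ _ _)).
rewrite dfun_sum; last first.
  by move=> j; exact: (differentiableM (dxj j) (dG j)).
rewrite (eq_bigr _ (fun j _ => dfunM v (dxj j) (dG j))) big_split /=.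
have A1 : \sum_j G j p * dfun p v ((fun q => xc q 0 j) : M -> R^o) =
    dfun p (dfun p v xc) (f : M -> R^o).
  transitivity (\sum_j (dfun p v xc) 0 j * G j p).
    by apply: eq_bigr => j _; rewrite mulrC (dfun_row v j dxc).
  exact: esym (derive_sum_delta _ dfh).
have A2 : \sum_j xc p 0 j * dfun p v (G j : M -> R^o) =
    \sum_j X p 0 j * 'D_v ('D_(delta_mx 0 j) fh) (chart p p).
  by apply: eq_bigr => j _; rewrite dfG /xc dfun_self.
exact: (etrans (addrC _ _) (f_equal2 (fun a b : R => a + b) A1 A2)).
Qed.

(** The Hessian terms of X(Y f) and Y(X f) cancel by symmetry, and the first-order terms are those
    defining the bracket. So the commutator identity passes from the coordinate functions to all
    smooth functions. *)
Lemma dfun_lie_bracket W p X Y f : open W -> W p -> smooth_vfield W X -> smooth_vfield W Y ->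
  smooth_fun W f ->
  dfun p (lie_bracket X Y p) (f : M -> R^o) =
  dfun p (X p) ((fun q => dfun q (Y q) (f : M -> R^o)) : M -> R^o) -
  dfun p (Y p) ((fun q => dfun q (X q) (f : M -> R^o)) : M -> R^o).
Proof.
move=> oW Wp sX sY sf.
have oI : open (chart_image p W) by exact: open_chart_image.
have xI : chart_image p W (chart p p) by exact/chart_image_self/Wp/chart_dom_self.
have E1 := dfun_dfun (X p) oW Wp sY sf.
have E2 := dfun_dfun (Y p) oW Wp sX sf.
have E3 := derive_second_sym (X p) (Y p) oI xI (sf p 2).
have E4 (a b s : R) : a - b = a + s - (b + s) by ring.
have df := smooth_mdifferentiable oW Wp sf.
have E5 (u w : 'rV[R]_n) : dfun p (u - w) (f : M -> R^o) =
    dfun p u (f : M -> R^o) - dfun p w (f : M -> R^o).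
  by rewrite [u - w]addrC -scaleN1r (dfunP _ _ _ df) mulN1r addrC.
apply: etrans (esym (f_equal2 (fun a b : R => a - b) (etrans E1 (congr1 (fun z => _ + z) E3)) E2)).
exact: (etrans (E5 _ _) (E4 _ _ _)).
Qed.

End Bracket.
End VectorFields.

(** * Smooth maps and their differentials *)

Section SmoothMap.
Variables (R : realType) (n k : nat) (M : manifold R n) (N : manifold R k) (pi : M -> N).
Hypothesis spi : smooth_map pi.
Implicit Types (p q : M) (y : N) (V : set N).

Lemma open_preimage V : open V -> open (pi @^-1` V).
Proof. by move=> oV; apply: open_comp => // x _; exact: (proj1 spi). Qed.

Lemma map_C_on p y j : C_on j (chart_image p (pi @^-1` chart_dom y))
  (chart y \o pi \o chart_inv p).
Proof. exact: (proj2 spi). Qed.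

Lemma mdifferentiable_map_chart p y : chart_dom y (pi p) -> mdifferentiable (chart y \o pi) p.
Proof.
move=> yp.
have oI : open (chart_image p (pi @^-1` chart_dom y)).
  exact/open_chart_image/open_preimage/chart_dom_open.
apply: (C1_row_differentiable oI (map_C_on p y 1)).
by apply: chart_image_self => //; exact: chart_dom_self.
Qed.

Lemma dmapE p v : v *m dmap pi p = dfun p v (chart (pi p) \o pi).
Proof.
by rewrite -deriveEjacobian //; exact: mdifferentiable_map_chart (chart_dom_self _).
Qed.

Lemma near_map_chart (F : Type) p y (f : N -> F) : chart_dom y (pi p) ->
  \forall x \near chart p p, ((f \o chart_inv y) \o (chart y \o pi \o chart_inv p)) x = (f \o pi \o chart_inv p) x.
Proof.
move=> yp; have oP := open_preimage (@chart_dom_open _ _ N y).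
have := nbhs_chart_inv_open oP yp (chart_dom_self p).
by apply: filterS => x /= yx; rewrite chartK.
Qed.

Lemma dfun_comp (F : normedModType R) (f : N -> F) p v : mdifferentiable f (pi p) ->
  dfun p v (f \o pi) = dfun (pi p) (v *m dmap pi p) f.
Proof.
move=> df; have dc := mdifferentiable_map_chart (chart_dom_self (pi p)).
have E : (chart (pi p) \o pi \o chart_inv p) (chart p p) = chart (pi p) (pi p).
  by rewrite /= chartK //; exact: chart_dom_self.
transitivity ('D_v ((f \o chart_inv (pi p)) \o (chart (pi p) \o pi \o chart_inv p)) (chart p p)).
  exact: esym (near_eq_derive v (near_map_chart f (chart_dom_self (pi p)))).
rewrite /mdifferentiable -E in df.
apply: etrans (derive_comp v dc df) _.
by rewrite E dmapE.
Qed.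

Lemma smooth_fun_comp V (f : N -> R) : open V -> smooth_fun V f ->
  smooth_fun (pi @^-1` V) (f \o pi).
Proof.
move=> oV sf p j; apply: C_on_pt => _ [q [pq Vq] <-].
pose y := pi q.
have oyV : open (chart_dom y `&` V) by apply: openI => //; exact: chart_dom_open.
have oP := open_preimage oyV.
have oI : open (chart_image p (pi @^-1` (chart_dom y `&` V))) by exact: open_chart_image.
have oIN : open (chart_image y V) by exact: open_chart_image.
have H : C_on j (chart_image p (pi @^-1` (chart_dom y `&` V)))
    ((f \o chart_inv y) \o (chart y \o pi \o chart_inv p) : _ -> R^o).
  apply: C_on_comp oI oIN _ _ (sf y j).
    by move=> x /chart_imageP [_ [yx Vx]]; exists (pi (chart_inv p x)).
  apply: C_on_sub (map_C_on p y j) => _ [x [px [yx Vx]] <-].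
  by exists x.
have {}H : C_on j (chart_image p (pi @^-1` (chart_dom y `&` V))) ((f \o pi) \o chart_inv p : _ -> R^o).
  by apply: C_on_ext H => // x /chart_imageP [_ [yx Vx]] /=; rewrite chartK.
apply: C_on_sub H => _ ->; exists q => //; split=> //; split=> //.
exact: chart_dom_self.
Qed.

Lemma smooth_fun_map_coord y j :
  smooth_fun (pi @^-1` chart_dom y) (fun q => chart y (pi q) 0 j).
Proof.
exact: (smooth_fun_comp (@chart_dom_open _ _ N y) (smooth_fun_coord y j)).
Qed.

(** The entries of [dmap pi p] refer to charts that change with [p], so they need not depend
    smoothly on [p]. Here the base chart [y] stays fixed and the coefficients are derivatives of
    smooth functions. *)
Lemma dmap_decomp y p v : chart_dom y (pi p) ->
  v *m dmap pi p =
  \sum_j dfun p v ((fun q => chart y (pi q) 0 j) : M -> R^o) *: const_ext y (delta_mx 0 j) (pi p).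
Proof.
move=> yp; rewrite {1}(tangent_decomp (v *m dmap pi p) yp); apply: eq_bigr => j _.
rewrite -(dfun_comp v (mdifferentiable_chart_fun yp)).
by rewrite (dfun_row v j (mdifferentiable_map_chart yp)).
Qed.

End SmoothMap.

(** * Levi-Civita calculus *)

Section InnerProduct.
Variables (R : realType) (n : nat) (M : riemannian R n).
Implicit Types (p q : M) (W : set M) (u v w : 'rV[R]_n) (X Y Z : vfield M).

Lemma ipE p u v : ip p u v = (u *m metric p *m v^T) 0 0.
Proof. by []. Qed.

Lemma ipDl p u v w : ip p (u + v) w = ip p u w + ip p v w.
Proof. by rewrite /ip /gdot !mulmxDl mxE. Qed.

Lemma ipZl p a u w : ip p (a *: u) w = a * ip p u w.
Proof. by rewrite /ip /gdot -!scalemxAl mxE. Qed.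

Lemma ipC p u v : ip p u v = ip p v u.
Proof.
have [sg _ _] := metricP M.
have H : (u *m metric p *m v^T)^T = v *m metric p *m u^T.
  by rewrite !trmx_mul trmxK sg mulmxA.
by rewrite /ip /gdot -H [RHS]mxE.
Qed.

Lemma ipDr p u v w : ip p w (u + v) = ip p w u + ip p w v.
Proof. by rewrite !(ipC p w) ipDl. Qed.

Lemma ipZr p a u w : ip p w (a *: u) = a * ip p w u.
Proof. by rewrite !(ipC p w) ipZl. Qed.

Lemma ipNl p u w : ip p (- u) w = - ip p u w.
Proof. by rewrite -scaleN1r ipZl mulN1r. Qed.

Lemma ipNr p u w : ip p w (- u) = - ip p w u.
Proof. by rewrite !(ipC p w) ipNl. Qed.

Lemma ipBl p u v w : ip p (u - v) w = ip p u w - ip p v w.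
Proof. by rewrite ipDl ipNl. Qed.

Lemma ipBr p u v w : ip p w (u - v) = ip p w u - ip p w v.
Proof. by rewrite ipDr ipNr. Qed.

Lemma ip0l p w : ip p 0 w = 0.
Proof. by rewrite -(scale0r (0 : 'rV[R]_n)) ipZl mul0r. Qed.

Lemma ip0r p w : ip p w 0 = 0.
Proof. by rewrite ipC ip0l. Qed.

Lemma ip_suml p (I : Type) (s : seq I) (P : pred I) (u : I -> 'rV[R]_n) w :
  ip p (\sum_(i <- s | P i) u i) w = \sum_(i <- s | P i) ip p (u i) w.
Proof. by apply: (big_morph (fun z => ip p z w)) => [a b|]; rewrite ?ipDl ?ip0l. Qed.

Lemma ip_sumr p (I : Type) (s : seq I) (P : pred I) (u : I -> 'rV[R]_n) w :
  ip p w (\sum_(i <- s | P i) u i) = \sum_(i <- s | P i) ip p w (u i).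
Proof. by apply: (big_morph (fun z => ip p w z)) => [a b|]; rewrite ?ipDr ?ip0r. Qed.

Lemma ip_gt0 p v : v != 0 -> 0 < ip p v v.
Proof. by have [_ H _] := metricP M; exact: H. Qed.

Lemma ip_ge0 p v : 0 <= ip p v v.
Proof. by have [->|/ip_gt0 /ltW] := eqVneq v 0; [rewrite ip0l|]. Qed.

Lemma ip_eq0 p v : ip p v v = 0 -> v = 0.
Proof. by move=> H; apply: contra_eq H => /ip_gt0 H; rewrite gt_eqF. Qed.

Lemma ip_inj p u v : (forall w, ip p u w = ip p v w) -> u = v.
Proof. by move=> H; apply/subr0_eq/(@ip_eq0 p); rewrite ipBl H subrr. Qed.

Lemma metric_unit p : metric p \in unitmx.
Proof.
rewrite -row_free_unit; apply/inj_row_free => v H.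
by apply: (@ip_eq0 p); rewrite /ip /gdot H mul0mx mxE.
Qed.

Lemma smooth_ip W X Y : open W -> smooth_vfield W X -> smooth_vfield W Y ->
  smooth_fun W (fun q => ip q (X q) (Y q)).
Proof. by have [_ _ H] := metricP M; exact: H. Qed.

End InnerProduct.

Local Opaque ip dfun lie_bracket.

Section Connection.
Variables (R : realType) (n : nat) (M : riemannian R n).
Implicit Types (p q : M) (W : set M) (u v w : 'rV[R]_n) (X Y Z : vfield M).
Local Notation der q v f := (dfun q v ((f : M -> R) : M -> R^o)).

Variable (W : set M).
Hypothesis oW : open W.

Lemma conn_smooth X Y : smooth_vfield W X -> smooth_vfield W Y ->
  smooth_vfield W (fun q => conn q (X q) Y).
Proof. exact: (nabla_smooth (connP M) oW). Qed.

Lemma conn_ext Y Z q v : smooth_vfield W Y -> (forall x, W x -> Y x = Z x) -> W q ->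
  conn q v Y = conn q v Z.
Proof. by move=> sY YZ Wq; exact: (nabla_local (connP M) oW sY YZ). Qed.

Section At.
Variables (q : M).
Hypothesis Wq : W q.

Lemma conn_dirP Y a u v : smooth_vfield W Y ->
  conn q (a *: u + v) Y = a *: conn q u Y + conn q v Y.
Proof. by move=> sY; exact: (nabla_linear (connP M) oW sY). Qed.

Lemma conn_dirD Y u v : smooth_vfield W Y -> conn q (u + v) Y = conn q u Y + conn q v Y.
Proof. by move=> sY; rewrite -[u]scale1r conn_dirP // !scale1r. Qed.

Lemma conn_dir0 Y : smooth_vfield W Y -> conn q 0 Y = 0.
Proof.
by move=> sY; apply: (addrI (conn q 0 Y)); rewrite -conn_dirD // !addr0.
Qed.

Lemma conn_dirZ Y a u : smooth_vfield W Y -> conn q (a *: u) Y = a *: conn q u Y.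
Proof. by move=> sY; rewrite -[a *: u]addr0 conn_dirP // conn_dir0 // addr0. Qed.

Lemma conn_dirB Y u v : smooth_vfield W Y -> conn q (u - v) Y = conn q u Y - conn q v Y.
Proof. by move=> sY; rewrite conn_dirD // -scaleN1r conn_dirZ // scaleN1r. Qed.

Lemma connD Y Z v : smooth_vfield W Y -> smooth_vfield W Z ->
  conn q v (fun x => Y x + Z x) = conn q v Y + conn q v Z.
Proof. by move=> sY sZ; exact: (nabla_additive (connP M) oW sY sZ). Qed.

Lemma connZ (f : M -> R) Y v : smooth_fun W f -> smooth_vfield W Y ->
  conn q v (fun x => f x *: Y x) = der q v f *: Y q + f q *: conn q v Y.
Proof. by move=> sf sY; exact: (nabla_leibniz (connP M) oW sf sY). Qed.

Lemma conn_sum (I : Type) (s : seq I) (Y : I -> vfield M) v :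
  (forall i, smooth_vfield W (Y i)) ->
  conn q v (fun x => \sum_(i <- s) Y i x) = \sum_(i <- s) conn q v (Y i).
Proof.
move=> sY; elim: s => [|i s IH].
  have s0 := @smooth_vfield0 _ _ M W.
  have sS : smooth_vfield W (fun x => \sum_(i <- [::]) Y i x).
    by apply: smooth_vfield_sum.
  have E x : W x -> \sum_(i <- [::]) Y i x = 0 *: (0 : 'rV[R]_n).
    by rewrite big_nil scaler0.
  rewrite big_nil (conn_ext v sS E Wq).
  by rewrite (connZ v (smooth_fun_cst W 0) s0) dfun_cst !scale0r addr0.
rewrite big_cons -IH -connD //; last exact: smooth_vfield_sum.
apply: conn_ext => //; first exact: smooth_vfield_sum.
by move=> x _; rewrite big_cons.
Qed.

Lemma conn0 v : conn q v (fun=> 0 : 'rV[R]_n) = 0.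
Proof.
have s0 := @smooth_vfield0 _ _ M W.
have := connD v s0 s0; rewrite addr0 => /eqP.
by rewrite -subr_eq0 opprD addNKr oppr_eq0 => /eqP.
Qed.

Lemma dfun_ip Y Z v : smooth_vfield W Y -> smooth_vfield W Z ->
  der q v (fun x => ip x (Y x) (Z x)) = ip q (conn q v Y) (Z q) + ip q (Y q) (conn q v Z).
Proof. by move=> sY sZ; exact: (nabla_metric (connP M) oW sY sZ). Qed.

Lemma ip_conn_skew Y Z v (a : R) : smooth_vfield W Y -> smooth_vfield W Z ->
  (forall x, W x -> ip x (Y x) (Z x) = a) ->
  ip q (conn q v Y) (Z q) = - ip q (Y q) (conn q v Z).
Proof.
move=> sY sZ H; apply/eqP; rewrite -addr_eq0 -dfun_ip //.
by rewrite (dfun_local v oW Wq (g := (fun=> a) : M -> R^o) H) dfun_cst.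
Qed.

Lemma lie_bracket_conn X Y : smooth_vfield W X -> smooth_vfield W Y ->
  lie_bracket X Y q = conn q (X q) Y - conn q (Y q) X.
Proof. by move=> sX sY; rewrite (nabla_torsion_free (connP M) oW sX sY). Qed.

(** The right-hand side involves the metric and brackets only; this allows the connections of the
    total space and of the base to be compared without knowing either. *)
Lemma koszul X Y Z : smooth_vfield W X -> smooth_vfield W Y -> smooth_vfield W Z ->
  2 * ip q (conn q (X q) Y) (Z q) =
  der q (X q) (fun x => ip x (Y x) (Z x)) + der q (Y q) (fun x => ip x (X x) (Z x))
  - der q (Z q) (fun x => ip x (X x) (Y x)) + ip q (lie_bracket X Y q) (Z q)
  - ip q (lie_bracket X Z q) (Y q) - ip q (lie_bracket Y Z q) (X q).
Proof.
move=> sX sY sZ; rewrite !dfun_ip // !lie_bracket_conn // !ipBl.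
rewrite (ipC q (Y q) (conn q (X q) Z)) (ipC q (X q) (conn q (Y q) Z)).
rewrite (ipC q (X q) (conn q (Z q) Y)).
ring.
Qed.

End At.

(** Torsion-freeness writes the bracket as a difference of covariant derivatives, which are
    smooth. *)
Lemma smooth_lie_bracket X Y : smooth_vfield W X -> smooth_vfield W Y ->
  smooth_vfield W (lie_bracket X Y).
Proof.
move=> sX sY.
have := smooth_vfieldB (conn_smooth sX sY) (conn_smooth sY sX).
by apply: smooth_vfield_ext => q Wq; rewrite lie_bracket_conn.
Qed.

End Connection.

(** * Local orthonormal frames by Gram-Schmidt *)

Section GramSchmidt.
Variables (R : realType) (n : nat) (M : riemannian R n).
Implicit Types (p q : M) (W : set M) (X Y Z : vfield M).

(* The independence of the values at p is expressed by separating F i p from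
   the previous vectors by a subspace; the inclusion of spans, by testing on
   all subspaces A. *)
Lemma gram_schmidt W p s (F : nat -> vfield M) : open W -> W p ->
  (forall i, smooth_vfield W (F i)) ->
  (forall i, (i < s)%N -> exists A : 'M[R]_n,
     (forall j, (j < i)%N -> (F j p <= A)%MS) /\ ~~ (F i p <= A)%MS) ->
  exists W' (G : nat -> vfield M), [/\ open W', W' p, W' `<=` W,
    forall i, smooth_vfield W' (G i) &
    forall q, W' q ->
      (forall i j, (i < s)%N -> (j < s)%N -> ip q (G i q) (G j q) = (i == j)%:R) /\
      (forall k (A : 'M[R]_n), (forall j, (j < k)%N -> (F j q <= A)%MS) ->
        forall i, (i < s)%N -> (i < k)%N -> (G i q <= A)%MS)].
Proof.
move=> oW Wp sF; elim: s => [|s IH] indep.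
  exists W, F; split=> // q _; split=> // i j; by rewrite ltn0.
have [|W1 [G [oW1 W1p W1W sG GP]]] := IH.
  by move=> i lt_is; apply: indep; rewrite ltnS ltnW.
have sF1 i : smooth_vfield W1 (F i) by exact: smooth_vfield_sub W1W (sF i).
pose F' q := F s q - \sum_(j < s) ip q (F s q) (G j q) *: G j q.
have sF' : smooth_vfield W1 F'.
  apply: smooth_vfieldB => //; apply: smooth_vfield_sum => j.
  by apply: smooth_vfieldZ => //; exact: smooth_ip.
have F'A q (A : 'M[R]_n) : W1 q -> (forall j, (j <= s)%N -> (F j q <= A)%MS) -> (F' q <= A)%MS.
  move=> W1q FA; rewrite addmx_sub ?FA // eqmx_opp; apply: summx_sub => j _.
  apply: scalemx_sub; have [_ GA] := GP q W1q.
  by apply: (GA s.+1) => //; rewrite ltnS ltnW.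
have F'p : F' p != 0.
  have [//|A [AF /negP AFs]] := indep s.
  apply/eqP => /subr0_eq E; apply: AFs; rewrite E; apply: summx_sub => j _.
  by apply: scalemx_sub; have [_ GA] := GP p W1p; exact: (GA s).
have sN := smooth_ip oW1 sF' sF'.
(* Independence is known at [p] only. The remainder [F'] is nonzero at [p], hence nonzero nearby, so
   the domain shrinks at each step. *)
pose W2 := [set q | W1 q /\ 0 < ip q (F' q) (F' q)].
have oW2 : open W2 by exact: open_pos oW1 sN.
have W21 : W2 `<=` W1 by move=> q [].
pose a q : R := (Num.sqrt (ip q (F' q) (F' q)))^-1.
have sa : smooth_fun W2 a.
  by apply: smooth_fun_rsqrt => //; [move=> q []|exact: smooth_fun_sub W21 sN].
have sGs : smooth_vfield W2 (fun q => a q *: F' q).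
  by apply: smooth_vfieldZ => //; exact: smooth_vfield_sub W21 sF'.
pose G' i : vfield M := if (i < s)%N then G i else fun q => a q *: F' q.
have sG' i : smooth_vfield W2 (G' i).
  rewrite /G'; case: ifP => _; last exact: sGs.
  exact: smooth_vfield_sub W21 (sG i).
exists W2, G'; split.
- exact: oW2.
- split; [exact: W1p|exact: ip_gt0].
- exact: subset_trans W21 W1W.
- exact: sG'.
move=> q W2q; have [W1q Nq] := W2q; have [ON GA] := GP q W1q.
have F'G j : (j < s)%N -> ip q (F' q) (G j q) = 0.
  move=> js; rewrite ipBl ip_suml (bigD1 (Ordinal js)) //= ipZl ON // eqxx mulr1.
  rewrite big1 ?addr0 ?subrr // => i; rewrite -val_eqE /= => ij.
  by rewrite ipZl ON // (negPf ij) mulr0.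
split=> [i j|k A FA i]; rewrite ltnS => is_; last first.
  move=> ik; rewrite /G'; case: ltnP => [lt_is|si]; first exact: (GA k).
  have E : i = s by apply/eqP; rewrite eqn_leq is_.
  apply: scalemx_sub; apply: F'A => // j js; apply: FA.
  by apply: leq_ltn_trans js _; rewrite -E.
rewrite ltnS => js; rewrite /G'.
case: (ltnP i s) => [lt_is|si]; case: (ltnP j s) => [lt_js|sj].
- exact: ON.
- rewrite ipZr ipC F'G // mulr0; case: eqP => // E.
  by move: lt_is; rewrite E ltnNge sj.
- rewrite ipZl F'G // mulr0; case: eqP => // E.
  by move: lt_js; rewrite -E ltnNge si.
- have -> : i = s by apply/eqP; rewrite eqn_leq is_.
  have -> : j = s by apply/eqP; rewrite eqn_leq js.
  rewrite eqxx ipZl ipZr mulrA /a -expr2 exprVn sqr_sqrtr; last exact: ltW.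
  by rewrite mulVf // gt_eqF.
Qed.

Lemma orthonormal_row_free q s (U : 'I_s -> 'rV[R]_n) :
  (forall i j, ip q (U i) (U j) = (i == j)%:R) -> row_free (\matrix_(i < s) U i).
Proof.
move=> ON; apply/inj_row_free => c H.
apply/rowP => j; rewrite mxE.
have E : \sum_i c 0 i *: U i = 0.
  by rewrite -[RHS]H mulmx_sum_row; apply: eq_bigr => i _; rewrite rowK.
have := congr1 (fun z => ip q z (U j)) E; rewrite ip0l ip_suml (bigD1 j) //=.
rewrite ipZl ON eqxx mulr1 big1 ?addr0 // => i ij.
by rewrite ipZl ON (negPf ij) mulr0.
Qed.

(** The orthonormal fields lie in [D] because the original ones do; being [s] independent vectors in
    a space of rank [s], they span it. *)
Lemma gram_schmidt_frame W p s (D : M -> 'M[R]_n) (F : 'I_s -> vfield M) : open W -> W p ->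
  (forall i, smooth_vfield W (F i)) -> (forall q, \rank (D q) = s) ->
  (forall q, W q -> forall i, (F i q <= D q)%MS) ->
  row_free (\matrix_(i < s) F i p) ->
  exists W' (U : 'I_s -> vfield M), [/\ open W', W' p, W' `<=` W & orthonormal_frame D W' U].
Proof.
move=> oW Wp sF rD FD /row_freeP [B FB].
(* Indices from [s] on receive the zero field, which keeps every member of the sequence smooth. *)
pose F1 (i : nat) : vfield M := if insub i is Some j then F j else fun=> 0.
have F1E (i : 'I_s) : F1 i = F i by rewrite /F1 valK.
have [||W' [G [oW' W'p W'W sG GP]]] := @gram_schmidt W p s F1 oW Wp.
- move=> i; rewrite /F1; case: insubP => [j _ _|_]; first exact: sF.
  exact: smooth_vfield0.
- move=> i lt_is; pose i' := Ordinal lt_is.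
  have E (j : 'I_s) : F j p *m col i' B = (j == i')%:R%:M.
    apply/rowP => k; rewrite (ord1 k) [RHS]mxE /= mulr1n.
    have := congr1 (fun A : 'M_s => A j i') FB; rewrite [RHS]mxE => <-.
    by rewrite !mxE; apply: eq_bigr => k' _; rewrite !mxE.
  exists (kermx (col i' B)); split.
    move=> j ji; rewrite -[j]/(val (Ordinal (ltn_trans ji lt_is))) F1E.
    apply/sub_kermxP; rewrite E -val_eqE /= (ltn_eqF ji).
    by apply/rowP => k; rewrite !mxE mul0rn.
  rewrite -[i]/(val i') F1E; apply/negP => /sub_kermxP.
  rewrite E eqxx => /matrixP /(_ 0 0); rewrite !mxE /= => /eqP.
  by rewrite oner_eq0.
exists W', (fun i => G i); split=> //; split=> // q W'q.
  by move=> i j; have [ON _] := GP q W'q; rewrite ON // val_eqE.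
have [ON GA] := GP q W'q.
have fr : row_free (\matrix_(i < s) G i q).
  by apply: (@orthonormal_row_free q) => i j; rewrite ON // val_eqE.
have sub : (\matrix_(i < s) G i q <= D q)%MS.
  apply/row_subP => i; rewrite rowK; apply: (GA s) => // j js.
  by rewrite -[j]/(val (Ordinal js)) F1E; apply: FD; exact: W'W.
by have := mxrank_leqif_eq sub => -[_ <-]; rewrite rD (eqP fr).
Qed.

End GramSchmidt.

(** * Riemannian submersions *)

Section Projections.
Variables (R : realType) (n k : nat) (M : riemannian R n) (N : riemannian R k) (pi : M -> N).
Implicit Types (p q : M) (u v w : 'rV[R]_n).

Lemma verticalP p v : reflect (v *m dmap pi p = 0) (v <= vertical pi p)%MS.
Proof. exact: sub_kermxP. Qed.

Lemma horizontalP p v :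
  (v <= horizontal pi p)%MS <-> forall u, (u <= vertical pi p)%MS -> ip p v u = 0.
Proof.
split=> [/sub_kermxP H u /submxP [c ->]|H].
  by rewrite ipE trmx_mul mulmxA -(mulmxA v) H mul0mx mxE.
apply/sub_kermxP/rowP => j; rewrite [RHS]mxE.
have := H (row j (vertical pi p)) (row_sub _ _).
rewrite ipE -mulmxA => <-; rewrite !mxE; apply: eq_bigr => i _; congr (_ * _).
by rewrite !mxE; apply: eq_bigr => m _; rewrite !mxE.
Qed.

Lemma vertical_cap_horizontal p : (vertical pi p :&: horizontal pi p = 0)%MS.
Proof.
apply/eqP; rewrite -submx0; apply/rV_subP => v; rewrite sub_capmx => /andP[vV /horizontalP vH].
by rewrite (ip_eq0 (vH v vV)) sub0mx.
Qed.

Lemma horizontal_cap_vertical p : (horizontal pi p :&: vertical pi p = 0)%MS.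
Proof. by rewrite capmxC vertical_cap_horizontal. Qed.

Lemma rank_horizontal p : \rank (horizontal pi p) = (n - \rank (vertical pi p))%N.
Proof.
rewrite mxrank_ker; congr (_ - _)%N.
rewrite -mxrank_tr trmx_mul trmxK mxrankMfree //.
by rewrite row_free_unit unitmx_tr metric_unit.
Qed.

Lemma vertical_add_horizontal p v : (v <= vertical pi p + horizontal pi p)%MS.
Proof.
suff E : (vertical pi p + horizontal pi p :=: 1%:M)%MS by rewrite E submx1.
apply/eqmxP; rewrite submx1 /= sub1mx /row_full.
have := mxrank_sum_cap (vertical pi p) (horizontal pi p).
rewrite vertical_cap_horizontal mxrank0 addn0 => ->.
by rewrite rank_horizontal subnKC // rank_leq_row.
Qed.

Lemma ver_sub p v : (ver pi p v <= vertical pi p)%MS.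
Proof. exact: proj_mx_sub. Qed.

Lemma hor_sub p v : (hor pi p v <= horizontal pi p)%MS.
Proof. exact: proj_mx_sub. Qed.

Lemma ver_hor p v : ver pi p v + hor pi p v = v.
Proof.
exact: (add_proj_mx (vertical_cap_horizontal p) (vertical_add_horizontal p v)).
Qed.

Lemma ver_id p v : (v <= vertical pi p)%MS -> ver pi p v = v.
Proof. exact: proj_mx_id (vertical_cap_horizontal p). Qed.

Lemma hor_id p v : (v <= horizontal pi p)%MS -> hor pi p v = v.
Proof. exact: proj_mx_id (horizontal_cap_vertical p). Qed.

Lemma hor_vertical p v : (v <= vertical pi p)%MS -> hor pi p v = 0.
Proof. exact: proj_mx_0 (horizontal_cap_vertical p). Qed.

Lemma ver_horizontal p v : (v <= horizontal pi p)%MS -> ver pi p v = 0.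
Proof. exact: proj_mx_0 (vertical_cap_horizontal p). Qed.

Lemma ip_hv p u v : (u <= horizontal pi p)%MS -> (v <= vertical pi p)%MS -> ip p u v = 0.
Proof. by move=> /horizontalP; exact. Qed.

Lemma ip_vh p u v : (u <= vertical pi p)%MS -> (v <= horizontal pi p)%MS -> ip p u v = 0.
Proof. by move=> uV vH; rewrite ipC ip_hv. Qed.

Lemma ip_ver p u v : (v <= vertical pi p)%MS -> ip p (ver pi p u) v = ip p u v.
Proof. by move=> vV; rewrite -{2}(ver_hor p u) ipDl (ip_hv (hor_sub _ _) vV) addr0. Qed.

Lemma ip_hor p u v : (v <= horizontal pi p)%MS -> ip p (hor pi p u) v = ip p u v.
Proof. by move=> vV; rewrite -{2}(ver_hor p u) ipDl (ip_vh (ver_sub _ _) vV) add0r. Qed.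

Lemma ip_verr p u v : (v <= vertical pi p)%MS -> ip p v (ver pi p u) = ip p v u.
Proof. by move=> vV; rewrite !(ipC p v) ip_ver. Qed.

Lemma ip_horr p u v : (v <= horizontal pi p)%MS -> ip p v (hor pi p u) = ip p v u.
Proof. by move=> vV; rewrite !(ipC p v) ip_hor. Qed.

Lemma verD p u v : ver pi p (u + v) = ver pi p u + ver pi p v.
Proof. exact: mulmxDl. Qed.

Lemma verB p u v : ver pi p (u - v) = ver pi p u - ver pi p v.
Proof. exact: mulmxBl. Qed.

Lemma horB p u v : hor pi p (u - v) = hor pi p u - hor pi p v.
Proof. exact: mulmxBl. Qed.

Lemma orthonormal_expand p s (U : 'I_s -> 'rV[R]_n) v :
  (forall i j, ip p (U i) (U j) = (i == j)%:R) -> (v <= \matrix_(i < s) U i)%MS ->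
  v = \sum_i ip p v (U i) *: U i.
Proof.
move=> ON /submxP [c ->]; rewrite mulmx_sum_row; apply: eq_bigr => i _.
rewrite ip_suml (bigD1 i) //= big1 ?addr0 => [|j ji]; rewrite !rowK ipZl ON ?eqxx ?mulr1 //.
by rewrite (negPf ji) mulr0.
Qed.

Section Submersion.
Hypothesis hpi : riemannian_submersion pi.

Lemma hlift_sub p (w : 'rV[R]_k) : (hlift pi p w <= horizontal pi p)%MS.
Proof. exact: hor_sub. Qed.

Lemma hor_dmap p v : hor pi p v *m dmap pi p = v *m dmap pi p.
Proof. by rewrite -{2}(ver_hor p v) mulmxDl (verticalP _ _ (ver_sub p v)) add0r. Qed.

Lemma hlift_dmap p (w : 'rV[R]_k) : hlift pi p w *m dmap pi p = w.
Proof.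
rewrite hor_dmap -mulmxA mulVpmx ?mulmx1 //.
by rewrite /row_full (rs_rank hpi).
Qed.

Lemma horizontal_inj p u v : (u <= horizontal pi p)%MS -> (v <= horizontal pi p)%MS ->
  u *m dmap pi p = v *m dmap pi p -> u = v.
Proof.
move=> uH vH E; apply/subr0_eq/(@ip_eq0 _ _ _ p); apply: ip_hv.
  by rewrite addmx_sub // eqmx_opp.
by apply/verticalP; rewrite mulmxBl E subrr.
Qed.

Lemma hlift_id p v : (v <= horizontal pi p)%MS -> hlift pi p (v *m dmap pi p) = v.
Proof. by move=> vH; apply: horizontal_inj (hlift_sub _ _) vH _; rewrite hlift_dmap. Qed.

(** The isometry condition concerns two horizontal vectors. One is enough, because the vertical part
    of the other is killed by [dmap] and orthogonal to [v]. *)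
Lemma ip_dmap p u v : (v <= horizontal pi p)%MS ->
  ip (pi p) (u *m dmap pi p) (v *m dmap pi p) = ip p u v.
Proof. by move=> vH; rewrite -(hor_dmap p u) (rs_isometry hpi) ?hor_sub // ip_hor. Qed.

Lemma ip_hlift p (w : 'rV[R]_k) v : (v <= horizontal pi p)%MS ->
  ip p (hlift pi p w) v = ip (pi p) w (v *m dmap pi p).
Proof. by move=> vH; rewrite -ip_dmap // hlift_dmap. Qed.

End Submersion.
End Projections.

(** * Related fields and basic lifts *)

Section Related.
Variables (R : realType) (n k : nat) (M : riemannian R n) (N : riemannian R k) (pi : M -> N).
Hypothesis spi : smooth_map pi.
Local Notation der q v f := (dfun q v ((f : _ -> R) : _ -> R^o)).

(** Tested on the coordinate functions f of the base. Relatedness means X(f o pi) = (Y f) o pi; used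
    twice, it carries each of the two iterated derivatives in the bracket from the total space to
    the base. *)
Lemma lie_bracket_related (W : set M) (V : set N) (X1 X2 : vfield M) (Y1 Y2 : vfield N) q :
  open W -> open V -> W q -> V (pi q) ->
  smooth_vfield W X1 -> smooth_vfield W X2 -> smooth_vfield V Y1 -> smooth_vfield V Y2 ->
  (forall x, W x -> V (pi x) -> X1 x *m dmap pi x = Y1 (pi x)) ->
  (forall x, W x -> V (pi x) -> X2 x *m dmap pi x = Y2 (pi x)) ->
  lie_bracket X1 X2 q *m dmap pi q = lie_bracket Y1 Y2 (pi q).
Proof.
move=> oW oV Wq Vq sX1 sX2 sY1 sY2 r1 r2.
pose y := pi q; have dy := chart_dom_self y.
have oD := @chart_dom_open _ _ N y.
pose V' := V `&` chart_dom y; have oV' : open V' by exact: openI.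
have V'q : V' y by [].
have V'V : V' `<=` V by exact: subIsetl.
apply/rowP => j.
pose f (x : N) : R := chart y x 0 j.
have sf : smooth_fun V' f.
  by apply: smooth_fun_sub (smooth_fun_coord y j); exact: subIsetr.
have dc := mdifferentiable_chart_fun dy.
have coord (v : 'rV[R]_k) : v 0 j = der y v f.
  by rewrite -(dfun_row v j dc) dfun_self.
rewrite !coord.
have df x : V' x -> mdifferentiable (f : N -> R^o) x.
  by move=> Vx; exact: smooth_mdifferentiable oV' Vx sf.
rewrite -(dfun_comp spi _ (df y V'q)).
pose W' := W `&` pi @^-1` V'.
have oW' : open W' by apply: openI => //; exact: (open_preimage spi).
have W'q : W' q by split.
have W'W : W' `<=` W by exact: subIsetl.
have sfpi : smooth_fun W' (f \o pi).
  by apply: smooth_fun_sub (smooth_fun_comp spi oV' sf); exact: subIsetr.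
rewrite (dfun_lie_bracket oW' W'q (smooth_vfield_sub W'W sX1) (smooth_vfield_sub W'W sX2) sfpi).
rewrite (dfun_lie_bracket oV' V'q (smooth_vfield_sub V'V sY1) (smooth_vfield_sub V'V sY2) sf).
have step (A1 A2 : vfield M) (B1 B2 : vfield N) :
    smooth_vfield V B2 ->
    (forall x, W x -> V (pi x) -> A1 x *m dmap pi x = B1 (pi x)) ->
    (forall x, W x -> V (pi x) -> A2 x *m dmap pi x = B2 (pi x)) ->
    der q (A1 q) (fun x => der x (A2 x) (f \o pi)) = der y (B1 y) (fun x => der x (B2 x) f).
  move=> sB rA1 rA2.
  have E x : W' x -> der x (A2 x) (f \o pi) = (fun z => der z (B2 z) f) (pi x).
    by move=> [Wx Vx]; rewrite (dfun_comp spi _ (df _ Vx)) rA2 //; case: Vx.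
  rewrite (dfun_local _ oW' W'q E).
  have sg : smooth_fun V' (fun z => der z (B2 z) f) by exact: sB.
  have dg := smooth_mdifferentiable oV' V'q sg.
  by rewrite (dfun_comp spi (A1 q) dg) rA1.
exact: (f_equal2 (fun a b : R => a - b) (step _ _ _ _ sY2 r1 r2) (step _ _ _ _ sY1 r2 r1)).
Qed.

End Related.

Section BasicLifts.
Variables (R : realType) (n k l : nat) (M : riemannian R n) (N : riemannian R k) (pi : M -> N).
Hypothesis hpi : riemannian_submersion pi.
Variables (W : set M) (X : 'I_l -> vfield M).
Hypothesis oW : open W.
Hypothesis frX : orthonormal_frame (horizontal pi) W X.
Implicit Types (p q : M) (V : set N) (Y Z : vfield M) (B : vfield N).
Local Notation der q v f := (dfun q v ((f : _ -> R) : _ -> R^o)).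
Let spi := rs_smooth hpi.

Lemma frame_smooth i : smooth_vfield W (X i).
Proof. by have [] := frX. Qed.

Lemma frame_horizontal q i : W q -> (X i q <= horizontal pi q)%MS.
Proof.
move=> Wq; have [_ _ /(_ q Wq) /andP[H _]] := frX.
by apply: submx_trans H; rewrite -(rowK (fun i => X i q) i) row_sub.
Qed.

Lemma hor_frame q v : W q -> hor pi q v = \sum_i ip q v (X i q) *: X i q.
Proof.
move=> Wq; have [_ ON /(_ q Wq) /andP[_ H]] := frX.
have := orthonormal_expand (ON q Wq) (submx_trans (hor_sub pi q v) H).
move=> {1}->; apply: eq_bigr => i _; rewrite ip_hor //; exact: frame_horizontal.
Qed.

(** The pointwise projection matrix is not known to vary smoothly, but through the frame the
    projection is the sum of the <Y, X_i> X_i. *)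
Lemma smooth_hor W' Y : open W' -> W' `<=` W -> smooth_vfield W' Y ->
  smooth_vfield W' (fun q => hor pi q (Y q)).
Proof.
move=> oW' W'W sY.
have sX i := smooth_vfield_sub W'W (frame_smooth i).
have : smooth_vfield W' (fun q => \sum_i ip q (Y q) (X i q) *: X i q).
  apply: smooth_vfield_sum => i; apply: smooth_vfieldZ (sX i).
  exact: smooth_ip oW' sY (sX i).
by apply: smooth_vfield_ext => q W'q; rewrite -hor_frame //; exact: W'W.
Qed.

Lemma smooth_ver W' Y : open W' -> W' `<=` W -> smooth_vfield W' Y ->
  smooth_vfield W' (fun q => ver pi q (Y q)).
Proof.
move=> oW' W'W sY.
have := smooth_vfieldB sY (smooth_hor oW' W'W sY).
by apply: smooth_vfield_ext => q _; rewrite -{1}(ver_hor pi q (Y q)) addrK.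
Qed.

Definition basic_lift B : vfield M := fun q => hlift pi q (B (pi q)).

Lemma lift_horizontal B q : (basic_lift B q <= horizontal pi q)%MS.
Proof. exact: hlift_sub. Qed.

Lemma lift_dmap B q : basic_lift B q *m dmap pi q = B (pi q).
Proof. exact: hlift_dmap. Qed.

Lemma ip_lift B q v : (v <= horizontal pi q)%MS ->
  ip q v (basic_lift B q) = ip (pi q) (v *m dmap pi q) (B (pi q)).
Proof. by move=> vH; rewrite ipC ip_hlift // ipC. Qed.

Lemma ip_lift_lift B B' q : ip q (basic_lift B q) (basic_lift B' q) = ip (pi q) (B (pi q)) (B' (pi q)).
Proof. by rewrite ip_lift ?lift_horizontal // lift_dmap. Qed.

Lemma ip_liftr B q v : ip q v (basic_lift B q) = ip (pi q) (v *m dmap pi q) (B (pi q)).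
Proof. by rewrite -(hor_dmap pi q v) -ip_lift ?hor_sub // ip_hor ?lift_horizontal. Qed.

(** [hlift] uses a pseudo-inverse at each point, so smoothness is read off the frame coefficients.
    The coefficient on X_i is the product of B o pi with the image of X_i, and [dmap_decomp] expands
    that image over a fixed base chart with smooth coefficients. *)
Lemma smooth_lift V B : open V -> smooth_vfield V B ->
  smooth_vfield (W `&` pi @^-1` V) (basic_lift B).
Proof.
move=> oV sB.
have oP : open (pi @^-1` V) by exact: (open_preimage spi).
have oW' : open (W `&` pi @^-1` V) by exact: openI.
have W'W : W `&` pi @^-1` V `<=` W by exact: subIsetl.
have sX i := smooth_vfield_sub W'W (frame_smooth i).
have : smooth_vfield (W `&` pi @^-1` V) (fun q => \sum_i ip q (basic_lift B q) (X i q) *: X i q).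
  apply: smooth_vfield_sum => i; apply: smooth_vfieldZ (sX i).
  apply: smooth_fun_cover => q0 [Wq0 Vq0].
  pose y := pi q0; have oD := @chart_dom_open _ _ N y.
  have oVy : open (V `&` chart_dom y) by exact: openI.
  pose W0 := W `&` pi @^-1` (V `&` chart_dom y).
  have oPy := open_preimage spi oVy.
  have oW0 : open W0 by exact: openI.
  have W0P : W0 `<=` pi @^-1` (V `&` chart_dom y) by exact: subIsetr.
  have W0W : W0 `<=` W by exact: subIsetl.
  exists W0; split; first by split=> //; split=> //; exact: chart_dom_self.
  have sXi := smooth_vfield_sub W0W (frame_smooth i).
  have sc a : smooth_fun W0 (fun q => chart y (pi q) 0 a).
    by apply: smooth_fun_sub (smooth_fun_map_coord spi y a) => q [_ []].
  have se a : smooth_fun W0 (fun q => ip (pi q) (B (pi q)) (const_ext y (delta_mx 0 a) (pi q))).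
    apply: smooth_fun_sub W0P _.
    apply: (smooth_fun_comp spi oVy (f := fun z => ip z (B z) (const_ext y (delta_mx 0 a) z))).
    apply: smooth_ip oVy _ _; first by exact: (smooth_vfield_sub (@subIsetl _ _ _) sB).
    by exact: (smooth_vfield_sub (@subIsetr _ _ _) (@smooth_const_ext _ _ _ y _)).
  have : smooth_fun W0 (fun q => \sum_a der q (X i q) (fun x => chart y (pi x) 0 a) *
      ip (pi q) (B (pi q)) (const_ext y (delta_mx 0 a) (pi q))).
    apply: smooth_fun_sum => // a; apply: smooth_funM => //.
    exact: (sXi W0 _ oW0 (@subset_refl _ _) (sc a)).
  apply: smooth_fun_ext => // q [Wq [Vq yq]].
  rewrite ipC ip_liftr (dmap_decomp spi (X i q) yq) ip_suml.
  by apply: eq_bigr => a _; rewrite ipZl (ipC (pi q) (const_ext _ _ _)).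
apply: smooth_vfield_ext => q [Wq _].
by rewrite -hor_frame // hor_id // lift_horizontal.
Qed.

End BasicLifts.

(** * O'Neill's tensors and curvature equations *)

Local Opaque ver hor.

Section ONeill.
Variables (R : realType) (n k l : nat) (M : riemannian R n) (N : riemannian R k) (pi : M -> N).
Hypothesis hpi : riemannian_submersion pi.
Implicit Types (W : set M) (p q : M) (V : set N) (X Y Z : vfield M) (B C : vfield N).
Local Notation der q v f := (dfun q v ((f : _ -> R) : _ -> R^o)).
Let spi := rs_smooth hpi.

Definition vertical_on W Y := forall q, W q -> (Y q <= vertical pi q)%MS.
Definition horizontal_on W Y := forall q, W q -> (Y q <= horizontal pi q)%MS.

Lemma orthonormal_frame_sub s (D : M -> 'M[R]_n) W W' (U : 'I_s -> vfield M) :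
  W' `<=` W -> orthonormal_frame D W U -> orthonormal_frame D W' U.
Proof.
move=> W'W [sU ON E]; split=> [i|q /W'W|q /W'W].
- exact: (smooth_vfield_sub W'W (sU i)).
- exact: ON.
- exact: E.
Qed.

Lemma ip_vh_on W Y Z q : vertical_on W Y -> horizontal_on W Z -> W q -> ip q (Y q) (Z q) = 0.
Proof. by move=> vY hZ Wq; apply: ip_vh; [exact: vY|exact: hZ]. Qed.

Lemma ip_hv_on W Y Z q : horizontal_on W Y -> vertical_on W Z -> W q -> ip q (Y q) (Z q) = 0.
Proof. by move=> hY vZ Wq; apply: ip_hv; [exact: hY|exact: vZ]. Qed.

(** A vertical field is [pi]-related to the zero field, so the bracket of two of them is mapped to
    zero. *)
Lemma bracket_vertical W Y Z q : open W -> W q -> smooth_vfield W Y -> smooth_vfield W Z ->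
  vertical_on W Y -> vertical_on W Z -> (lie_bracket Y Z q <= vertical pi q)%MS.
Proof.
move=> oW Wq sY sZ vY vZ; apply/verticalP.
have s0 := @smooth_vfield0 _ _ N setT.
rewrite (@lie_bracket_related _ _ _ _ _ _ spi W setT Y Z (fun=> 0) (fun=> 0) q) //.
- exact: lie_bracket0l.
- exact: openT.
- by move=> x Wx _; apply/verticalP/vY.
- by move=> x Wx _; apply/verticalP/vZ.
Qed.

Lemma T_sym W Y Z q : open W -> W q -> smooth_vfield W Y -> smooth_vfield W Z ->
  vertical_on W Y -> vertical_on W Z ->
  hor pi q (conn q (Y q) Z) = hor pi q (conn q (Z q) Y).
Proof.
move=> oW Wq sY sZ vY vZ; apply/subr0_eq; rewrite -horB -(lie_bracket_conn oW Wq sY sZ).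
exact/hor_vertical/(bracket_vertical oW Wq sY sZ vY vZ).
Qed.

Section Framed.
Variables (W : set M) (X : 'I_l -> vfield M).
Hypothesis oW : open W.
Hypothesis frX : orthonormal_frame (horizontal pi) W X.

Lemma vsmooth Y : smooth_vfield W Y -> smooth_vfield W (fun q => ver pi q (Y q)).
Proof. exact: (smooth_ver frX oW (@subset_refl _ _)). Qed.

Lemma hsmooth Y : smooth_vfield W Y -> smooth_vfield W (fun q => hor pi q (Y q)).
Proof. exact: (smooth_hor frX oW (@subset_refl _ _)). Qed.

Lemma ver_vertical_on Y : vertical_on W (fun q => ver pi q (Y q)).
Proof. by move=> q _; exact: ver_sub. Qed.

Section Lifts.
Variable V : set N.
Hypothesis oV : open V.
Hypothesis WV : forall q, W q -> V (pi q).

Lemma lift_smooth B : smooth_vfield V B -> smooth_vfield W (basic_lift pi B).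
Proof.
move=> sB; have := smooth_lift hpi oW frX oV sB.
by apply: smooth_vfield_sub => q Wq; split => //; exact: WV.
Qed.

Lemma lift_horizontal_on B : horizontal_on W (basic_lift pi B).
Proof. by move=> q _; exact: lift_horizontal. Qed.

Lemma bracket_vertical_lift Y B q : W q -> smooth_vfield W Y -> vertical_on W Y ->
  smooth_vfield V B -> (lie_bracket Y (basic_lift pi B) q <= vertical pi q)%MS.
Proof.
move=> Wq sY vY sB; apply/verticalP.
have s0 := @smooth_vfield0 _ _ N V.
have sL := lift_smooth sB.
have r1 x : W x -> V (pi x) -> Y x *m dmap pi x = (fun=> 0) (pi x).
  by move=> Wx _; apply/verticalP/vY.
have r2 x : W x -> V (pi x) -> basic_lift pi B x *m dmap pi x = B (pi x).
  by move=> Wx _; exact: lift_dmap.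
rewrite (lie_bracket_related spi oW oV Wq (WV Wq) sY sL s0 sB r1 r2).
exact: lie_bracket0l.
Qed.

(** Let L be the lift and v = V nabla_L L. Then |v|^2 = <nabla_L L, v> = -<L, nabla_L v> = -<L,
    nabla_v L>, the last step because [v, L] is vertical. This is -1/2 of the derivative of |L|^2
    along v, which is zero: |L|^2 comes from the base and v is vertical. *)
Lemma A_alt_lift B q : W q -> smooth_vfield V B ->
  ver pi q (conn q (basic_lift pi B q) (basic_lift pi B)) = 0.
Proof.
move=> Wq sB; have sL := lift_smooth sB; have hL := @lift_horizontal_on B.
pose v z := ver pi z (conn z (basic_lift pi B z) (basic_lift pi B)).
have sv : smooth_vfield W v by apply: vsmooth; exact: (conn_smooth oW sL sL).
have vv : vertical_on W v by exact: ver_vertical_on.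
apply: (@ip_eq0 _ _ _ q); rewrite -/(v q) {2}/v ip_verr ?vv //.
have vL x : W x -> ip x (basic_lift pi B x) (v x) = 0 by exact: ip_hv_on.
have E1 := ip_conn_skew oW Wq (basic_lift pi B q) sL sv vL.
have E2 := lie_bracket_conn oW Wq sv sL.
have E3 := dfun_ip oW Wq (v q) sL sL.
have E4 : der q (v q) (fun x => ip x (basic_lift pi B x) (basic_lift pi B x)) = 0.
  have E x : W x -> ip x (basic_lift pi B x) (basic_lift pi B x) = ((fun y => ip y (B y) (B y)) \o pi) x.
    by move=> _; exact: ip_lift_lift.
  rewrite (dfun_local _ oW Wq E) (dfun_comp spi).
    by rewrite (verticalP _ _ _ (vv q Wq)) dfun0v.
  exact: smooth_mdifferentiable oV (WV Wq) (smooth_ip oV sB sB).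
have E5 : ip q (basic_lift pi B q) (lie_bracket v (basic_lift pi B) q) = 0.
  by apply: ip_hv; [exact: hL|exact: bracket_vertical_lift].
move: E5; rewrite E2 ipBr => /subr0_eq E5.
rewrite ipC E1 -E5.
by move: E3; rewrite E4 (ipC q (conn _ _ _)) -mulr2n => /esym/eqP; rewrite mulrn_eq0 => /eqP ->; rewrite oppr0.
Qed.

End Lifts.
End Framed.

(** For vertical v, <nabla_Y Y, v> = -<Y, nabla_Y v> depends only on the value of Y at [q]. So Y may
    be replaced by the basic lift with the same value there, to which [A_alt_lift] applies. *)
Lemma A_alt W (X : 'I_l -> vfield M) Y q : open W -> orthonormal_frame (horizontal pi) W X ->
  W q -> smooth_vfield W Y -> horizontal_on W Y -> ver pi q (conn q (Y q) Y) = 0.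
Proof.
move=> oW frX Wq sY hY.
pose y := pi q; pose B := const_ext y (Y q *m dmap pi q).
have dy := chart_dom_self y; have oV := @chart_dom_open _ _ N y.
have sB : smooth_vfield (chart_dom y) B by exact: smooth_const_ext.
pose W1 := W `&` pi @^-1` chart_dom y.
have oW1 : open W1 by apply: openI => //; exact: (open_preimage spi).
have W1W : W1 `<=` W by exact: subIsetl.
have W1q : W1 q by [].
have frX1 := orthonormal_frame_sub W1W frX.
have W1V x : W1 x -> chart_dom y (pi x) by case.
have Lq : basic_lift pi B q = Y q.
  by rewrite /basic_lift /B const_ext_self (hlift_id hpi) //; exact: hY.
have sL := lift_smooth oW1 frX1 oV W1V sB.
have A0 := A_alt_lift oW1 frX1 oV W1V W1q sB.
have sv : smooth_vfield W1 (fun z => ver pi z (conn z (Y z) Y)).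
  apply: (vsmooth oW1 frX1).
  have sY1 := smooth_vfield_sub W1W sY; exact: (conn_smooth oW1 sY1 sY1).
set v := fun z => _ in sv.
have vv : vertical_on W1 v by move=> z _; exact: ver_sub.
have sY1 := smooth_vfield_sub W1W sY.
have hY1 : horizontal_on W1 Y by move=> z /W1W; exact: hY.
have hL : horizontal_on W1 (basic_lift pi B) by move=> z _; exact: lift_horizontal.
apply: (@ip_eq0 _ _ _ q); rewrite -/(v q) {2}/v ip_verr ?vv //.
have vY x : W1 x -> ip x (v x) (Y x) = 0 by exact: ip_vh_on.
have vL x : W1 x -> ip x (v x) (basic_lift pi B x) = 0 by exact: ip_vh_on.
have E1 := ip_conn_skew oW1 W1q (Y q) sv sY1 vY.
have E2 := ip_conn_skew oW1 W1q (Y q) sv sL vL.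
apply: oppr_inj; rewrite -E1 -[X in ip q _ X]Lq E2 -Lq.
by rewrite -(ip_verr _ (vv q W1q)) A0 ip0r.
Qed.

(** Polarisation of [A_alt]. *)
Lemma A_skew W (X : 'I_l -> vfield M) Y Z q : open W -> orthonormal_frame (horizontal pi) W X ->
  W q -> smooth_vfield W Y -> smooth_vfield W Z -> horizontal_on W Y -> horizontal_on W Z ->
  ver pi q (conn q (Y q) Z) = - ver pi q (conn q (Z q) Y).
Proof.
move=> oW frX Wq sY sZ hY hZ.
have sYZ := smooth_vfieldD sY sZ.
have hYZ : horizontal_on W (fun z => Y z + Z z).
  by move=> z Wz; apply: addmx_sub; [exact: hY|exact: hZ].
have := A_alt oW frX Wq sYZ hYZ.
rewrite (connD oW Wq _ sY sZ) (conn_dirD oW Wq _ _ sY) (conn_dirD oW Wq _ _ sZ) !verD.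
rewrite (A_alt oW frX Wq sY hY) (A_alt oW frX Wq sZ hZ) add0r addr0 => H.
by apply/eqP; rewrite -addr_eq0 addrC H.
Qed.

Section LiftCurvature.
Variables (W : set M) (X : 'I_l -> vfield M).
Hypothesis oW : open W.
Hypothesis frX : orthonormal_frame (horizontal pi) W X.
Variable V : set N.
Hypothesis oV : open V.
Hypothesis WV : forall q, W q -> V (pi q).

Lemma bracket_lift B C q : W q -> smooth_vfield V B -> smooth_vfield V C ->
  lie_bracket (basic_lift pi B) (basic_lift pi C) q *m dmap pi q = lie_bracket B C (pi q).
Proof.
move=> Wq sB sC.
apply: (lie_bracket_related spi oW oV Wq (WV Wq) (lift_smooth oW frX oV WV sB)
  (lift_smooth oW frX oV WV sC) sB sC) => x _ _; exact: lift_dmap.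
Qed.

Lemma der_ip_lift A B C q : W q -> smooth_vfield V B -> smooth_vfield V C ->
  der q (basic_lift pi A q) (fun x => ip x (basic_lift pi B x) (basic_lift pi C x)) =
  der (pi q) (A (pi q)) (fun y => ip y (B y) (C y)).
Proof.
move=> Wq sB sC.
have E x : W x -> ip x (basic_lift pi B x) (basic_lift pi C x) = ((fun y => ip y (B y) (C y)) \o pi) x.
  by move=> _; exact: ip_lift_lift.
rewrite (dfun_local _ oW Wq E) (dfun_comp spi) ?lift_dmap //.
exact: smooth_mdifferentiable oV (WV Wq) (smooth_ip oV sB sC).
Qed.

End LiftCurvature.
End ONeill.

(** * Curvature equations for horizontal, vertical and mixed pairs *)

Section Curvature.
Variables (R : realType) (n k l : nat) (M : riemannian R n) (N : riemannian R k) (pi : M -> N).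
Hypothesis hpi : riemannian_submersion pi.
Variables (W : set M) (X : 'I_l -> vfield M).
Hypothesis oW : open W.
Hypothesis frX : orthonormal_frame (horizontal pi) W X.
Implicit Types (p q : M) (Y Z U : vfield M) (B C : vfield N).
Local Notation vertical_on := (vertical_on pi).
Local Notation horizontal_on := (horizontal_on pi).
Let vsmooth := vsmooth oW frX.
Let hsmooth := hsmooth oW frX.

Section LiftCurvature.
Variable V : set N.
Hypothesis oV : open V.
Hypothesis WV : forall q, W q -> V (pi q).

Let Lsmooth B : smooth_vfield V B -> smooth_vfield W (basic_lift pi B).
Proof. exact: (lift_smooth hpi oW frX oV WV). Qed.

(** Paired with an arbitrary vector of the base, extended to a field and lifted, both sides are
    given by Koszul's formula; its six terms agree because lifting preserves inner products and
    brackets are mapped to brackets. *)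
Lemma conn_lift_dmap B C q : W q -> smooth_vfield V B -> smooth_vfield V C ->
  conn q (basic_lift pi B q) (basic_lift pi C) *m dmap pi q = conn (pi q) (B (pi q)) C.
Proof.
move=> Wq sB sC.
pose y := pi q; apply: (@ip_inj _ _ N y) => w.
pose V1 := V `&` chart_dom y.
have oD := @chart_dom_open _ _ N y.
have oV1 : open V1 by exact: openI.
have V1y : V1 y by split; [exact: WV|exact: chart_dom_self].
have V1V : V1 `<=` V by exact: subIsetl.
pose W1 := W `&` pi @^-1` V1.
have oW1 : open W1 by apply: openI => //; exact: (open_preimage (rs_smooth hpi) oV1).
have W1q : W1 q by [].
have W1W : W1 `<=` W by exact: subIsetl.
have W1V x : W1 x -> V1 (pi x) by case.
have frX1 := orthonormal_frame_sub W1W frX.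
pose D := const_ext y w.
have sD : smooth_vfield V1 D.
  exact: (smooth_vfield_sub (@subIsetr _ _ _) (@smooth_const_ext _ _ _ y _)).
have Dy : D y = w by exact: const_ext_self.
have sB1 := smooth_vfield_sub V1V sB; have sC1 := smooth_vfield_sub V1V sC.
have sLB := lift_smooth hpi oW1 frX1 oV1 W1V sB1.
have sLC := lift_smooth hpi oW1 frX1 oV1 W1V sC1.
have sLD := lift_smooth hpi oW1 frX1 oV1 W1V sD.
rewrite -Dy -(ip_liftr hpi).
have K1 := koszul oW1 W1q sLB sLC sLD.
have K2 := koszul oV1 V1y sB1 sC1 sD.
have two : (2 : R) != 0 by rewrite pnatr_eq0.
have b P Q S : smooth_vfield V1 P -> smooth_vfield V1 Q ->
    ip q (lie_bracket (basic_lift pi P) (basic_lift pi Q) q) (basic_lift pi S q) = ip y (lie_bracket P Q y) (S y).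
  by move=> sP sQ; rewrite (ip_liftr hpi) (bracket_lift hpi oW1 frX1 oV1 W1V W1q sP sQ).
have comb (a1 a2 a3 a4 a5 a6 b1 b2 b3 b4 b5 b6 : R) : a1 = b1 -> a2 = b2 -> a3 = b3 ->
    a4 = b4 -> a5 = b5 -> a6 = b6 -> a1 + a2 - a3 + a4 - a5 - a6 = b1 + b2 - b3 + b4 - b5 - b6.
  by move=> -> -> -> -> -> ->.
have E := comb _ _ _ _ _ _ _ _ _ _ _ _ (der_ip_lift hpi oW1 oV1 W1V B W1q sC1 sD)
  (der_ip_lift hpi oW1 oV1 W1V C W1q sB1 sD) (der_ip_lift hpi oW1 oV1 W1V D W1q sB1 sC1)
  (b _ _ D sB1 sC1) (b _ _ C sB1 sD) (b _ _ B sC1 sD).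
exact: (mulfI two (etrans K1 (etrans E (esym K2)))).
Qed.

Lemma ip_conn_lift A B C q : W q -> smooth_vfield V A -> smooth_vfield V B ->
  ip q (conn q (basic_lift pi A q) (basic_lift pi B)) (basic_lift pi C q) =
  ip (pi q) (conn (pi q) (A (pi q)) B) (C (pi q)).
Proof. by move=> Wq sA sB; rewrite ip_liftr // conn_lift_dmap. Qed.

Lemma conn_lift_decomp A B q : W q -> smooth_vfield V A -> smooth_vfield V B ->
  conn q (basic_lift pi A q) (basic_lift pi B) = basic_lift pi (fun y => conn y (A y) B) q +
    ver pi q (conn q (basic_lift pi A q) (basic_lift pi B)).
Proof.
move=> Wq sA sB; rewrite -{1}(ver_hor pi q (conn q _ _)) addrC; congr (_ + _).
apply: (@horizontal_inj _ _ _ _ _ pi q); [exact: hor_sub|exact: lift_horizontal|].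
by rewrite hor_dmap conn_lift_dmap // lift_dmap.
Qed.

(** Write a = V nabla_x y for the lifts x, y. Then nabla_y y is basic, nabla_x y is basic plus a,
    and [x, y] is basic plus 2a. The bracket term contributes 2|a|^2 and nabla_y nabla_x y one
    further |a|^2, whence the 3. *)
Lemma curv_lift A B q : W q -> smooth_vfield V A -> smooth_vfield V B ->
  ip q (curv (@conn R n M) (basic_lift pi A) (basic_lift pi B) (basic_lift pi B) q) (basic_lift pi A q) =
  ip (pi q) (curv (@conn R k N) A B B (pi q)) (A (pi q)) +
  3 * nsq q (ver pi q (conn q (basic_lift pi A q) (basic_lift pi B))).
Proof.
move=> Wq sA sB.
pose x := basic_lift pi A; pose y := basic_lift pi B.
have sx := Lsmooth sA; have sy := Lsmooth sB.
have hx : horizontal_on W x by move=> z _; exact: lift_horizontal.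
have hy : horizontal_on W y by move=> z _; exact: lift_horizontal.
pose a z := ver pi z (conn z (x z) y).
have sa : smooth_vfield W a by apply: vsmooth; exact: (conn_smooth oW sx sy).
have va : vertical_on W a by move=> z _; exact: ver_sub.
pose BB z := conn z (B z) B; pose AB z := conn z (A z) B.
have sBB : smooth_vfield V BB by exact: (conn_smooth oV sB sB).
have sAB : smooth_vfield V AB by exact: (conn_smooth oV sA sB).
have a_x : forall z, W z -> ip z (a z) (x z) = 0.
  by move=> z Wz; exact: (ip_vh_on va hx Wz).
have Dya : ip q (conn q (y q) a) (x q) = nsq q (a q).
  rewrite (ip_conn_skew oW Wq (y q) sa sx a_x).
  rewrite -(ip_verr _ (va q Wq)) (A_skew hpi oW frX Wq sy sx hy hx).
  by rewrite ipNr opprK.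
have Eyy z : W z -> conn z (y z) y = basic_lift pi BB z.
  move=> Wz; rewrite /y (conn_lift_decomp Wz sB sB).
  by rewrite (A_alt_lift hpi oW frX oV WV Wz sB) addr0.
have Exy z : W z -> conn z (x z) y = basic_lift pi AB z + a z.
  by move=> Wz; rewrite /x /y (conn_lift_decomp Wz sA sB).
have E2 : ip q (conn q (x q) (fun z => conn z (y z) y)) (x q) =
    ip (pi q) (conn (pi q) (A (pi q)) BB) (A (pi q)).
  rewrite (conn_ext oW (x q) (conn_smooth oW sy sy) Eyy Wq).
  exact: ip_conn_lift.
have E3 : ip q (conn q (y q) (fun z => conn z (x z) y)) (x q) =
    ip (pi q) (conn (pi q) (B (pi q)) AB) (A (pi q)) + nsq q (a q).
  rewrite (conn_ext oW (y q) (conn_smooth oW sx sy) Exy Wq).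
  rewrite (connD oW Wq _ (Lsmooth sAB) sa) ipDl Dya; congr (_ + _).
  exact: ip_conn_lift.
have E1 : ip q (conn q (lie_bracket x y q) y) (x q) =
    ip (pi q) (conn (pi q) (lie_bracket A B (pi q)) B) (A (pi q)) + 2 * nsq q (a q).
  have sAB' := smooth_lie_bracket oV sA sB.
  have -> : lie_bracket x y q = basic_lift pi (lie_bracket A B) q + 2 *: a q.
    rewrite -{1}(ver_hor pi q (lie_bracket x y q)) addrC; congr (_ + _).
      apply: (@horizontal_inj _ _ _ _ _ pi q); [exact: hor_sub|exact: lift_horizontal|].
      by rewrite hor_dmap (bracket_lift hpi oW frX oV WV Wq sA sB) lift_dmap.
    rewrite (lie_bracket_conn oW Wq sx sy) verB (A_skew hpi oW frX Wq sy sx hy hx) opprK.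
    by rewrite scaler_nat mulr2n.
  rewrite (conn_dirD oW Wq _ _ sy) (conn_dirZ oW Wq _ _ sy) ipDl ipZl.
  rewrite (ip_conn_lift _ Wq sAB' sB); congr (_ + 2 * _).
  (* The bracket of the vertical field [a] with the lift [y] is vertical, hence orthogonal to [x];
     this trades nabla_a y for nabla_y a, already computed in [Dya]. *)
  have -> : conn q (a q) y = lie_bracket a y q + conn q (y q) a.
    by rewrite (lie_bracket_conn oW Wq sa sy) subrK.
  have vb := bracket_vertical_lift hpi oW frX oV WV Wq sa va sB.
  by rewrite ipDl Dya (ip_vh vb (hx q Wq)) add0r.
rewrite /curv !ipDl !ipNl -/x -/y E1 E2 E3.
rewrite -/BB -/AB -/(a q).
ring.
Qed.

End LiftCurvature.

(** Gauss' equation of the fibres on the arguments (U, Y, Y, U). The second fundamental form is the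
    horizontal part of nabla on vertical fields, symmetric by [T_sym]. *)
Lemma gauss U Y q : W q -> smooth_vfield W U -> smooth_vfield W Y ->
  vertical_on W U -> vertical_on W Y ->
  ip q (curv (@conn R n M) U Y Y q) (U q) =
  ip q (curv_vert pi U Y Y q) (U q)
  + ip q (hor pi q (conn q (U q) U)) (hor pi q (conn q (Y q) Y))
  - nsq q (hor pi q (conn q (U q) Y)).
Proof.
move=> Wq sU sY vU vY.
(* The horizontal part of Z is orthogonal to U throughout [W], so its derivative can be moved onto
   U. *)
have split_conn (Z : vfield M) w : smooth_vfield W Z ->
    ip q (conn q w Z) (U q) = ip q (ver pi q (conn q w (fun z => ver pi z (Z z)))) (U q)
      - ip q (hor pi q (Z q)) (hor pi q (conn q w U)).
  move=> sZ; have sv := vsmooth sZ; have sh := hsmooth sZ.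
  have E z : W z -> Z z = ver pi z (Z z) + hor pi z (Z z) by rewrite ver_hor.
  rewrite (conn_ext oW w sZ E Wq) (connD oW Wq _ sv sh) ipDl ip_ver ?vU //.
  congr (_ + _).
  have H z : W z -> ip z (hor pi z (Z z)) (U z) = 0.
    by move=> Wz; apply: ip_hv; [exact: hor_sub|exact: vU].
  rewrite (ip_conn_skew oW Wq w sh sU H) ip_horr //; exact: hor_sub.
rewrite /curv_vert /curv !ipDl !ipNl -(ip_ver (conn q (lie_bracket U Y q) Y) (vU q Wq)).
rewrite (split_conn _ _ (conn_smooth oW sY sY)) (split_conn _ _ (conn_smooth oW sU sY)).
rewrite (T_sym hpi oW Wq sU sY vU vY) /vconn /nsq.
rewrite (ipC q (hor pi q (conn q (Y q) Y))).
set c1 := ip q (ver pi q (conn q (lie_bracket U Y q) Y)) _.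
set c2 := ip q (ver pi q (conn q (U q) _)) _.
set c3 := ip q (ver pi q (conn q (Y q) _)) _.
ring.
Qed.

(** Split nabla_Y U = a + b and nabla_U Y = c + d into vertical and horizontal parts. The last term,
    -2 <a, c>, arises from differentiating T_U U as a field: the tensor derivative of T would also
    subtract the derivatives of its two arguments. The derivative of A does not appear since A is
    alternating on horizontal fields. *)
Lemma mixed_curv Y U q : W q -> smooth_vfield W Y -> smooth_vfield W U ->
  horizontal_on W Y -> vertical_on W U ->
  ip q (curv (@conn R n M) Y U U q) (Y q) =
  nsq q (ver pi q (conn q (U q) Y)) - nsq q (hor pi q (conn q (Y q) U))
  - ip q (conn q (Y q) (fun z => hor pi z (conn z (U z) U))) (Y q)
  - 2 * ip q (ver pi q (conn q (Y q) U)) (ver pi q (conn q (U q) Y)).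
Proof.
move=> Wq sY sU hY vU.
pose a z := ver pi z (conn z (Y z) U); pose b z := hor pi z (conn z (Y z) U).
pose c z := ver pi z (conn z (U z) Y); pose d z := hor pi z (conn z (U z) Y).
have sYU := conn_smooth oW sY sU; have sUY := conn_smooth oW sU sY.
have sa : smooth_vfield W a by exact: vsmooth.
have sb : smooth_vfield W b by exact: hsmooth.
have sc : smooth_vfield W c by exact: vsmooth.
have sd : smooth_vfield W d by exact: hsmooth.
have va : vertical_on W a by move=> z _; exact: ver_sub.
have vc : vertical_on W c by move=> z _; exact: ver_sub.
have hb : horizontal_on W b by move=> z _; exact: hor_sub.
have hd : horizontal_on W d by move=> z _; exact: hor_sub.
have DV (Z : vfield M) w : smooth_vfield W Z -> vertical_on W Z ->
    ip q (conn q w Z) (Y q) = - ip q (Z q) (conn q w Y).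
  move=> sZ vZ; apply: (ip_conn_skew oW Wq w sZ sY (a := 0)) => z Wz.
  exact: (ip_vh_on vZ hY Wz).
have ver_c (v : 'rV[R]_n) : (v <= vertical pi q)%MS -> ip q v (conn q (U q) Y) = ip q v (c q).
  by move=> vv; rewrite -(ip_verr _ vv).
have Dvert (Z : vfield M) : smooth_vfield W Z -> vertical_on W Z ->
    ip q (conn q (Z q) U) (Y q) = - ip q (Z q) (c q).
  move=> sZ vZ; rewrite -(ip_hor _ (hY q Wq)) (T_sym hpi oW Wq sZ sU vZ vU).
  by rewrite ip_hor ?hY // DV // ver_c // vZ.
(* With Z and Y horizontal, <nabla_Z U, Y> = -<U, nabla_Z Y> = <U, nabla_Y Z> = -<nabla_Y U, Z>, the
   middle step by skewness of A. *)
have Dhor (Z : vfield M) : smooth_vfield W Z -> horizontal_on W Z ->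
    ip q (conn q (Z q) U) (Y q) = - ip q (Z q) (b q).
  move=> sZ hZ; rewrite DV // -(ip_verr _ (vU q Wq)) (A_skew hpi oW frX Wq sZ sY hZ hY).
  rewrite ipNr opprK (ip_verr _ (vU q Wq)).
  have H z : W z -> ip z (Z z) (U z) = 0 by exact: (ip_hv_on hZ vU).
  rewrite ipC (ip_conn_skew oW Wq (Y q) sZ sU H) -/(b q).
  by rewrite -(ip_horr (conn q (Y q) U) (hZ q Wq)).
have t1 : ip q (conn q (lie_bracket Y U q) U) (Y q) =
    - ip q (a q) (c q) - ip q (b q) (b q) + ip q (c q) (c q) + ip q (d q) (b q).
  have -> : lie_bracket Y U q = a q + b q - c q - d q.
    by rewrite (lie_bracket_conn oW Wq sY sU) -addrA -opprD !ver_hor.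
  rewrite !(conn_dirB oW Wq _ _ sU) (conn_dirD oW Wq _ _ sU) !ipBl ipDl.
  by rewrite (Dvert a sa va) (Dvert c sc vc) (Dhor b sb hb) (Dhor d sd hd) !opprK.
have t2 : ip q (conn q (Y q) (fun z => conn z (U z) U)) (Y q) =
    ip q (conn q (Y q) (fun z => hor pi z (conn z (U z) U))) (Y q).
  have sUU := conn_smooth oW sU sU.
  have sv := vsmooth sUU; have sh := hsmooth sUU.
  have E z : W z -> conn z (U z) U = ver pi z (conn z (U z) U) + hor pi z (conn z (U z) U).
    by rewrite ver_hor.
  rewrite (conn_ext oW _ sUU E Wq) (connD oW Wq _ sv sh) ipDl DV //; last first.
    by move=> z _; exact: ver_sub.
  by rewrite -(ip_verr _ (ver_sub _ _ _)) (A_alt hpi oW frX Wq sY hY) ip0r oppr0 add0r.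
have t3 : ip q (conn q (U q) (fun z => conn z (Y z) U)) (Y q) =
    - ip q (a q) (c q) - ip q (b q) (d q).
  have E z : W z -> conn z (Y z) U = a z + b z by rewrite ver_hor.
  rewrite (conn_ext oW _ sYU E Wq) (connD oW Wq _ sa sb) ipDl DV // ver_c ?va //.
  congr (_ + _).
  have H z : W z -> ip z (b z) (Y z) = 0.
    move=> Wz; rewrite ip_hor ?hY //.
    have H1 x : W x -> ip x (U x) (Y x) = 0 by exact: (ip_vh_on vU hY).
    rewrite (ip_conn_skew oW Wz (Y z) sU sY H1) -(ip_verr _ (vU z Wz)).
    by rewrite (A_alt hpi oW frX Wz sY hY) ip0r oppr0.
  by rewrite (ip_conn_skew oW Wq (U q) sb sY H) -(ip_horr _ (hb q Wq)).
rewrite /curv !ipDl !ipNl t1 t2 t3 /nsq -/(a q) -/(b q) -/(c q) (ipC q (d q)).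
have fin (ac bb cc bd e : R) :
  - ac - bb + cc + bd - e + (- ac - bd) = cc - bb - e - 2 * ac by ring.
exact: fin.
Qed.

End Curvature.

(** * Traces over adapted frames *)

Lemma sum_skew_sym (R : realType) (r : nat) (w s : 'I_r -> 'I_r -> R) :
  (forall i j, w i j = - w j i) -> (forall i j, s i j = s j i) ->
  \sum_i \sum_j w i j * s i j = 0.
Proof.
move=> sw ss; set S := LHS.
have : S = - S.
  rewrite {1}/S exchange_big -sumrN; apply: eq_bigr => i _.
  by rewrite -sumrN; apply: eq_bigr => j _; rewrite sw ss mulNr.
by move/eqP; rewrite -addr_eq0 -mulr2n mulrn_eq0 => /eqP.
Qed.

Section FrameTensors.
Variables (R : realType) (n k l r : nat) (M : riemannian R n) (N : riemannian R k) (pi : M -> N).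
Hypothesis hpi : riemannian_submersion pi.
Variables (W : set M) (U : 'I_r -> vfield M) (X : 'I_l -> vfield M).
Hypothesis oW : open W.
Hypothesis frU : orthonormal_frame (vertical pi) W U.
Hypothesis frX : orthonormal_frame (horizontal pi) W X.
Implicit Types (p q : M) (Y Z : vfield M).
Local Notation vertical_on := (vertical_on pi).
Local Notation horizontal_on := (horizontal_on pi).

Let sU i : smooth_vfield W (U i). Proof. by have [] := frU. Qed.
Let sX i : smooth_vfield W (X i). Proof. by have [] := frX. Qed.

Lemma frame_vertical_on i : vertical_on W (U i).
Proof.
move=> q Wq; have [_ _ /(_ q Wq) /andP[H _]] := frU.
by apply: submx_trans H; rewrite -(rowK (fun i => U i q) i) row_sub.
Qed.

Lemma frame_horizontal_on i : horizontal_on W (X i).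
Proof. by move=> q Wq; exact: (frame_horizontal frX). Qed.

Let vU := frame_vertical_on.
Let hX := frame_horizontal_on.

Lemma vertical_expand q v : W q -> (v <= vertical pi q)%MS ->
  v = \sum_i ip q v (U i q) *: U i q.
Proof.
move=> Wq vv; have [_ ON /(_ q Wq) /andP[_ H]] := frU.
exact: (orthonormal_expand (ON q Wq) (submx_trans vv H)).
Qed.

Lemma horizontal_expand q v : W q -> (v <= horizontal pi q)%MS ->
  v = \sum_i ip q v (X i q) *: X i q.
Proof.
move=> Wq vv; have [_ ON /(_ q Wq) /andP[_ H]] := frX.
exact: (orthonormal_expand (ON q Wq) (submx_trans vv H)).
Qed.

Lemma ip_vertical_frame q u v : W q -> (u <= vertical pi q)%MS ->
  ip q u v = \sum_i ip q u (U i q) * ip q (U i q) v.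
Proof.
move=> Wq uv; rewrite {1}(vertical_expand Wq uv) ip_suml.
by apply: eq_bigr => i _; rewrite ipZl.
Qed.

Lemma ip_horizontal_frame q u v : W q -> (u <= horizontal pi q)%MS ->
  ip q u v = \sum_i ip q u (X i q) * ip q (X i q) v.
Proof.
move=> Wq uv; rewrite {1}(horizontal_expand Wq uv) ip_suml.
by apply: eq_bigr => i _; rewrite ipZl.
Qed.

Section Tensors.
Variable q : M.
Hypothesis Wq : W q.

Lemma conn_hor_vertical Y v : smooth_vfield W Y -> vertical_on W Y ->
  conn q v (fun z => hor pi z (Y z)) = 0.
Proof.
move=> sY vY; rewrite -(conn0 oW Wq v).
apply: (conn_ext oW v _ _ Wq); first exact: (hsmooth oW frX sY).
by move=> z Wz; apply: hor_vertical; exact: vY.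
Qed.

Lemma conn_ver_vertical Y v : smooth_vfield W Y -> vertical_on W Y ->
  conn q v (fun z => ver pi z (Y z)) = conn q v Y.
Proof.
move=> sY vY; apply: (conn_ext oW v _ _ Wq); first exact: (vsmooth oW frX sY).
by move=> z Wz; apply: ver_id; exact: vY.
Qed.

Lemma conn_ver_horizontal Y v : smooth_vfield W Y -> horizontal_on W Y ->
  conn q v (fun z => ver pi z (Y z)) = 0.
Proof.
move=> sY hY; rewrite -(conn0 oW Wq v).
apply: (conn_ext oW v _ _ Wq); first exact: (vsmooth oW frX sY).
by move=> z Wz; apply: ver_horizontal; exact: hY.
Qed.

Lemma conn_hor_horizontal Y v : smooth_vfield W Y -> horizontal_on W Y ->
  conn q v (fun z => hor pi z (Y z)) = conn q v Y.
Proof.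
move=> sY hY; apply: (conn_ext oW v _ _ Wq); first exact: (hsmooth oW frX sY).
by move=> z Wz; apply: hor_id; exact: hY.
Qed.

Let ver0 : ver pi q 0 = 0. Proof. exact: mul0mx. Qed.
Let hor0 : hor pi q 0 = 0. Proof. exact: mul0mx. Qed.

Lemma oneill_T_vv Y Z : smooth_vfield W Z -> vertical_on W Y -> vertical_on W Z ->
  oneill_T pi Y Z q = hor pi q (conn q (Y q) Z).
Proof.
move=> sZ vY vZ; rewrite /oneill_T (ver_id (vY q Wq)).
by rewrite (conn_ver_vertical _ sZ vZ) (conn_hor_vertical _ sZ vZ) ver0 addr0.
Qed.

Lemma oneill_T_vh Y Z : smooth_vfield W Z -> vertical_on W Y -> horizontal_on W Z ->
  oneill_T pi Y Z q = ver pi q (conn q (Y q) Z).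
Proof.
move=> sZ vY hZ; rewrite /oneill_T (ver_id (vY q Wq)).
by rewrite (conn_ver_horizontal _ sZ hZ) (conn_hor_horizontal _ sZ hZ) hor0 add0r.
Qed.

Lemma oneill_A_hv Y Z : smooth_vfield W Z -> horizontal_on W Y -> vertical_on W Z ->
  oneill_A pi Y Z q = hor pi q (conn q (Y q) Z).
Proof.
move=> sZ hY vZ; rewrite /oneill_A (hor_id (hY q Wq)).
by rewrite (conn_ver_vertical _ sZ vZ) (conn_hor_vertical _ sZ vZ) ver0 addr0.
Qed.

Lemma oneill_A_hh Y Z : smooth_vfield W Z -> horizontal_on W Y -> horizontal_on W Z ->
  oneill_A pi Y Z q = ver pi q (conn q (Y q) Z).
Proof.
move=> sZ hY hZ; rewrite /oneill_A (hor_id (hY q Wq)).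
by rewrite (conn_ver_horizontal _ sZ hZ) (conn_hor_horizontal _ sZ hZ) hor0 add0r.
Qed.

(** Against a vertical U_i the derivative moves from the horizontal field onto U_i, leaving only the
    value of the field at [q]. *)
Lemma ver_conn_tensor Y Z v : smooth_vfield W Y -> smooth_vfield W Z ->
  horizontal_on W Y -> horizontal_on W Z -> Y q = Z q ->
  ver pi q (conn q v Y) = ver pi q (conn q v Z).
Proof.
move=> sY sZ hY hZ YZ; apply: subr0_eq; set w := LHS.
have wv : (w <= vertical pi q)%MS by rewrite /w -verB ver_sub.
apply: (@ip_eq0 _ _ _ q); rewrite (ip_vertical_frame _ Wq wv) big1 // => i _.
have sk D : smooth_vfield W D -> horizontal_on W D ->
    ip q (ver pi q (conn q v D)) (U i q) = - ip q (D q) (conn q v (U i)).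
  move=> sD hD; rewrite (ip_ver _ (vU i Wq)).
  exact: (ip_conn_skew oW Wq v sD (sU i) (fun x Wx => ip_hv_on hD (vU i) Wx)).
by rewrite /w ipBl (sk Y sY hY) (sk Z sZ hZ) YZ subrr mul0r.
Qed.

(** Both are sums of squares of the same numbers: <nabla_{X_i} X_j, U_m> = -<X_j, nabla_{X_i} U_m>,
    as X_j and U_m are orthogonal. *)
Lemma normAV2_AH2 : normAV2 pi X q = normAH2 pi U X q.
Proof.
rewrite /normAV2 /normAH2; apply: eq_bigr => i _.
transitivity (\sum_j \sum_m ip q (conn q (X i q) (X j)) (U m q) ^+ 2).
  apply: eq_bigr => j _; rewrite /nsq (oneill_A_hh (sX j) (hX i) (hX j)).
  rewrite (ip_vertical_frame _ Wq (ver_sub _ _ _)); apply: eq_bigr => m _.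
  by rewrite (ip_verr _ (vU m Wq)) (ip_ver _ (vU m Wq)) (ipC q (U m q)).
rewrite exchange_big; apply: eq_bigr => m _.
rewrite /nsq (oneill_A_hv (sU m) (hX i) (vU m)).
rewrite (ip_horizontal_frame _ Wq (hor_sub _ _ _)); apply: eq_bigr => j _.
rewrite (ip_horr _ (hX j Wq)) (ip_hor _ (hX j Wq)) (ipC q (X j q)).
rewrite (ip_conn_skew oW Wq (X i q) (sX j) (sU m) (fun x Wx => ip_hv_on (hX j) (vU m) Wx)).
by rewrite sqrrN (ipC q (X j q)).
Qed.

Lemma sum_gauss :
  \sum_i \sum_j ip q (curv (@conn R n M) (U j) (U i) (U i) q) (U j q) =
  scal_vert pi U q + nsq q (trT pi U q) - normTH2 pi U q.
Proof.
have TE i j : oneill_T pi (U i) (U j) q = hor pi q (conn q (U i q) (U j)).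
  by rewrite (oneill_T_vv (sU j) (vU i) (vU j)).
rewrite /scal_vert /nsq /trT /normTH2 ip_suml.
rewrite [X in _ - X]exchange_big -big_split -sumrB; apply: eq_bigr => i _ /=.
rewrite ip_sumr -big_split -sumrB; apply: eq_bigr => j _ /=.
rewrite (gauss hpi oW frX Wq (sU j) (sU i) (vU j) (vU i)) !TE.
by rewrite (ipC q (hor pi q (conn q (U j q) (U j)))).
Qed.

End Tensors.

Lemma trT_frame z : W z -> trT pi U z = \sum_j hor pi z (conn z (U j z) (U j)).
Proof.
by move=> Wz; apply: eq_bigr => j _; rewrite (oneill_T_vv Wz (sU j) (vU j) (vU j)).
Qed.

(** Summed over j, the derivatives of the fields T_{U_j} U_j become the derivative of their sum
    [trT], which is the contribution of X_i to [delta_trT]. *)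
Lemma sum_mixed q i : W q ->
  \sum_j ip q (curv (@conn R n M) (X i) (U j) (U j) q) (X i q) =
  \sum_j nsq q (oneill_T pi (U j) (X i) q) - \sum_j nsq q (oneill_A pi (X i) (U j) q)
  - ip q (conn q (X i q) (trT pi U)) (X i q).
Proof.
move=> Wq.
have sT j : smooth_vfield W (fun z => hor pi z (conn z (U j z) (U j))).
  by apply: (hsmooth oW frX); exact: (conn_smooth oW (sU j) (sU j)).
have -> : conn q (X i q) (trT pi U) =
    \sum_j conn q (X i q) (fun z => hor pi z (conn z (U j z) (U j))).
  rewrite -(conn_sum oW Wq _ _ sT); apply: esym; apply: (conn_ext oW _ _ _ Wq).
    exact: smooth_vfield_sum.
  by move=> z Wz; rewrite trT_frame.
rewrite ip_suml -!sumrB.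
rewrite (eq_bigr _ (fun j _ => mixed_curv hpi oW frX Wq (sX i) (sU j) (hX i) (vU j))).
rewrite [LHS]sumrB -[X in _ - X = _]mulr_sumr.
(* Expanded over the vertical frame, this pairs <nabla_{X_i} U_j, U_m>, skew in j and m by
   orthonormality, with <U_m, nabla_{U_j} X_i>, symmetric because it is minus the second fundamental
   form in the direction X_i. *)
have -> : \sum_j ip q (ver pi q (conn q (X i q) (U j))) (ver pi q (conn q (U j q) (X i))) = 0.
  rewrite (eq_bigr _ (fun j _ => ip_vertical_frame _ Wq (ver_sub _ _ _))).
  apply: sum_skew_sym => j m.
    rewrite !(ip_ver _ (vU _ Wq)) (ipC q (conn q (X i q) (U m))).
    have ON z : W z -> ip z (U j z) (U m z) = (j == m)%:R.
      by move=> Wz; have [_ H _] := frU; exact: H.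
    exact: (ip_conn_skew oW Wq (X i q) (sU j) (sU m) ON).
  rewrite !(ip_verr _ (vU _ Wq)).
  have sk a b : ip q (U a q) (conn q (U b q) (X i)) =
      - ip q (hor pi q (conn q (U b q) (U a))) (X i q).
    rewrite (ip_hor _ (hX i Wq)).
    rewrite (ip_conn_skew oW Wq (U b q) (sU a) (sX i) (fun x Wx => ip_vh_on (vU a) (hX i) Wx)).
    by rewrite opprK.
  by rewrite !sk (T_sym hpi oW Wq (sU j) (sU m) (vU j) (vU m)).
rewrite mulr0 subr0; apply: eq_bigr => j _.
by rewrite (oneill_T_vh Wq (sX i) (vU j) (hX i)) (oneill_A_hv Wq (sU j) (hX i) (vU j)).
Qed.

End FrameTensors.

(** * Curvature of the space form on adapted frames *)

Definition space_form_curv (R : realType) (n : nat) (M : riemannian R n) (c : R)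
    (J : 'I_3 -> M -> 'End('rV[R]_n)) (q : M) (x y z : 'rV[R]_n) : 'rV[R]_n :=
  (c / 4) *: (ip q y z *: x - ip q x z *: y
    + \sum_(a < 3) (ip q (J a q y) z *: J a q x - ip q (J a q x) z *: J a q y
                    + (2 * ip q (J a q y) x) *: J a q z)).

Section SpaceForm.
Variables (R : realType) (n k l r : nat) (M : riemannian R n) (N : riemannian R k) (pi : M -> N).
Hypothesis hpi : riemannian_submersion pi.
Variables (W : set M) (U : 'I_r -> vfield M) (X : 'I_l -> vfield M).
Hypothesis oW : open W.
Hypothesis frU : orthonormal_frame (vertical pi) W U.
Hypothesis frX : orthonormal_frame (horizontal pi) W X.
Variables (c : R) (J : 'I_3 -> M -> 'End('rV[R]_n)).
Hypothesis curvK : forall W', open W' -> W' `<=` W -> forall Y1 Y2 Y3 : vfield M,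
  smooth_vfield W' Y1 -> smooth_vfield W' Y2 -> smooth_vfield W' Y3 ->
  forall q, W' q -> curv (@conn R n M) Y1 Y2 Y3 q = space_form_curv c J q (Y1 q) (Y2 q) (Y3 q).
Variable q : M.
Hypothesis Wq : W q.

Let sU i : smooth_vfield W (U i). Proof. by have [] := frU. Qed.
Let sX i : smooth_vfield W (X i). Proof. by have [] := frX. Qed.

(** The frame fields are not basic, so they are replaced by basic lifts with the same values at [q].
    By [curvK] the curvature sees these values only, and by [ver_conn_tensor] so does A. The lifts
    are smooth over one chart of the base, hence the form of [curvK] on smaller open sets. *)
Lemma curv_hor_frame i j :
  ip q (curv_hor pi q (X i q) (X j q) (X j q)) (X i q) =
  ip q (curv (@conn R n M) (X i) (X j) (X j) q) (X i q) - 3 * nsq q (oneill_A pi (X i) (X j) q).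
Proof.
have hX := frame_horizontal_on frX.
pose y := pi q; have dy := chart_dom_self y; have oV := @chart_dom_open _ _ N y.
pose L a := const_ext y (X a q *m dmap pi q).
have sL a : smooth_vfield (chart_dom y) (L a) by exact: smooth_const_ext.
have Ly a : L a y = X a q *m dmap pi q by exact: const_ext_self.
pose W1 := W `&` pi @^-1` chart_dom y.
have oW1 : open W1 by apply: openI => //; exact: (open_preimage (rs_smooth hpi)).
have W1W : W1 `<=` W by exact: subIsetl.
have W1q : W1 q by [].
have frX1 := orthonormal_frame_sub W1W frX; have frU1 := orthonormal_frame_sub W1W frU.
have W1V z : W1 z -> chart_dom y (pi z) by case.
have Lq a : basic_lift pi (L a) q = X a q by rewrite /basic_lift Ly (hlift_id hpi (hX a q Wq)).
have sL1 a := lift_smooth hpi oW1 frX1 oV W1V (sL a).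
have sX1 a := smooth_vfield_sub W1W (sX a).
have hX1 a : horizontal_on pi W1 (X a) by move=> z /W1W; exact: hX.
have hL1 a : horizontal_on pi W1 (basic_lift pi (L a)) by move=> z _; exact: lift_horizontal.
rewrite /curv_hor (ip_hlift hpi _ (hX i q Wq)) /curv_at -/y.
have := curv_lift hpi oW1 frX1 oV W1V W1q (sL i) (sL j).
rewrite (curvK oW1 W1W (sL1 i) (sL1 j) (sL1 j) W1q) !Lq.
rewrite -(curvK oW (@subset_refl _ _) (sX i) (sX j) (sX j) Wq) -/y Ly => ->.
rewrite (oneill_A_hh oW frX Wq (sX j) (hX i) (hX j)).
rewrite (ver_conn_tensor oW1 frU1 W1q (X i q) (sX1 j) (sL1 j) (hX1 j) (hL1 j)) ?Lq //.
by rewrite addrK.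
Qed.

Lemma scal_hor_frame :
  scal_hor pi X q =
  \sum_i \sum_j ip q (curv (@conn R n M) (X i) (X j) (X j) q) (X i q) - 3 * normAV2 pi X q.
Proof.
rewrite /scal_hor /normAV2 mulr_sumr -sumrB; apply: eq_bigr => i _.
by rewrite mulr_sumr -sumrB; apply: eq_bigr => j _; exact: curv_hor_frame.
Qed.

Lemma scal_sum :
  scal_vert pi U q + scal_hor pi X q =
  \sum_i \sum_j ip q (curv (@conn R n M) (U j) (U i) (U i) q) (U j q)
  + \sum_i \sum_j ip q (curv (@conn R n M) (X i) (X j) (X j) q) (X i q)
  + 2 * \sum_i \sum_j ip q (curv (@conn R n M) (X i) (U j) (U j) q) (X i q)
  - nsq q (trT pi U q) + normTH2 pi U q + 2 * delta_trT pi U X q - 2 * normTV2 pi U X q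
  - normAV2 pi X q.
Proof.
rewrite scal_hor_frame (sum_gauss hpi oW frU frX Wq).
rewrite (eq_bigr _ (fun i _ => sum_mixed hpi oW frU frX i Wq)) !sumrB.
rewrite -/(normTV2 pi U X q) -/(normAH2 pi U X q) -(normAV2_AH2 oW frU frX Wq).
rewrite -/(delta_trT pi U X q).
set e1 := \sum_i \sum_j _.
have fin (a b d e f g h : R) :
  a + (b - 3 * d) = a + e - f + b + 2 * (g - d - h) - e + f + 2 * h - 2 * g - d by ring.
exact: fin.
Qed.

End SpaceForm.

Section QuaternionicAlgebra.
Variables (R : realType) (n k l r : nat) (M : riemannian R n) (N : riemannian R k) (pi : M -> N).
Variables (E : M -> {vspace 'End('rV[R]_n)}) (W : set M) (J : 'I_3 -> M -> 'End('rV[R]_n)).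
Variable c : R.
Hypothesis cbJ : canonical_basis E W J.
Variable q : M.
Hypothesis Wq : W q.
Implicit Types (x y : 'rV[R]_n).

Lemma J_skew a x y : ip q (J a q x) y = - ip q x (J a q y).
Proof.
by rewrite -[LHS](cb_hermitian cbJ Wq a) (cb_sqr cbJ Wq) ipNl.
Qed.

Lemma J_alt a x : ip q (J a q x) x = 0.
Proof.
have /eqP := J_skew a x x.
by rewrite (ipC q x) -addr_eq0 -mulr2n mulrn_eq0 => /eqP.
Qed.

(** J_a is skew, so the products <J_a y, y> vanish; of the other two J-terms one gives <J_a x, y>^2
    and the other twice that, whence the 3. *)
Lemma ip_space_form_curv x y :
  ip q (space_form_curv c J q x y y) x =
  c / 4 * (ip q x x * ip q y y - ip q x y ^+ 2 + 3 * \sum_(a < 3) ip q (J a q x) y ^+ 2).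
Proof.
rewrite /space_form_curv ipZl ipDl ipBl !ipZl ip_suml mulr_sumr.
rewrite (mulrC (ip q y y)) (ipC q y x) -expr2; congr (_ * (_ + _)).
apply: eq_bigr => a _; rewrite ipDl ipBl !ipZl !J_alt mul0r sub0r.
rewrite (J_skew a y x) (ipC q y); ring.
Qed.

Variables (U : 'I_r -> vfield M) (X : 'I_l -> vfield M).
Hypothesis frU : orthonormal_frame (vertical pi) W U.
Hypothesis frX : orthonormal_frame (horizontal pi) W X.
Hypothesis antiJ : forall a v, (v <= vertical pi q)%MS -> (J a q v <= horizontal pi q)%MS.

Lemma normB2E a x : normB2 pi U (J a) x q = \sum_j ip q (J a q x) (U j q) ^+ 2.
Proof. by apply: eq_bigr => j _; rewrite (ip_ver _ (frame_vertical_on frU j Wq)). Qed.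

Lemma normC2E a x : normC2 pi X (J a) x q = \sum_j ip q (J a q x) (X j q) ^+ 2.
Proof. by apply: eq_bigr => j _; rewrite (ip_hor _ (frame_horizontal_on frX j Wq)). Qed.

Let frame_sum s (F : 'I_s -> vfield M) :
  (forall i j, ip q (F i q) (F j q) = (i == j)%:R) ->
  \sum_i \sum_j (ip q (F i q) (F i q) * ip q (F j q) (F j q) - ip q (F i q) (F j q) ^+ 2)
  = s%:R * (s%:R - 1).
Proof.
move=> ON.
transitivity (\sum_(i < s) (s%:R - 1 : R)); last by rewrite sumr_const card_ord mulr_natl.
apply: eq_bigr => i _; rewrite sumrB; congr (_ - _).
  transitivity (\sum_(j < s) (1 : R)); last by rewrite sumr_const card_ord.
  by apply: eq_bigr => j _; rewrite !ON !eqxx mulr1.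
rewrite (bigD1 i) //= ON eqxx expr1n big1 ?addr0 // => j ji.
by rewrite ON eq_sym (negPf ji) expr0n.
Qed.

(** Vertical pairs contribute no J-terms because J_a maps vertical to horizontal vectors. Horizontal
    pairs give 3 |C|^2, and mixed pairs 3 |B|^2 counted twice, hence the 6. The remaining terms add
    up as r(r-1) + l(l-1) + 2lr = (l+r)(l+r-1). *)
Lemma sum_space_form_curv :
  \sum_i \sum_j ip q (space_form_curv c J q (U j q) (U i q) (U i q)) (U j q)
  + \sum_i \sum_j ip q (space_form_curv c J q (X i q) (X j q) (X j q)) (X i q)
  + 2 * \sum_i \sum_j ip q (space_form_curv c J q (X i q) (U j q) (U j q)) (X i q)
  = c / 4 * ((l%:R + r%:R) * (l%:R + r%:R - 1)
    + \sum_(a < 3) \sum_(i < l) (6 * normB2 pi U (J a) (X i q) q + 3 * normC2 pi X (J a) (X i q) q)).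
Proof.
have [_ /(_ q Wq) ONU _] := frU; have [_ /(_ q Wq) ONX _] := frX.
have vU := frame_vertical_on frU; have hX := frame_horizontal_on frX.
have EU : \sum_i \sum_j ip q (space_form_curv c J q (U j q) (U i q) (U i q)) (U j q) =
    c / 4 * (r%:R * (r%:R - 1)).
  rewrite -(frame_sum ONU) exchange_big mulr_sumr; apply: eq_bigr => j _.
  rewrite mulr_sumr; apply: eq_bigr => i _; rewrite ip_space_form_curv.
  rewrite [X in 3 * X]big1 ?mulr0 ?addr0 // => a _.
  by rewrite (ip_hv (antiJ a (vU j q Wq)) (vU i q Wq)) expr0n.
have EX : \sum_i \sum_j ip q (space_form_curv c J q (X i q) (X j q) (X j q)) (X i q) =
    c / 4 * (l%:R * (l%:R - 1) + 3 * \sum_(a < 3) \sum_(i < l) normC2 pi X (J a) (X i q) q).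
  rewrite -(frame_sum ONX) exchange_big [X in 3 * X]exchange_big /= mulr_sumr.
  rewrite exchange_big -big_split mulr_sumr; apply: eq_bigr => i _ /=.
  under [X in 3 * X]eq_bigr do rewrite normC2E.
  rewrite [X in 3 * X]exchange_big mulr_sumr -big_split mulr_sumr; apply: eq_bigr => j _ /=.
  by rewrite ip_space_form_curv.
have EXU : \sum_i \sum_j ip q (space_form_curv c J q (X i q) (U j q) (U j q)) (X i q) =
    c / 4 * (l%:R * r%:R + 3 * \sum_(a < 3) \sum_(i < l) normB2 pi U (J a) (X i q) q).
  rewrite [X in 3 * X]exchange_big mulr_sumr.
  rewrite (_ : l%:R * r%:R = \sum_(i < l) (r%:R : R)); last by rewrite sumr_const card_ord mulr_natl.
  rewrite -big_split mulr_sumr; apply: eq_bigr => i _ /=.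
  under [X in 3 * X]eq_bigr do rewrite normB2E.
  rewrite [X in 3 * X]exchange_big mulr_sumr.
  rewrite (_ : r%:R = \sum_(j < r) (1 : R)); last by rewrite sumr_const card_ord.
  rewrite -big_split mulr_sumr; apply: eq_bigr => j _ /=.
  rewrite ip_space_form_curv ONX ONU !eqxx (ip_hv (hX i q Wq) (vU j q Wq)).
  by rewrite expr0n subr0 mulr1.
rewrite EU EX EXU.
under [X in _ = c / 4 * (_ + X)]eq_bigr do rewrite big_split -!mulr_sumr.
rewrite [X in _ = c / 4 * (_ + X)]big_split -!mulr_sumr /=.
set b := \sum_(a < 3) _; set d := \sum_(a < 3) _; ring.
Qed.

End QuaternionicAlgebra.

Section ScalarIdentity.
Variables (R : realType) (n k l r : nat) (M : riemannian R n) (N : riemannian R k) (pi : M -> N).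
Variables (E : M -> {vspace 'End('rV[R]_n)}) (c : R).
Hypothesis hM : quaternionic_space_form E c.
Hypothesis hpi : riemannian_submersion pi.
Hypothesis hanti : anti_invariant E pi.

Lemma canonical_basis_sub W W' J : open W' -> W' `<=` W -> canonical_basis E W J ->
  canonical_basis E W' J.
Proof.
move=> oW' W'W [oW sJ bJ qJ mJ aJ hJ]; split; first exact: oW'.
- by move=> a W2 Y oW2 W2W'; exact: (sJ a W2 Y oW2 (subset_trans W2W' W'W)).
- by move=> q /W'W; exact: bJ.
- by move=> q /W'W; exact: qJ.
- by move=> q /W'W; exact: mJ.
- by move=> q /W'W; exact: aJ.
- by move=> q /W'W; exact: hJ.
Qed.

Lemma nsq_mean_curvature (U : 'I_r -> vfield M) q :
  r%:R ^+ 2 * nsq q (mean_curvature pi U q) = nsq q (trT pi U q).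
Proof.
rewrite /mean_curvature /nsq ipZl ipZr.
(* For [r = 0] the factor cannot be cancelled, but the sum defining [trT] is then empty. *)
have [r0|r0] := eqVneq r 0%N.
  have -> : trT pi U q = 0.
    rewrite /trT big1 // => i _; have : (i < 0)%N by rewrite -[X in (_ < X)%N]r0 ltn_ord.
    by [].
  by rewrite ip0l !mulr0.
have : (r%:R : R) != 0 by rewrite pnatr_eq0.
by set z := ip q _ _ => rN; field.
Qed.

Lemma scal_identity W (U : 'I_r -> vfield M) (X : 'I_l -> vfield M) J q :
  adapted_frames E pi W U X J -> W q ->
  scal_vert pi U q + scal_hor pi X q = common_rhs pi c J U X q - normAV2 pi X q.
Proof.
move=> [oW frU frX cbJ] Wq.
have curvK (W' : set M) : open W' -> W' `<=` W -> forall Y1 Y2 Y3 : vfield M,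
    smooth_vfield W' Y1 -> smooth_vfield W' Y2 -> smooth_vfield W' Y3 ->
    forall p, W' p -> curv (@conn R n M) Y1 Y2 Y3 p = space_form_curv c J p (Y1 p) (Y2 p) (Y3 p).
  move=> oW' W'W Y1 Y2 Y3 s1 s2 s3 p W'p.
  exact: (proj2 hM W' J (canonical_basis_sub oW' W'W cbJ) Y1 Y2 Y3 s1 s2 s3 p W'p).
have curvF := curvK W oW (@subset_refl _ _).
have sU i : smooth_vfield W (U i) by have [] := frU.
have sX i : smooth_vfield W (X i) by have [] := frX.
have antiJ a v : (v <= vertical pi q)%MS -> (J a q v <= horizontal pi q)%MS.
  exact: (hanti cbJ a Wq).
rewrite (scal_sum hpi oW frU frX curvK Wq).
have E3 : \sum_i \sum_j ip q (curv (@conn R n M) (X i) (U j) (U j) q) (X i q) =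
    \sum_i \sum_j ip q (space_form_curv c J q (X i q) (U j q) (U j q)) (X i q).
  apply: eq_bigr => i _; apply: eq_bigr => j _.
  by rewrite (curvF _ _ _ (sX i) (sU j) (sU j) q Wq).
have E2 : \sum_i \sum_j ip q (curv (@conn R n M) (X i) (X j) (X j) q) (X i q) =
    \sum_i \sum_j ip q (space_form_curv c J q (X i q) (X j q) (X j q)) (X i q).
  apply: eq_bigr => i _; apply: eq_bigr => j _.
  by rewrite (curvF _ _ _ (sX i) (sX j) (sX j) q Wq).
have E1 : \sum_i \sum_j ip q (curv (@conn R n M) (U j) (U i) (U i) q) (U j q) =
    \sum_i \sum_j ip q (space_form_curv c J q (U j q) (U i q) (U i q)) (U j q).
  apply: eq_bigr => i _; apply: eq_bigr => j _.
  by rewrite (curvF _ _ _ (sU j) (sU i) (sU i) q Wq).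
rewrite E1 E2 E3 (sum_space_form_curv c cbJ Wq frU frX antiJ).
by rewrite /common_rhs nsq_mean_curvature.
Qed.

End ScalarIdentity.

(** * Existence of adapted frames, integrability *)

Section Frames.
Variables (R : realType) (n k r : nat) (M : riemannian R n) (N : riemannian R k) (pi : M -> N).
Hypothesis hpi : riemannian_submersion pi.
Implicit Types (W : set M) (p q : M).
Local Notation der q v f := (dfun q v ((f : _ -> R) : _ -> R^o)).
Let spi := rs_smooth hpi.

Lemma rank_vertical q : \rank (vertical pi q) = (n - k)%N.
Proof. by rewrite mxrank_ker (rs_rank hpi). Qed.

Lemma rank_horizontal_base q : \rank (horizontal pi q) = k.
Proof. by rewrite rank_horizontal rank_vertical subKn // ltnW // (rs_dim hpi). Qed.

Lemma tangent_frame W p : open W -> W p ->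
  exists W' (e : 'I_n -> vfield M), [/\ open W', W' p, W' `<=` W &
    orthonormal_frame (fun=> 1%:M) W' e].
Proof.
move=> oW Wp; have oD := @chart_dom_open _ _ M p.
have oW1 : open (W `&` chart_dom p) by exact: openI.
have W1p : (W `&` chart_dom p) p by split=> //; exact: chart_dom_self.
have [|q|q W1q i||W' [e [oW' W'p W'W fr]]] := @gram_schmidt_frame _ _ M (W `&` chart_dom p) p n
  (fun=> 1%:M) (fun i => const_ext p (delta_mx 0 i)) oW1 W1p.
- move=> i; exact: (smooth_vfield_sub (@subIsetr _ _ _) (@smooth_const_ext _ _ _ p _)).
- exact: mxrank1.
- exact: submx1.
- rewrite (_ : \matrix_i _ = 1%:M) ?row_free_unit ?unitmx1 //.
  by apply/matrixP => i j; rewrite !mxE const_ext_self !mxE eqxx eq_sym.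
by exists W', e; split=> // q /W'W [].
Qed.

(* The gradients of the coordinate functions of the base span the horizontal space. *)
Lemma horizontal_frame W p : open W -> W p ->
  exists W' (X : 'I_k -> vfield M), [/\ open W', W' p, W' `<=` W &
    orthonormal_frame (horizontal pi) W' X].
Proof.
move=> oW Wp; have [W1 [e [oW1 W1p W1W fre]]] := tangent_frame oW Wp.
pose y := pi p; have oD := @chart_dom_open _ _ N y; have dy := chart_dom_self y.
pose W2 := W1 `&` pi @^-1` chart_dom y.
have oW2 : open W2 by apply: openI => //; exact: (open_preimage spi).
have W2p : W2 p by [].
have W21 : W2 `<=` W1 by exact: subIsetl.
pose f a q : R := chart y (pi q) 0 a.
have sf a : smooth_fun W2 (f a).
  by apply: smooth_fun_sub (smooth_fun_map_coord spi y a); exact: subIsetr.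
have [se ONe spe] := orthonormal_frame_sub W21 fre.
pose grad a : vfield M := fun q => \sum_i der q (e i q) (f a) *: e i q.
have sg a : smooth_vfield W2 (grad a).
  apply: smooth_vfield_sum => i; apply: smooth_vfieldZ (se i).
  exact: (se i W2 _ oW2 (@subset_refl _ _) (sf a)).
have df a q : W2 q -> mdifferentiable (f a : M -> R^o) q.
  by move=> W2q; exact: smooth_mdifferentiable oW2 W2q (sf a).
have gradP a q w : W2 q -> ip q (grad a q) w = der q w (f a).
  move=> W2q; have /andP[_ sp] := spe q W2q.
  have wE := orthonormal_expand (ONe q W2q) (submx_trans (submx1 w) sp).
  rewrite {2}wE (dfun_sumv _ _ (df a q W2q)) ip_suml; apply: eq_bigr => i _.
  by rewrite ipZl (dfunZv _ _ (df a q W2q)) mulrC (ipC q w).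
have derP a q w : W2 q -> der q w (f a) = der (pi q) (w *m dmap pi q) (fun z => chart y z 0 a).
  move=> [_ yq]; apply: (dfun_comp spi (f := (fun z => chart y z 0 a) : N -> R^o)).
  exact: smooth_mdifferentiable oD yq (smooth_fun_coord y a).
have hg q a : W2 q -> (grad a q <= horizontal pi q)%MS.
  move=> W2q; apply/horizontalP => u /verticalP uv.
  by rewrite gradP // derP // uv dfun0v.
have fg : row_free (\matrix_(a < k) grad a p).
  rewrite /row_free eqn_leq rank_leq_row /= -{1}(rs_rank hpi p) -mxrank_tr.
  (* The gradients times the metric give the transposed Jacobian, whose rank is [k]; so the
     gradients are independent at [p]. *)
  suff <- : (\matrix_(a < k) grad a p) *m metric p = (dmap pi p)^T by exact: mxrankM_maxl.
  apply/matrixP => a j; rewrite [RHS]mxE.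
  have := gradP a p (delta_mx 0 j) W2p; rewrite derP // ipE.
  rewrite -(dfun_row _ _ (mdifferentiable_chart_fun dy)) dfun_self.
  rewrite -rowE [RHS]mxE => <-; by rewrite -[in RHS](rowK (fun a => grad a p) a) -row_mul trmx_delta -colE [RHS]mxE [RHS]mxE.
have hgq q : W2 q -> forall a, (grad a q <= horizontal pi q)%MS by move=> W2q a; exact: hg.
have [W3 [X [oW3 W3p W32 frX]]] := gram_schmidt_frame oW2 W2p sg rank_horizontal_base hgq fg.
by exists W3, X; split=> // q /W32 /W21 /W1W.
Qed.

Hypothesis hr : forall q, \rank (vertical pi q) = r.

(** For the vertical part, a basis of the vertical space at [p] is extended with constant components
    in the chart and projected to the vertical spaces; the projection is smooth thanks to the
    horizontal frame already found. *)
Lemma adapted_frame W p : open W -> W p ->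
  exists W' (U : 'I_r -> vfield M) (X : 'I_k -> vfield M), [/\ open W', W' p, W' `<=` W,
    orthonormal_frame (vertical pi) W' U & orthonormal_frame (horizontal pi) W' X].
Proof.
move=> oW Wp; have [W1 [X [oW1 W1p W1W frX]]] := horizontal_frame oW Wp.
have oD := @chart_dom_open _ _ M p.
pose W2 := W1 `&` chart_dom p; have oW2 : open W2 by exact: openI.
have W2p : W2 p by split=> //; exact: chart_dom_self.
have W21 : W2 `<=` W1 by exact: subIsetl.
have [B fB BV] : exists2 B : 'M[R]_(r, n), row_free B & (B <= vertical pi p)%MS.
  rewrite -(hr p); exists (row_base (vertical pi p)); first exact: row_base_free.
  by rewrite eq_row_base.
pose F i : vfield M := fun q => ver pi q (const_ext p (row i B) q).
have sF i : smooth_vfield W2 (F i).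
  apply: (smooth_ver frX oW2 W21).
  exact: (smooth_vfield_sub (@subIsetr _ _ _) (@smooth_const_ext _ _ _ p _)).
have fF : row_free (\matrix_i F i p).
  rewrite (_ : \matrix_i F i p = B) //; apply/row_matrixP => i; rewrite rowK.
  by rewrite /F const_ext_self ver_id // (submx_trans (row_sub _ _) BV).
have vF q : W2 q -> forall i, (F i q <= vertical pi q)%MS by move=> _ i; exact: ver_sub.
have [W3 [U [oW3 W3p W32 frU]]] := gram_schmidt_frame oW2 W2p sF hr vF fF.
exists W3, U, X; split=> //; first by move=> q /W32 /W21 /W1W.
exact: (orthonormal_frame_sub (subset_trans W32 W21) frX).
Qed.

End Frames.

(** * Integrability and the vanishing of A *)

Section Integrability.
Variables (R : realType) (n k l r : nat) (M : riemannian R n) (N : riemannian R k) (pi : M -> N).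
Hypothesis hpi : riemannian_submersion pi.
Variables (W : set M) (U : 'I_r -> vfield M) (X : 'I_l -> vfield M).
Hypothesis oW : open W.
Hypothesis frU : orthonormal_frame (vertical pi) W U.
Hypothesis frX : orthonormal_frame (horizontal pi) W X.

Let sU i : smooth_vfield W (U i). Proof. by have [] := frU. Qed.
Let sX i : smooth_vfield W (X i). Proof. by have [] := frX. Qed.

Lemma normAV2_ge0 q : 0 <= normAV2 pi X q.
Proof. by apply: sumr_ge0 => i _; apply: sumr_ge0 => j _; exact: ip_ge0. Qed.

(** By skewness of A the vertical part of [X_i, X_j] is 2 A_{X_i} X_j. *)
Lemma integrable_normAV2 q : horizontal_integrable pi -> W q -> normAV2 pi X q = 0.
Proof.
move=> integr Wq; have hX := frame_horizontal_on frX.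
rewrite /normAV2 big1 // => i _; rewrite big1 // => j _.
rewrite (oneill_A_hh oW frX Wq (sX j) (hX i) (hX j)).
have := ver_horizontal (integr W (X i) (X j) oW (sX i) (sX j) (hX i) (hX j) q Wq).
rewrite (lie_bracket_conn oW Wq (sX i) (sX j)) verB.
rewrite (A_skew hpi oW frX Wq (sX j) (sX i) (hX j) (hX i)) opprK => /eqP.
by rewrite -mulr2n -scaler_nat scaler_eq0 pnatr_eq0 /= => /eqP ->; rewrite /nsq ip0l.
Qed.

(** The vertical part is tensorial in the horizontal field: paired with U_m it equals -<Y, nabla_v
    U_m>, which expands over the values X_i. *)
Lemma ver_conn_frame0 q (Y : vfield M) v : W q -> smooth_vfield W Y -> horizontal_on pi W Y ->
  (forall i, ver pi q (conn q v (X i)) = 0) -> ver pi q (conn q v Y) = 0.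
Proof.
move=> Wq sY hY H0; have hX := frame_horizontal_on frX; have vU := frame_vertical_on frU.
apply: (@ip_eq0 _ _ _ q); rewrite (ip_vertical_frame frU _ Wq (ver_sub _ _ _)) big1 // => m _.
have sk (D : vfield M) : smooth_vfield W D -> horizontal_on pi W D ->
    ip q (ver pi q (conn q v D)) (U m q) = - ip q (D q) (conn q v (U m)).
  move=> sD hD; rewrite (ip_ver _ (vU m q Wq)).
  exact: (ip_conn_skew oW Wq v sD (sU m) (fun x Wx => ip_hv_on hD (vU m) Wx)).
rewrite (sk Y sY hY) (ip_horizontal_frame frX _ Wq (hY q Wq)) big1 ?oppr0 ?mul0r // => i _.
have /eqP := sk (X i) (sX i) (hX i); rewrite H0 ip0l eq_sym oppr_eq0 => /eqP ->.
by rewrite mulr0.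
Qed.

(** A vanishes on pairs of frame fields. Tensoriality extends this to every horizontal field in the
    second slot, skewness exchanges the slots, and tensoriality again covers arbitrary pairs; the
    bracket then has no vertical part. *)
Lemma normAV2_bracket q (Y Z : vfield M) : W q -> normAV2 pi X q = 0 ->
  smooth_vfield W Y -> smooth_vfield W Z -> horizontal_on pi W Y -> horizontal_on pi W Z ->
  (lie_bracket Y Z q <= horizontal pi q)%MS.
Proof.
move=> Wq A0 sY sZ hY hZ; have hX := frame_horizontal_on frX.
have AX i j : ver pi q (conn q (X i q) (X j)) = 0.
  rewrite -(oneill_A_hh oW frX Wq (sX j) (hX i) (hX j)); apply: (@ip_eq0 _ _ _ q).
  have p0 a b : 0 <= nsq q (oneill_A pi (X a) (X b) q) by exact: ip_ge0.
  have H : \sum_b nsq q (oneill_A pi (X i) (X b) q) = 0.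
    by apply: (psumr_eq0P _ A0 (i := i)) => // a _; apply: sumr_ge0 => b _; exact: p0.
  by apply: (psumr_eq0P _ H (i := j)) => // b _; exact: p0.
have AXh i (D : vfield M) : smooth_vfield W D -> horizontal_on pi W D ->
    ver pi q (conn q (D q) (X i)) = 0.
  move=> sD hD; rewrite (A_skew hpi oW frX Wq sD (sX i) hD (hX i)).
  by rewrite (ver_conn_frame0 Wq sD hD (AX i)) oppr0.
have Ah (D1 D2 : vfield M) : smooth_vfield W D1 -> horizontal_on pi W D1 ->
    smooth_vfield W D2 -> horizontal_on pi W D2 -> ver pi q (conn q (D1 q) D2) = 0.
  move=> s1 h1 s2 h2; apply: (ver_conn_frame0 Wq s2 h2) => i; exact: AXh.
rewrite (lie_bracket_conn oW Wq sY sZ) -(ver_hor pi q (_ - _)) verB.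
by rewrite (Ah Y Z) // (Ah Z Y) // subrr add0r hor_sub.
Qed.

End Integrability.

Theorem theorem3p8 (R : realType) (m k r l : nat)
    (M : riemannian R (4 * m)) (E : M -> {vspace 'End('rV[R]_(4 * m))})
    (c : R) (N : riemannian R k) (pi : M -> N)
    (hM : quaternionic_space_form E c)
    (hpi : riemannian_submersion pi)
    (hanti : anti_invariant E pi)
    (hr : forall p : M, \rank (vertical pi p) = r)
    (hl : forall p : M, \rank (horizontal pi p) = l) :
  [/\ forall (W : set M) (U : 'I_r -> vfield M) (X : 'I_l -> vfield M)
          (J : 'I_3 -> M -> 'End('rV[R]_(4 * m))),
        adapted_frames E pi W U X J ->
        forall p, W p ->
        scal_vert pi U p + scal_hor pi X p <= upper_rhs pi c J U X p,
      forall (W : set M) (U : 'I_r -> vfield M) (X : 'I_l -> vfield M)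
          (J : 'I_3 -> M -> 'End('rV[R]_(4 * m))),
        adapted_frames E pi W U X J ->
        forall p, W p ->
        scal_vert pi U p + scal_hor pi X p >= lower_rhs pi c J U X p,
      (forall (W : set M) (U : 'I_r -> vfield M) (X : 'I_l -> vfield M)
          (J : 'I_3 -> M -> 'End('rV[R]_(4 * m))),
        adapted_frames E pi W U X J ->
        forall p, W p ->
        scal_vert pi U p + scal_hor pi X p = upper_rhs pi c J U X p)
      <-> horizontal_integrable pi &
      (forall (W : set M) (U : 'I_r -> vfield M) (X : 'I_l -> vfield M)
          (J : 'I_3 -> M -> 'End('rV[R]_(4 * m))),
        adapted_frames E pi W U X J ->
        forall p, W p ->
        scal_vert pi U p + scal_hor pi X p = lower_rhs pi c J U X p)
      <-> horizontal_integrable pi].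
Proof.
have lk (p : M) : l = k by rewrite -(hl p) (rank_horizontal_base hpi).
have A_ge0 (X : 'I_l -> vfield M) p : 0 <= normAV2 pi X p by exact: normAV2_ge0.
have upperE W (U : 'I_r -> vfield M) (X : 'I_l -> vfield M) J p : adapted_frames E pi W U X J -> W p ->
    scal_vert pi U p + scal_hor pi X p = upper_rhs pi c J U X p - 3 * normAV2 pi X p.
  move=> fr Wp; rewrite (scal_identity hM hpi hanti fr Wp) /upper_rhs.
  have [oW frU frX _] := fr; rewrite -(normAV2_AH2 oW frU frX Wp).
  set a := common_rhs _ _ _ _ _ _; ring.
have lowerE W (U : 'I_r -> vfield M) (X : 'I_l -> vfield M) J p : adapted_frames E pi W U X J -> W p ->
    scal_vert pi U p + scal_hor pi X p = lower_rhs pi c J U X p + 2 * normAV2 pi X p.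
  move=> fr Wp; rewrite (scal_identity hM hpi hanti fr Wp) /lower_rhs.
  set a := common_rhs _ _ _ _ _ _; ring.
have A0 W (U : 'I_r -> vfield M) (X : 'I_l -> vfield M) J p : horizontal_integrable pi ->
    adapted_frames E pi W U X J -> W p -> normAV2 pi X p = 0.
  by move=> integr [oW _ frX _] Wp; exact: (integrable_normAV2 hpi oW frX integr Wp).
(* Integrability is tested on arbitrary fields and open sets, while vanishing of A is known only
   along adapted frames; these are constructed on a smaller neighbourhood of each point. *)
have integr : (forall W (U : 'I_r -> vfield M) (X : 'I_l -> vfield M) J,
    adapted_frames E pi W U X J -> forall p, W p -> normAV2 pi X p = 0) ->
    horizontal_integrable pi.
  move=> H W Y Z oW sY sZ hY hZ q Wq.
  have [W0 [J [W0q cbJ]]] := proj1 (proj1 hM) q.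
  have oW1 : open (W `&` W0) by apply: openI => //; exact: cb_open cbJ.
  have [W2 [U [X [oW2 W2q W21 frU frX]]]] := adapted_frame hpi hr oW1 (conj Wq W0q).
  have W2W : W2 `<=` W by move=> x /W21 [].
  have W20 : W2 `<=` W0 by move=> x /W21 [].
  have cbJ2 := canonical_basis_sub oW2 W20 cbJ.
  (* The constructed horizontal frame has [k] members. Identifying [l] with [k] takes a point of
     [M], which is available here. *)
  have El := lk q; subst l.
  have A20 : normAV2 pi X q = 0 by apply: (H W2 U X J _ q W2q); split.
  apply: (normAV2_bracket hpi oW2 frU frX W2q A20).
  - exact: (smooth_vfield_sub W2W sY).
  - exact: (smooth_vfield_sub W2W sZ).
  - by move=> x /W2W; exact: hY.
  - by move=> x /W2W; exact: hZ.
split.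
- move=> W U X J fr p Wp; rewrite (upperE _ _ _ _ _ fr Wp) gerBl.
  by rewrite mulr_ge0.
- move=> W U X J fr p Wp; rewrite (lowerE _ _ _ _ _ fr Wp) lerDl.
  by rewrite mulr_ge0.
- split=> [H|integrable W U X J fr p Wp].
    apply: integr => W U X J fr p Wp.
    have /eqP := H W U X J fr p Wp; rewrite (upperE _ _ _ _ _ fr Wp).
    by rewrite -subr_eq0 addrAC subrr add0r oppr_eq0 mulf_eq0 pnatr_eq0 => /eqP.
  by rewrite (upperE _ _ _ _ _ fr Wp) (A0 _ _ _ _ _ integrable fr Wp) mulr0 subr0.
- split=> [H|integrable W U X J fr p Wp].
    apply: integr => W U X J fr p Wp.
    have /eqP := H W U X J fr p Wp; rewrite (lowerE _ _ _ _ _ fr Wp).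
    by rewrite -subr_eq0 addrAC subrr add0r mulf_eq0 pnatr_eq0 => /eqP.
  by rewrite (lowerE _ _ _ _ _ fr Wp) (A0 _ _ _ _ _ integrable fr Wp) mulr0 addr0.
Qed.
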